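(* Let $n\ge 1$ and let $F:\mathrm{LC}_n\to(-\infty,\infty]$ be a linear and increasing functional. Assume further that: (1) There exists a function $f_0\in\mathrm{LC}_n$ such that $\int_{\mathbb{R}^n} f_0>0$ and $F(f_0)<\infty$. (2) For every sequence $\{f_i\}_{i=1}^{\infty}\subseteq\mathrm{LC}_n$ such that $f_i\uparrow f\in\mathrm{LC}_n$ we have $F(f_i)\to F(f)$. Then there exist a unique positive and finite Borel measure $\mu$ on $\mathbb{R}^n$ with a finite first moment, and a unique positive and finite Borel measure $\nu$ on $\mathbb{S}^{n-1}$, such that $$F(f)=\int_{\mathbb{R}^n}h_f\,d\mu+\int_{\mathbb{S}^{n-1}}h_{K_f}\,d\nu\qquad\text{for all } f\in\mathrm{LC}_n.$$ Conversely, for every positive finite Borel measure $\mu$ on $\mathbb{R}^n$ with a finite first moment and every positive finite Borel measure $\nu$ on $\mathbb{S}^{n-1}$, the functional $F$ defined by this formula is a linear and increasing functional $\mathrm{LC}_n\to(-\infty,\infty]$ satisfying (1) and (2).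
   Context: A function $f:\mathbb{R}^n\to[0,\infty)$, not identically $0$, is log-concave if $f=e^{-\phi}$ with $\phi:\mathbb{R}^n\to(-\infty,\infty]$ convex. $\mathrm{LC}_n$ is the class of all upper semi-continuous log-concave functions on $\mathbb{R}^n$. For $f,g\in\mathrm{LC}_n$ the sup-convolution is $(f\star g)(x)=\sup_{y\in\mathbb{R}^n} f(y)g(x-y)$; if it is finite but not upper semi-continuous, $f\star g$ denotes its closure (upper semi-continuous hull); if it takes the value $+\infty$ it is not an element of $\mathrm{LC}_n$. For $\lambda>0$ the dilation is $(\lambda\cdot f)(x)=f(x/\lambda)^{\lambda}$. The support function of $f\in\mathrm{LC}_n$ is $h_f=(-\log f)^{*}:\mathbb{R}^n\to(-\infty,\infty]$, where $\phi^{*}(y)=\sup_{x\in\mathbb{R}^n}(\langle x,y\rangle-\phi(x))$ is the Legendre transform. $K_f=\overline{\{x\in\mathbb{R}^n: f(x)>0\}}$ is the support of $f$, a closed convex set, and $h_{K_f}:\mathbb{S}^{n-1}\to(-\infty,\infty]$ is its support function $h_{K_f}(\theta)=\sup_{x\in K_f}\langle x,\theta\rangle$. A functional $F:\mathrm{LC}_n\to(-\infty,\infty]$ is linear if $F((\alpha\cdot f)\star(\beta\cdot g))=\alpha F(f)+\beta F(g)$ for all $f,g\in\mathrm{LC}_n$ and all $\alpha,\beta>0$ such that $(\alpha\cdot f)\star(\beta\cdot g)\in\mathrm{LC}_n$. It is increasing if $f\ge g$ pointwise implies $F(f)\ge F(g)$. The notation $f_i\uparrow f$ means $f_1\le f_2\le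 f_3\le\cdots$ and $\lim_{i\to\infty}f_i(x)=f(x)$ for all $x\in\mathbb{R}^n$. A measure $\mu$ has a finite first moment if $\int|x|\,d\mu<\infty$. *)

(* Defs.v *)
From HB Require Import structures.
From mathcomp Require Import all_boot all_order all_algebra.
From mathcomp Require Import all_classical all_reals all_analysis.
From mathcomp Require Import measurable_realfun.

Set Implicit Arguments.
Unset Strict Implicit.
Unset Printing Implicit Defensive.

Import Order.TTheory GRing.Theory Num.Theory.
Import numFieldNormedType.Exports.

Local Open Scope classical_set_scope.
Local Open Scope ring_scope.

(* The library norm on 'rV[R]_n is the sup norm, hence the Euclidean structure
   below. The topologies coincide. *)
Definition dotp (R : realType) (n : nat) (x y : 'rV[R]_n) : R :=
  \sum_(i < n) x ord0 i * y ord0 i.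

Definition enorm (R : realType) (n : nat) (x : 'rV[R]_n) : R :=
  Num.sqrt (dotp x x).

Notation borel_rV R n := (g_sigma_algebraType (@open 'rV[R]_n)).

Section lebesgue_rV.
Context (R : realType).

Lemma measurable_coord (n : nat) (j : 'I_n) :
  measurable_fun [set: borel_rV R n] (fun v : borel_rV R n => v ord0 j).
Proof.
apply: (measurability _ (RGenOpens.measurableE R)) => _ [_ [a [b ->] <-]].
rewrite setTI; apply: sub_sigma_algebra.
by apply: open_comp; [move=> v _; exact: coord_continuous | exact: interval_open].
Qed.

Lemma measurable_fun_rV d (T : measurableType d) (n : nat)
    (f : T -> borel_rV R n) :
  (forall j, measurable_fun [set: T] (fun t => f t ord0 j)) ->
  measurable_fun [set: T] f.
Proof.
move=> mf.
apply: (@measurability _ _ T (borel_rV R n) setT f (@open 'rV[R]_n) erefl).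
move=> _ [U oU <-]; rewrite setTI.
pose box (p : 'rV[rat]_n * rat) : set 'rV[R]_n :=
  [set v | forall j, ball (ratr (p.1 ord0 j) : R) (ratr p.2) (v ord0 j)].
have -> : f @^-1` U =
    \bigcup_p (if `[< box p `<=` U >] then f @^-1` box p else set0).
  apply/seteqP; split=> [t Uft|t [p _]]; last first.
    by case: asboolP => // + ?; exact.
  have /nbhs_ballP[e /= e0 eU] : nbhs (f t) U by apply: open_nbhs_nbhs.
  have e20 : 0 < e / 2 by rewrite divr_gt0.
  have [q /itvP qe] := rat_in_itvoo e20.
  have q0 : 0 < ratr q :> R by rewrite qe.
  have /choice[r rP] j : exists r : rat,
      `|f t ord0 j - ratr r| < ratr q.
    have /rat_in_itvoo[r /itvP re] : f t ord0 j - ratr q < f t ord0 j + ratr q.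
      by rewrite ltrD2l gtrN.
    by exists r; rewrite distrC ltr_distl !re.
  exists (\row_j r j, q) => //; case: asboolP => [_ j|]; first last.
    case=> v bv; apply: eU; split=> // i j; rewrite !ord1.
    rewrite /ball /= (le_lt_trans (ler_distD (ratr (r j)) _ _))//.
    rewrite [ltRHS]splitr ltrD//; first by rewrite (lt_trans (rP j))// qe.
    by have := bv j; rewrite /ball /= mxE => /lt_trans; apply; rewrite qe.
  by rewrite /ball /= mxE distrC.
apply: countable_bigcupT_measurable => [|p]; first exact: countableP.
case: asboolP => // _.
have -> : f @^-1` box p = \bigcap_(j in [set: 'I_n])
    ((fun t => f t ord0 j) @^-1` ball (ratr (p.1 ord0 j) : R) (ratr p.2)).
  by apply/seteqP; split=> t fb j; [move=> _|]; exact: fb.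
apply: fin_bigcap_measurable => // j _.
rewrite -[X in measurable X]setTI; apply: mf => //.
exact: open_measurable (ball_open _ _).
Qed.

Definition cons_rV (n : nat) (p : measurableTypeR R * borel_rV R n) :
    borel_rV R n.+1 :=
  row_mx (p.1%:M : 'rV[R]_1) p.2.

Lemma measurable_cons_rV (n : nat) : measurable_fun setT (@cons_rV n).
Proof.
apply: measurable_fun_rV => j; rewrite /cons_rV.
case: (@splitP 1 n j) => k jk.
  rewrite (_ : j = lshift n k); last exact: val_inj.
  under eq_fun do rewrite (row_mxEl (_ : 'rV_1)) mxE (ord1 k) eqxx mulr1n.
  exact: measurable_fst.
rewrite (_ : j = rshift 1 k); last exact: val_inj.
under eq_fun do rewrite (row_mxEr (_ : 'rV_1)).
by apply: (measurableT_comp (measurable_coord k)); exact: measurable_snd.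
Qed.

(* The product of n copies of the one-dimensional Lebesgue measure, carried over
   from R * ... * R to row vectors. *)
Fixpoint lebesgue_rV (n : nat) : set (borel_rV R n) -> \bar R :=
  match n return set (borel_rV R n) -> \bar R with
  | 0 => dirac (0 : borel_rV R 0)
  | m.+1 => pushforward (@lebesgue_measure R \x @lebesgue_rV m)%E (@cons_rV m)
  end.

Lemma lebesgue_rV_measure (n : nat) :
  exists m : {sigma_finite_measure set (borel_rV R n) -> \bar R},
    @lebesgue_rV n = m :> (set (borel_rV R n) -> \bar R).
Proof.
elim: n => [|n [m IH]] /=; first by exists \d_(0 : borel_rV R 0).
rewrite IH.
pose l : {measure set (measurableTypeR R * borel_rV R n) -> \bar R} :=
  (@lebesgue_measure R \x m)%E.
pose p := measure_function_pushforward__canonical__measure_function_Measure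
  l (@measurable_cons_rV n).
have /sigma_finiteP[A [AT And Afin]] := @sigma_finiteT _ _ R
  (@lebesgue_measure R : {sigma_finite_measure set (measurableTypeR R) -> \bar R}).
have /sigma_finiteP[B [BT Bnd Bfin]] := sigma_finiteT m.
pose C k : set (borel_rV R n.+1) :=
  [set v : 'rV[R]_(1 + n) | A k (v ord0 ord0) /\ B k (rsubmx v)].
have mC k : measurable (C k).
  rewrite (_ : C k = (fun v : borel_rV R n.+1 => v ord0 ord0) @^-1` A k `&`
     (fun v : borel_rV R n.+1 => rsubmx (v : 'rV[R]_(1 + n)) : borel_rV R n)
       @^-1` B k)//.
  apply: measurableI; rewrite -[X in measurable X]setTI.
    by apply: (measurable_coord ord0) => //; exact: (Afin k).1.
  apply: (_ : measurable_fun _ _) => //; last exact: (Bfin k).1.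
  apply: measurable_fun_rV => j; under eq_fun do rewrite mxE.
  exact: measurable_coord.
have cons0 x v : @cons_rV n (x, v) ord0 ord0 = x.
  rewrite /cons_rV /= (_ : @ord0 n = @lshift 1 n ord0); last exact: val_inj.
  by rewrite (row_mxEl (_ : 'rV_1)) mxE eqxx mulr1n.
have CA k : @cons_rV n @^-1` C k = A k `*` B k.
  apply/seteqP; split=> -[x v]; rewrite /preimage /C [mkset]lock /= -lock /=.
    by rewrite cons0 /cons_rV row_mxKr.
  by rewrite cons0 /cons_rV row_mxKr.
have sp : sigma_finite setT p.
  exists C => [|k].
    apply/esym; rewrite -subTset => v _.
    have [i _ Ai] : (\bigcup_i A i) (v ord0 ord0) by rewrite -AT.
    have [j _ Bj] : (\bigcup_i B i) (rsubmx (v : 'rV[R]_(1 + n))) by rewrite -BT.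
    exists (maxn i j) => //; split.
      by move/subsetPset: (And _ _ (leq_maxl i j)); exact.
    by move/subsetPset: (Bnd _ _ (leq_maxr i j)); exact.
  split; first exact: mC.
  rewrite /p /= /pushforward CA /l /= product_measure1E.
  - by apply: lte_mul_pinfty; rewrite ?ge0_fin_numE//;
      [exact: (Afin k).2 | exact: (Bfin k).2].
  - exact: (Afin k).1.
  - exact: (Bfin k).1.
pose q := HB.pack_for {sigma_finite_measure set (borel_rV R n.+1) -> \bar R}
  (Measure.sort p) (Measure_isSigmaFinite.Build _ _ _ (Measure.sort p) sp).
by exists q.
Qed.

Section instances.
Variable n : nat.

Let lebesgue_rV0 : @lebesgue_rV n set0 = 0%E.
Proof. by have [m ->] := lebesgue_rV_measure n; exact: measure0. Qed.

Let lebesgue_rV_ge0 A : (0 <= @lebesgue_rV n A)%E.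
Proof. by have [m ->] := lebesgue_rV_measure n; exact: measure_ge0. Qed.

Let lebesgue_rV_sigma_additive : semi_sigma_additive (@lebesgue_rV n).
Proof.
by have [m ->] := lebesgue_rV_measure n; exact: measure_semi_sigma_additive.
Qed.

HB.instance Definition _ := isMeasure.Build _ _ _ (@lebesgue_rV n)
  lebesgue_rV0 lebesgue_rV_ge0 lebesgue_rV_sigma_additive.

Let lebesgue_rV_sigma_finite : sigma_finite setT (@lebesgue_rV n).
Proof. by have [m ->] := lebesgue_rV_measure n; exact: sigma_finiteT. Qed.

HB.instance Definition _ := Measure_isSigmaFinite.Build _ _ _ (@lebesgue_rV n)
  lebesgue_rV_sigma_finite.

End instances.

End lebesgue_rV.

Definition unit_sphere (R : realType) (n : nat) : set 'rV[R]_n :=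
  [set x | enorm x = 1].

(* sphere R n is the n-dimensional sphere, contained in 'rV[R]_n.+1, with the
   subspace topology; measurable types have to be inhabited, which excludes the
   empty sphere of 'rV[R]_0. *)
Definition sphere (R : realType) (n : nat) : Type :=
  set_type (@unit_sphere R n.+1).

HB.instance Definition _ (R : realType) (n : nat) :=
  Topological.copy (sphere R n) (set_type (@unit_sphere R n.+1)).

Lemma unit_sphere_delta (R : realType) (n : nat) :
  (delta_mx ord0 ord0 : 'rV[R]_n.+1) \in @unit_sphere R n.+1.
Proof.
apply/mem_set; rewrite /unit_sphere /enorm /dotp /= big_ord_recl big1.
  by rewrite !mxE !eqxx mulr1 addr0 sqrtr1.
by move=> i _; rewrite !mxE mul0r.
Qed.

HB.instance Definition _ (R : realType) (n : nat) :=
  isPointed.Build (sphere R n)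
    (exist (fun x => x \in @unit_sphere R n.+1) _ (@unit_sphere_delta R n)).

Notation borel_sphere R n := (g_sigma_algebraType (@open (sphere R n))).

Section log_concave.
Context (R : realType) (n : nat).
Local Open Scope ereal_scope.
Implicit Types (f g : 'rV[R]_n -> R) (u phi : 'rV[R]_n -> \bar R).

(* Only used for functions that avoid -oo, so that the right-hand side is never
   of the form +oo - oo; the library convention is 0 * +oo = 0. *)
Definition convex_fun phi : Prop :=
  forall (x y : 'rV[R]_n) (t : R), (0 <= t <= 1)%R ->
    phi (t *: x + (1 - t) *: y)%R <= t%:E * phi x + (1 - t)%:E * phi y.

Definition upper_semicontinuous u : Prop := lower_semicontinuous (\- u).

Definition log_concave f : Prop :=
  (exists x, f x != 0%R) /\
  exists phi, [/\ forall x, phi x != -oo, convex_fun phi &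
                  forall x, (f x)%:E = expeR (- phi x)].

Record LC := MkLC {
  LC_fun :> 'rV[R]_n -> R;
  LC_log_concave : log_concave LC_fun;
  LC_usc : upper_semicontinuous (EFin \o LC_fun) }.

Definition usc_hull u : 'rV[R]_n -> \bar R :=
  fun x => limf_esup u (nbhs x).

(* The closure does nothing if the supremum is already upper semi-continuous.
   It dominates the supremum, so that if the latter takes the value +oo then so
   does sup_conv f g, which is then not equal to any element of LC. *)
Definition sup_conv f g : 'rV[R]_n -> \bar R :=
  usc_hull (fun x => ereal_sup [set (f y * g (x - y))%:E | y in [set: 'rV[R]_n]]).

Definition dilation (a : R) f : 'rV[R]_n -> R :=
  fun x => (f (a^-1 *: x) `^ a)%R.

Definition legendre phi : 'rV[R]_n -> \bar R :=
  fun y => ereal_sup [set (dotp x y)%:E - phi x | x in [set: 'rV[R]_n]].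

Definition support_fun f : 'rV[R]_n -> \bar R :=
  legendre (fun x => - lne (f x)%:E).

Definition supp f : set 'rV[R]_n := closure [set x | (0 < f x)%R].

Definition set_support_fun (K : set 'rV[R]_n) : 'rV[R]_n -> \bar R :=
  fun y => ereal_sup [set (dotp x y)%:E | x in K].

Implicit Type F : LC -> \bar R.

Definition linear_functional F : Prop :=
  forall (a b : R) (f g h : LC), (0 < a)%R -> (0 < b)%R ->
    (forall x, (h x)%:E = sup_conv (dilation a f) (dilation b g) x) ->
    F h = a%:E * F f + b%:E * F g.

Definition increasing_functional F : Prop :=
  forall f g : LC, (forall x, (g x <= f x)%R) -> F g <= F f.

Definition increases_to (fs : nat -> LC) (f : LC) : Prop :=
  (forall i x, (fs i x <= fs i.+1 x)%R) /\
  (forall x, fs i x @[i --> \oo] --> f x).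

Definition monotone_continuous F : Prop :=
  forall (fs : nat -> LC) (f : LC), increases_to fs f ->
    F (fs i) @[i --> \oo] --> F f.

Definition finite_somewhere F : Prop :=
  exists f0 : LC,
    0 < \int[@lebesgue_rV R n]_(x in [set: borel_rV R n]) (f0 x)%:E /\
    F f0 < +oo.

Definition finite_first_moment (mu : set (borel_rV R n) -> \bar R) : Prop :=
  \int[mu]_(x in [set: borel_rV R n]) (enorm x)%:E < +oo.

End log_concave.

Definition integral_functional (R : realType) (n : nat)
    (mu : set (borel_rV R n.+1) -> \bar R) (nu : set (borel_sphere R n) -> \bar R)
    (f : LC R n.+1) : \bar R :=
  (\int[mu]_(y in [set: borel_rV R n.+1]) support_fun f y +
   \int[nu]_(t in [set: borel_sphere R n])
     set_support_fun (supp f) (\val (t : sphere R n)))%E.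

(* Main.v *)
Require Import Defs.
From HB Require Import structures.
From mathcomp Require Import all_boot all_order all_algebra.
From mathcomp Require Import all_classical all_reals all_analysis.
From mathcomp Require Import measurable_realfun ring lra.

(** Why the theorem holds.  Code a log-concave [f] by its hypograph
    [hyp f = {(x, s) | e^s <= f x}], a closed convex set that is stable under
    lowering the last coordinate, and let a point [z] of the closed Euclidean unit
    ball act on pairs by the linear form [<x, z> + s (1 - |z|)].  The supremum of
    this form over [hyp f], [ball_support (hyp f) z], is
    [(1 - |z|) h_f (z / (1 - |z|))] when [|z| < 1] and the support function of
    [K_f] at [z] when [|z| = 1] ([support_fun_ball], [set_support_fun_ball]).  So
    the ball compactifies the space by its sphere at infinity, the two kinds of
    support function are the restrictions of one function on it, and the sum of the
    two integrals in the theorem is one integral against one measure on the ball: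
    the pairs [(mu, nu)] with [mu] of finite first moment correspond to the finite
    measures on the ball ([ball_measure_exists], [ball_measure_split],
    [ball_decomposition_unique], [integral_functional_ball]).

    With a measure on the ball given, everything reduces to pointwise properties of
    [ball_support].  It is bounded below on the ball, sup-convolution adds it
    ([ball_support_sup_conv]) and it follows increasing limits of functions
    ([cvg_ball_support]); linearity and monotone convergence of the integral do the
    rest.

    Conversely let [F] be a functional with the stated properties.  Every bounded
    set [A] of pairs generates a function [LC_of A], whose hypograph is the closed,
    convex and downward stable hull of [A].  On these functions [F] is monotone and
    additive in the support function of [A] ([LC_of_mink]), because a hypograph is
    determined by its support function: a point outside the hull is separated from
    it by a form coming from the ball ([ball_hull_separated]).  [F] is finite there:
    a function with positive integral is not carried by a hyperplane, hence by
    concavity it exceeds a positive constant on a cube ([hyp_cube]), and a multiple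
    of that cube, translated, dominates any bounded set ([on_pairs_fin]).
    Differences of support functions of bounded sets form a vector lattice of
    continuous functions that contains the constants and the coordinates
    ([support_difference_lattice]), and [F] extends to a positive linear form on it.
    The Daniell construction represents this form by a measure on the ball
    ([daniell_representation]), continuity from below holding by compactness of the
    ball.  Every [f] is an increasing limit of functions [LC_of A] ([LC_approx]), so
    the continuity of [F] extends the formula to all [f].

    The measure on the ball is unique because the positivity sets of the lattice
    generate the Borel sets ([lattice_measure_unique]), and its decomposition into
    [mu] and [nu] is unique because the open ball and the sphere are disjoint. *)

Set Implicit Arguments.
Unset Strict Implicit.
Unset Printing Implicit Defensive.

Import Order.TTheory GRing.Theory Num.Theory.
Import numFieldNormedType.Exports.

Local Open Scope classical_set_scope.
Local Open Scope ring_scope.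

(** * Euclidean geometry and separation *)

Section euclidean.
Context (R : realType) (k : nat).
Implicit Types (x y z : 'rV[R]_k) (a : R).

Lemma dotpC x y : dotp x y = dotp y x.
Proof. by apply: eq_bigr => i _; rewrite mulrC. Qed.

Lemma dotpDl x y z : dotp (x + y) z = dotp x z + dotp y z.
Proof. by rewrite -big_split; apply: eq_bigr => i _; rewrite !mxE mulrDl. Qed.

Lemma dotpDr x y z : dotp z (x + y) = dotp z x + dotp z y.
Proof. by rewrite dotpC dotpDl !(dotpC z). Qed.

Lemma dotpZl a x y : dotp (a *: x) y = a * dotp x y.
Proof. by rewrite mulr_sumr; apply: eq_bigr => i _; rewrite !mxE mulrA. Qed.

Lemma dotpZr a x y : dotp y (a *: x) = a * dotp y x.
Proof. by rewrite dotpC dotpZl dotpC. Qed.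

Lemma dotpNl x y : dotp (- x) y = - dotp x y.
Proof. by rewrite -scaleN1r dotpZl mulN1r. Qed.

Lemma dotpNr x y : dotp y (- x) = - dotp y x.
Proof. by rewrite dotpC dotpNl dotpC. Qed.

Lemma dotp0l x : dotp 0 x = 0.
Proof. by rewrite -(scale0r x) dotpZl mul0r. Qed.

Lemma dotp0r x : dotp x 0 = 0.
Proof. by rewrite dotpC dotp0l. Qed.

Lemma dotp_ge0 x : 0 <= dotp x x.
Proof. by apply: sumr_ge0 => i _; rewrite -expr2 sqr_ge0. Qed.

Lemma dotp_coord x i : x ord0 i ^+ 2 <= dotp x x.
Proof.
rewrite /dotp (bigD1 i)//= -expr2 lerDl; apply: sumr_ge0 => j _.
by rewrite -expr2 sqr_ge0.
Qed.

Lemma dotp_eq0 x : dotp x x = 0 -> x = 0.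
Proof.
move=> x0; apply/rowP => i; rewrite !mxE; apply/eqP.
by rewrite -sqrf_eq0 eq_le sqr_ge0 -x0 dotp_coord.
Qed.

Lemma dotp_delta x i : dotp (delta_mx ord0 i) x = x ord0 i.
Proof.
rewrite /dotp (bigD1 i)//= big1 ?addr0 => [|j ji]; rewrite !mxE !eqxx ?mul1r//.
by rewrite (negbTE ji) mul0r.
Qed.

Lemma enorm_ge0 x : 0 <= enorm x. Proof. exact: sqrtr_ge0. Qed.

Lemma enorm_sqr x : enorm x ^+ 2 = dotp x x.
Proof. by rewrite sqr_sqrtr ?dotp_ge0. Qed.

Lemma enorm0 : enorm (0 : 'rV[R]_k) = 0.
Proof. by rewrite /enorm dotp0l sqrtr0. Qed.

Lemma enorm_eq0 x : enorm x = 0 -> x = 0.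
Proof. by move=> x0; apply: dotp_eq0; rewrite -enorm_sqr x0 expr0n. Qed.

Lemma enormZ a x : enorm (a *: x) = `|a| * enorm x.
Proof.
by rewrite /enorm dotpZl dotpZr mulrA -expr2 sqrtrM ?sqr_ge0// sqrtr_sqr.
Qed.

Lemma enormN x : enorm (- x) = enorm x.
Proof. by rewrite -scaleN1r enormZ normrN normr1 mul1r. Qed.

(** Cauchy-Schwarz, from the square of [enorm y *: x - enorm x *: y]. *)
Lemma dotp_le_enorm x y : dotp x y <= enorm x * enorm y.
Proof.
have [x0|x0] := eqVneq (enorm x) 0.
  by rewrite (enorm_eq0 x0) dotp0l enorm0 mul0r.
have [y0|y0] := eqVneq (enorm y) 0.
  by rewrite (enorm_eq0 y0) dotp0r enorm0 mulr0.
have xp : 0 < enorm x by rewrite lt_def x0 enorm_ge0.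
have yp : 0 < enorm y by rewrite lt_def y0 enorm_ge0.
have := dotp_ge0 (enorm y *: x - enorm x *: y).
rewrite !(dotpDl, dotpDr, dotpNl, dotpNr, dotpZl, dotpZr) -!enorm_sqr.
rewrite (dotpC y x); set d := dotp x y => dp.
rewrite -subr_ge0 -(pmulr_rge0 _ (mulr_gt0 xp yp)).
by nra.
Qed.

Lemma normr_dotp x y : `|dotp x y| <= enorm x * enorm y.
Proof.
by rewrite ler_norml dotp_le_enorm andbT lerNl -dotpNl -(enormN x) dotp_le_enorm.
Qed.

Lemma enormD x y : enorm (x + y) <= enorm x + enorm y.
Proof.
rewrite -(ler_pXn2r (n := 2))// ?nnegrE ?addr_ge0 ?enorm_ge0//.
rewrite sqrrD !enorm_sqr dotpDl !dotpDr (dotpC y x).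
by have := dotp_le_enorm x y; lra.
Qed.

Lemma coord_le_enorm x i : `|x ord0 i| <= enorm x.
Proof. by rewrite -sqrtr_sqr ler_wsqrtr// dotp_coord. Qed.

Lemma mx_norm_le_enorm x : `|x| <= enorm x.
Proof.
rewrite /Num.norm/= mx_normrE; apply: bigmax_le => [|[i j] _]; first exact: enorm_ge0.
by rewrite (ord1 i); exact: coord_le_enorm.
Qed.

End euclidean.

Section euclidean_topology.
Context (R : realType) (k : nat).
Implicit Types (x y z : 'rV[R]_k) (a : R).

Lemma dotp_continuous x : continuous (fun z => dotp x z).
Proof.
apply: (continuous_big (P := xpredT) add_continuous) => i _ z.
by apply: continuousM; [exact: cst_continuous|exact: coord_continuous].
Qed.

Lemma dotp_sqr_continuous : continuous (fun z : 'rV[R]_k => dotp z z).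
Proof.
apply: (continuous_big (P := xpredT) add_continuous) => i _ z.
by apply: continuousM; exact: coord_continuous.
Qed.

Lemma enorm_continuous : continuous (@enorm R k).
Proof.
move=> z; apply: (continuous_comp (f := fun z => dotp z z) (g := Num.sqrt)).
  exact: dotp_sqr_continuous.
exact: sqrt_continuous.
Qed.

Lemma enorm_subr_continuous x : continuous (fun z : 'rV[R]_k => enorm (z - x)).
Proof.
move=> z; apply: (continuous_comp (f := fun z => z - x)).
  exact: cvgB cvg_id (cvg_cst _).
exact: enorm_continuous.
Qed.

Lemma closed_ball_enorm x r : closed [set z : 'rV[R]_k | enorm (z - x) <= r].
Proof.
by have /continuous_closedP/(_ _ (@closed_le R r)) := @enorm_subr_continuous x.
Qed.

Lemma closed_unit_enorm_ball : closed [set z : 'rV[R]_k | enorm z <= 1].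
Proof.
by have := @closed_ball_enorm 0 1; under eq_set do rewrite subr0.
Qed.

Lemma bounded_enorm (A : set 'rV[R]_k) x r :
  (forall z, A z -> enorm (z - x) <= r) -> bounded_set A.
Proof.
move=> Ar; exists (r + `|x|); split; first by rewrite num_real.
move=> M rM z Az /=; have := ler_normD (z - x) x; rewrite subrK => /le_trans.
apply; rewrite (le_trans _ (ltW rM))// lerD2r (le_trans (mx_norm_le_enorm _))//.
exact: Ar.
Qed.

End euclidean_topology.

Definition convex_subset (R : realType) (V : lmodType R) (S : set V) :=
  forall x y t, S x -> S y -> 0 <= t <= 1 -> S (t *: x + (1 - t) *: y).

(** The point of the closure of [S] nearest to [p] exists by compactness, and
    the segments from it to the points of [S] do not come closer to [p]. *)
Lemma separation (R : realType) (k : nat) (S : set 'rV[R]_k.+1) p :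
  convex_subset S -> S !=set0 -> ~ closure S p ->
  exists w e, 0 < e /\ forall q, S q -> dotp q w + e <= dotp p w.
Proof.
move=> cS [s0 Ss0] clSp.
pose r := enorm (s0 - p).
pose C := closure S `&` [set z | enorm (z - p) <= r].
have C0 : C !=set0 by exists s0; split; [exact: subset_closure|exact: lexx].
have cC : compact C.
  apply: bounded_closed_compact; first by apply: (@bounded_enorm _ _ _ p r) => z [].
  by apply: closedI; [exact: closed_closure|exact: closed_ball_enorm].
have cf := @enorm_subr_continuous R k.+1 p.
have [c /set_mem[clc cr] cmin] := EVT_min_rV C0 cC (continuous_subspaceT cf).
have cmin' z : closure S z -> enorm (c - p) <= enorm (z - p).
  move=> clz; have [zr|/ltW zr] := leP (enorm (z - p)) r.
    by apply: cmin; rewrite inE.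
  exact: le_trans zr.
have w0 : 0 < dotp (p - c) (p - c).
  rewrite lt_def dotp_ge0 andbT; apply/eqP => /dotp_eq0/eqP.
  by rewrite subr_eq0 => /eqP pc; apply: clSp; rewrite pc.
exists (p - c), (dotp (p - c) (p - c)); split => // q Sq.
suff dle0 : dotp (q - c) (p - c) <= 0.
  rewrite -lerBrDr -subr_ge0.
  have -> : dotp p (p - c) - dotp (p - c) (p - c) - dotp q (p - c) =
     - dotp (q - c) (p - c).
    by rewrite !(dotpDl, dotpNl); ring.
  by rewrite oppr_ge0.
set d := dotp (q - c) (p - c).
(* The point at parameter [t] of the segment from [c] to [q] is not nearer to [p];
   a positive [d] is then refuted by letting [t] be small. *)
have step t : 0 < t -> t <= 1 -> 2 * d <= t * dotp (q - c) (q - c).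
  move=> t0 t1.
  have clt : closure S (t *: q + (1 - t) *: c).
    move=> B.
    have ct : continuous (fun z : 'rV[R]_k.+1 => t *: q + (1 - t) *: z).
      by move=> z; exact: cvgD (cvg_cst _) (cvgZ (cvg_cst _) cvg_id).
    move=> /(ct c)/clc[s [Ss Bs]]; exists (t *: q + (1 - t) *: s); split => //.
    by apply: cS => //; rewrite (ltW t0).
  have := cmin' _ clt; rewrite -(ler_pXn2r (n := 2))// ?nnegrE ?enorm_ge0//.
  rewrite !enorm_sqr.
  have -> : t *: q + (1 - t) *: c - p = t *: (q - c) - (p - c).
    by apply/rowP => i; rewrite !mxE; ring.
  rewrite -(opprB p c) dotpNl dotpNr opprK.
  rewrite !(dotpDl (t *: _), dotpDr (t *: _), dotpNl (p - c), dotpNr (p - c)).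
  rewrite !dotpZl !dotpZr (dotpC (p - c) (q - c)) -/d.
  set u := dotp (p - c) _; set v := dotp (q - c) _ => h.
  by rewrite -(ler_pM2l t0); lra.
rewrite leNgt; apply/negP => d0.
set v := dotp (q - c) (q - c) in step.
have v0 : 0 <= v by exact: dotp_ge0.
have [vd|dv] := leP v d; first by have := step 1 ltr01 (lexx _); lra.
have v1 : 0 < v by exact: lt_trans dv.
have := step (d / v); rewrite divr_gt0// ler_pdivrMr// mul1r divfK ?gt_eqF//.
by move=> /(_ isT (ltW dv)); lra.
Qed.

(** * Support functions on the unit ball *)

Section ball_support.
Context (R : realType) (k : nat).
Implicit Types (A B S : set ('rV[R]_k * R)) (p q : 'rV[R]_k * R) (z : 'rV[R]_k).

(** The point [z] stands for the direction [(z, 1 - |z|)].  Up to a positive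
    factor these are all directions with nonnegative last coordinate: those of the
    form [(y, 1)] for [|z| < 1], the horizontal ones for [|z| = 1]. *)
Definition ball_form q z : R := dotp q.1 z + q.2 * (1 - enorm z).

Definition ball_support A z : \bar R :=
  ereal_sup [set (ball_form q z)%:E | q in A].

(** The closed convex hull of [A] and of all points below it, given as an
    intersection of half-spaces. *)
Definition ball_hull A : set ('rV[R]_k * R) :=
  [set p | forall z, enorm z <= 1 -> ((ball_form p z)%:E <= ball_support A z)%E].

Definition mink (a : R) A (b : R) B : set ('rV[R]_k * R) :=
  [set r | exists p q, [/\ A p, B q & r = (a *: p.1 + b *: q.1, a * p.2 + b * q.2)]].

Lemma ball_formD a b p q z :
  ball_form (a *: p.1 + b *: q.1, a * p.2 + b * q.2) z =
  a * ball_form p z + b * ball_form q z.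
Proof. by rewrite /ball_form/= dotpDl !dotpZl; ring. Qed.

Lemma ball_formS (x : 'rV[R]_k) s t z : enorm z <= 1 -> s <= t ->
  ball_form (x, s) z <= ball_form (x, t) z.
Proof.
by move=> z1 st; rewrite /ball_form/= lerD2l ler_wpM2r// subr_ge0.
Qed.

Lemma ball_form_continuous q : continuous (ball_form q).
Proof.
move=> z; exact: cvgD (@dotp_continuous _ _ q.1 z)
  (cvgM (cvg_cst _) (cvgB (cvg_cst _) (@enorm_continuous _ _ z))).
Qed.

Lemma ball_support_ge A q z : A q -> ((ball_form q z)%:E <= ball_support A z)%E.
Proof. by move=> Aq; apply: ereal_sup_ubound; exists q. Qed.

Lemma ball_support_le A z (c : \bar R) :
  (forall q, A q -> ((ball_form q z)%:E <= c)%E) -> (ball_support A z <= c)%E.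
Proof. by move=> h; apply: ge_ereal_sup => _ [q Aq <-]; exact: h. Qed.

Lemma ball_support_gtNy A z : A !=set0 -> (-oo < ball_support A z)%E.
Proof. by move=> [q /(ball_support_ge z)]; apply: lt_le_trans; exact: ltNyr. Qed.

Lemma ball_support_subset A B z :
  A `<=` B -> (ball_support A z <= ball_support B z)%E.
Proof. by move=> AB; apply: ball_support_le => q /AB; exact: ball_support_ge. Qed.

(** The two suprema run over independent variables.  Infinite values of the
    supports are excluded one at a time, by bounding one variable with the other
    one fixed. *)
Lemma ball_support_mink a A b B z : 0 < a -> 0 < b -> A !=set0 -> B !=set0 ->
  (ball_support (mink a A b B) z =
   a%:E * ball_support A z + b%:E * ball_support B z)%E.
Proof.
move=> a0 b0 A0 B0; apply/eqP; rewrite eq_le; apply/andP; split.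
  apply: ball_support_le => _ [p [q [Ap Bq ->]]].
  rewrite ball_formD EFinD !EFinM leeD// lee_wpmul2l ?lee_fin ?(ltW a0, ltW b0)//;
    exact: ball_support_ge.
have [p0 Ap0] := A0; have [q0 Bq0] := B0.
have ub p q : A p -> B q -> ((a * ball_form p z + b * ball_form q z)%:E <=
    ball_support (mink a A b B) z)%E.
  by move=> Ap Bq; rewrite -ball_formD; apply: ball_support_ge; exists p, q.
case: (ball_support (mink a A b B) z) ub => [T| |] ub; last 2 first.
- by rewrite leey.
- by have := ub _ _ Ap0 Bq0; rewrite leeNy_eq.
have hA q : B q -> (ball_support A z <= ((T - b * ball_form q z) / a)%:E)%E.
  move=> Bq; apply: ball_support_le => p Ap; rewrite lee_fin ler_pdivlMr// mulrC.
  by rewrite lerBrDr -lee_fin; exact: ub.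
have := ball_support_gtNy z A0.
case: (ball_support A z) hA => [u| |//] hA _; last first.
  by have := hA _ Bq0; rewrite leye_eq.
have hB : (ball_support B z <= ((T - a * u) / b)%:E)%E.
  apply: ball_support_le => q Bq; rewrite lee_fin ler_pdivlMr// mulrC.
  by have := hA _ Bq; rewrite lee_fin ler_pdivlMr//; lra.
have := ball_support_gtNy z B0.
case: (ball_support B z) hB => [v| |//] hB _; last by move: hB; rewrite leye_eq.
move: hB; rewrite -!EFinM -EFinD !lee_fin ler_pdivlMr//; lra.
Qed.

Lemma ball_hull_support A z :
  enorm z <= 1 -> ball_support (ball_hull A) z = ball_support A z.
Proof.
move=> z1; apply/eqP; rewrite eq_le; apply/andP; split.
  by apply: ball_support_le => q; exact.
by apply: ball_support_subset => q Aq y y1; exact: ball_support_ge.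
Qed.

Lemma sub_ball_hull A : A `<=` ball_hull A.
Proof. by move=> q Aq y y1; exact: ball_support_ge. Qed.

Lemma ball_hull_le A B :
  (forall z, enorm z <= 1 -> (ball_support A z <= ball_support B z)%E) ->
  ball_hull A `<=` ball_hull B.
Proof. by move=> AB q Aq z z1; exact: le_trans (Aq _ z1) (AB _ z1). Qed.

Lemma ball_hull_down A (x : 'rV[R]_k) s t :
  s <= t -> ball_hull A (x, t) -> ball_hull A (x, s).
Proof.
move=> st At z z1; apply: le_trans (At _ z1).
by rewrite lee_fin ball_formS.
Qed.

Definition convex_pairs S := forall p q t, S p -> S q -> 0 <= t <= 1 ->
  S (t *: p.1 + (1 - t) *: q.1, t * p.2 + (1 - t) * q.2).

Lemma ball_hull_convex A : convex_pairs (ball_hull A).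
Proof.
move=> p q t Ap Aq /andP[t0 t1] z z1; rewrite ball_formD.
have := Ap _ z1; have := Aq _ z1.
case: (ball_support A z) => [T| |]; rewrite ?leey ?leeNy_eq ?lee_fin//.
by move=> h1 h2; nra.
Qed.

Lemma mink_convex a A b B :
  convex_pairs A -> convex_pairs B -> convex_pairs (mink a A b B).
Proof.
move=> cA cB _ _ t [p [q [Ap Bq ->]]] [p' [q' [Ap' Bq' ->]]] t01/=.
exists (t *: p.1 + (1 - t) *: p'.1, t * p.2 + (1 - t) * p'.2).
exists (t *: q.1 + (1 - t) *: q'.1, t * q.2 + (1 - t) * q'.2).
split; [exact: cA|exact: cB|congr (_, _) => /=; last by ring].
by apply/rowP => i; rewrite !mxE; ring.
Qed.

End ball_support.

(** A form that separates a point from a downward stable convex set has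
    nonnegative weight on the last coordinate, hence is a positive multiple of a
    form given by a point of the ball.  Weight zero is allowed: it gives a point of
    the sphere, so separation by a vertical hyperplane needs no approximation by
    other ones. *)
Lemma ball_hull_separated (R : realType) (k : nat) (S : set ('rV[R]_k.+1 * R))
    (x0 : 'rV[R]_k.+1) (s0 d : R) (V : set 'rV[R]_k.+1) :
  convex_pairs S -> S !=set0 ->
  (forall x s t, s <= t -> S (x, t) -> S (x, s)) ->
  nbhs x0 V -> 0 < d -> (forall q, S q -> V q.1 -> q.2 + d <= s0) ->
  ~ ball_hull S (x0, s0).
Proof.
move=> cS [[x1 s1] S1] dS nV d0 SV.
(* [j] writes pairs as vectors, to which [separation] applies. *)
pose j (q : 'rV[R]_k.+1 * R) : 'rV[R]_(1 + k.+1) := row_mx (q.2%:M : 'rV_1) q.1.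
have dotj (q : 'rV[R]_k.+1 * R) (w : 'rV[R]_(1 + k.+1)) :
    dotp (j q) w = q.2 * lsubmx w ord0 ord0 + dotp q.1 (rsubmx w).
  rewrite /dotp /j big_split_ord/= big_ord1; congr (_ + _).
    by rewrite !mxE/= (unsplitK (inl _))/= !mxE eqxx mulr1n.
  by apply: eq_bigr => i _; rewrite !mxE/= (unsplitK (inr _)).
have [w [e [e0 we]]] : exists w e, 0 < e /\
    forall q, (j @` S) q -> dotp q w + e <= dotp (j (x0, s0)) w.
  apply: separation.
  - move=> _ _ t [p Sp <-] [q Sq <-] t01.
    exists (t *: p.1 + (1 - t) *: q.1, t * p.2 + (1 - t) * q.2); first exact: cS.
    apply/rowP => i; rewrite /j !mxE/=.
    by case: splitP => i' _; rewrite !mxE// (ord1 i') eqxx !mulr1n.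
  - by exists (j (x1, s1)), (x1, s1).
  move: nV => /nbhs_ballP[e /= e0 eV].
  move=> /(_ (ball (j (x0, s0)) (Num.min e d))) [].
    by apply: nbhsx_ballx; rewrite lt_min e0 d0.
  move=> _ [[[q s] Sq <-] [_ bq]].
  have qV : V q.
    apply: eV; split => // i0 i; have := bq ord0 (rshift 1 i).
    rewrite !row_mxEr (ord1 i0) /ball/= => /lt_le_trans; apply.
    by rewrite ge_min lexx.
  have := SV _ Sq qV; rewrite leNgt => /negP; apply => /=.
  have := bq ord0 (lshift k.+1 ord0).
  rewrite !row_mxEl !mxE eqxx !mulr1n /ball/= lt_min => /andP[_].
  by rewrite ltr_norml => /andP[_]; rewrite ltrBlDr addrC.
set y : 'rV[R]_k.+1 := rsubmx w; set t : R := lsubmx w ord0 ord0.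
have yt q : S q -> q.2 * t + dotp q.1 y + e <= s0 * t + dotp x0 y.
  by move=> Sq; have := we (j q); rewrite !dotj; apply; exists q.
have t0 : 0 <= t.
  rewrite leNgt; apply/negP => tn.
  (* Were [t] negative, lowering the pair [(x1, s1)] far enough would violate the
     separation [yt]. *)
  pose s := Num.min s1 ((s0 * t + dotp x0 y - dotp x1 y) / t).
  have /yt/= : S (x1, s) by apply: dS S1; rewrite ge_min lexx.
  have : s0 * t + dotp x0 y - dotp x1 y <= s * t.
    by rewrite -ler_ndivlMr// ge_min lexx orbT.
  by lra.
have c0 : 0 < enorm y + t.
  rewrite lt_def addr_ge0 ?enorm_ge0// andbT; apply/eqP => c0.
  have y0 : enorm y = 0 by have := enorm_ge0 y; lra.
  have tz : t = 0 by move: c0; rewrite y0 add0r.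
  by have := yt _ S1; rewrite tz (enorm_eq0 y0) !dotp0r; lra.
set c := enorm y + t in c0; pose z := c^-1 *: y.
have nz : enorm z = enorm y / c by rewrite enormZ gtr0_norm ?invr_gt0// mulrC.
have z1 : enorm z <= 1 by rewrite nz ler_pdivrMr// mul1r lerDl.
have fz q : ball_form q z = (q.2 * t + dotp q.1 y) / c.
  rewrite /ball_form nz /z dotpZr.
  have -> : 1 - enorm y / c = t / c.
    by rewrite -{1}(divff (lt0r_neq0 c0)) -mulrBl /c addrAC subrr add0r.
  by ring.
move=> /(_ z z1); apply/negP; rewrite -ltNge.
apply: (@le_lt_trans _ _ ((ball_form (x0, s0) z - e / c)%:E)).
  apply: ball_support_le => q Sq; rewrite lee_fin !fz -mulrBl.
  by rewrite ler_pM2r ?invr_gt0//= lerBrDr; exact: yt.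
by rewrite lte_fin ltrBlDr ltrDl divr_gt0.
Qed.

(** * Log-concave functions as hypographs *)

Section log_concave_functions.
Context (R : realType) (k : nat).
Implicit Types (A B S : set ('rV[R]_k * R)) (p q : 'rV[R]_k * R).
Implicit Types (x y z : 'rV[R]_k) (f g h : LC R k).

Definition hyp (f : 'rV[R]_k -> R) : set ('rV[R]_k * R) :=
  [set q | expR q.2 <= f q.1].

Lemma LC_ge0 f x : 0 <= f x.
Proof.
have [_ [phi [_ _ fE]]] := LC_log_concave f.
by rewrite -lee_fin fE expeR_ge0.
Qed.

Lemma hyp_ln f x : 0 < f x -> hyp f (x, ln (f x)).
Proof. by move=> fx; rewrite /hyp/= lnK. Qed.

Lemma hyp_leP f x s : hyp f (x, s) -> 0 < f x /\ s <= ln (f x).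
Proof.
rewrite /hyp/= => sf; have fx := lt_le_trans (expR_gt0 s) sf.
by split => //; rewrite -ler_expR lnK.
Qed.

Lemma hyp_down (f : 'rV[R]_k -> R) x s t :
  s <= t -> hyp f (x, t) -> hyp f (x, s).
Proof. by move=> st; apply: le_trans; rewrite ler_expR. Qed.

Lemma LC_neq0 f : exists x, 0 < f x.
Proof.
have [[x fx] _] := LC_log_concave f.
by exists x; rewrite lt_def fx LC_ge0.
Qed.

Lemma hyp_neq0 f : hyp f !=set0.
Proof. by have [x fx] := LC_neq0 f; exists (x, ln (f x)); exact: hyp_ln. Qed.

Lemma hyp_convex f : convex_pairs (hyp f).
Proof.
have [_ [phi [phiNy cphi fE]]] := LC_log_concave f.
have hypE x s : hyp f (x, s) <-> (phi x <= (- s)%:E)%E.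
  rewrite /hyp/= -lee_fin fE (_ : (expR s)%:E = expeR s%:E)// lee_expeR.
  by rewrite leeNr.
move=> [x s] [y r] t /hypE xs /hypE yr /= t01.
have /andP[t0 t1] := t01.
apply/hypE; apply: le_trans (cphi x y t t01) _.
have -> : (- (t * s + (1 - t) * r))%:E =
    (t%:E * (- s)%:E + (1 - t)%:E * (- r)%:E)%E.
  by rewrite -!EFinM -EFinD; congr EFin; ring.
by rewrite leeD// lee_wpmul2l// lee_fin subr_ge0.
Qed.

Lemma usc_lt f x c : f x < c -> exists2 V, nbhs x V & forall y, V y -> f y < c.
Proof.
move=> fc; have lf : lower_semicontinuous (fun y => - (f y)%:E)%E := @LC_usc R k f.
have /lf[V nV Vc] : ((- c)%:E < - (f x)%:E)%E by rewrite -EFinN lte_fin ltrN2.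
by exists V => // y /Vc; rewrite -EFinN lte_fin ltrN2.
Qed.

Lemma lne_EFin_eq0 (f : 'rV[R]_k -> R) x : f x = 0 -> (- lne (f x)%:E)%E = +oo%E.
Proof. by move=> ->; rewrite le0_lneNy. Qed.

(** The endpoints [t = 0] and [t = 1] are treated apart, since there the
    convention [0 * +oo = 0] is what makes the convexity inequality hold at points
    where [f] vanishes. *)
Lemma log_concave_hyp (f : 'rV[R]_k -> R) : (forall x, 0 <= f x) ->
  (exists x, 0 < f x) -> convex_pairs (hyp f) -> log_concave f.
Proof.
move=> f0 [x0 fx0] cf; split; first by exists x0; rewrite gt_eqF.
exists (fun x => (- lne (f x)%:E)%E); split => [x||x].
- by have [fx|fx] := leP (f x) 0; [rewrite le0_lneNy|rewrite lne_EFin].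
- move=> x y t /andP[t0 t1].
  rewrite -[leLHS]/(- lne (f (t *: x + (1 - t) *: y))%:E)%E.
  rewrite -[leRHS]/(t%:E * (- lne (f x)%:E) + (1 - t)%:E * (- lne (f y)%:E))%E.
  have [->|tn0] := eqVneq t 0.
    by rewrite scale0r add0r subr0 scale1r mul0e mul1e add0e.
  have [->|tn1] := eqVneq t 1.
    by rewrite scale1r subrr scale0r addr0 mul0e mul1e adde0.
  have tp : 0 < t by rewrite lt_def tn0.
  have sp : 0 < 1 - t by rewrite subr_gt0 lt_def eq_sym tn1.
  have hx u : f u = 0 \/ 0 < f u.
    by have := f0 u; rewrite le_eqVlt => /predU1P[|]; [left|right].
  have [fx|fx] := hx x.
    rewrite (lne_EFin_eq0 fx) gt0_muley ?lte_fin// addye ?leey//.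
    have [fy|fy] := hx y.
      by rewrite (lne_EFin_eq0 fy) gt0_muley ?lte_fin.
    by rewrite lne_EFin// -EFinN -EFinM.
  have [fy|fy] := hx y.
    by rewrite (lne_EFin_eq0 fy) [X in (_ + X)%E]gt0_muley ?lte_fin// addey ?leey// lne_EFin.
  set w := t * ln (f x) + (1 - t) * ln (f y).
  have wf : expR w <= f (t *: x + (1 - t) *: y).
    apply: (cf (x, ln (f x)) (y, ln (f y)) t); rewrite /hyp/= ?lnK//.
    by rewrite t0 t1.
  rewrite !lne_EFin// ?(lt_le_trans (expR_gt0 _) wf)//.
  rewrite -!EFinN -!EFinM -EFinD lee_fin !mulrN -opprD lerN2.
  by rewrite -ler_expR lnK// posrE (lt_le_trans (expR_gt0 _) wf).
- rewrite oppeK lneK// in_itv/= leey andbT lee_fin; exact: f0.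
Qed.

Definition bounded_pairs A :=
  A !=set0 /\ exists M, forall q, A q -> enorm q.1 <= M /\ `|q.2| <= M.

Lemma ball_support_fin A z : bounded_pairs A ->
  ball_support A z = (fine (ball_support A z))%:E.
Proof.
move=> [A0 [M AM]]; have := ball_support_gtNy z A0.
have : (ball_support A z <= (M * enorm z + M * `|1 - enorm z|)%:E)%E.
  apply: ball_support_le => q /AM[q1 q2]; rewrite lee_fin /ball_form lerD//.
    by rewrite (le_trans (dotp_le_enorm _ _))// ler_wpM2r// enorm_ge0.
  by rewrite (le_trans (ler_norm _))// normrM ler_wpM2r.
by case: (ball_support A z).
Qed.

Lemma ball_hull_ubound A : bounded_pairs A ->
  exists M, forall q, ball_hull A q -> q.2 <= M.
Proof.
move=> bA; exists (fine (ball_support A 0)) => q /(_ 0).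
rewrite enorm0 => /(_ ler01); rewrite ball_support_fin// lee_fin.
by rewrite /ball_form dotp0r enorm0 subr0 mulr1 add0r.
Qed.

Definition hull_fun A x : R := sup [set expR s | s in [set s | ball_hull A (x, s)]].

Lemma hull_fun_ge A x s : bounded_pairs A -> ball_hull A (x, s) ->
  expR s <= hull_fun A x.
Proof.
move=> bA As; apply: ub_le_sup; last by exists s.
have [M AM] := ball_hull_ubound bA; exists (expR M) => _ [t At <-].
by rewrite ler_expR; exact: AM At.
Qed.

(** The fibres of the hull are closed half-lines, so the supremum that defines
    [hull_fun] is attained. *)
Lemma hull_fun_hyp A : bounded_pairs A -> hyp (hull_fun A) = ball_hull A.
Proof.
move=> bA; apply/seteqP; split => [[x s]|[x s]]; last exact: hull_fun_ge.
rewrite /hyp/= => sA z z1.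
have lim t : t < s -> ball_hull A (x, t).
  move=> ts; have tA : expR t < hull_fun A x.
    by apply: lt_le_trans sA; rewrite ltr_expR.
  have [|_ [r Ar <-]] := sup_gt _ tA.
    apply/set0P/eqP => A0; move: tA.
    by rewrite /hull_fun A0 sup0 ltNge expR_ge0.
  by rewrite ltr_expR => /ltW /ball_hull_down; apply.
move: {lim} (fun t ts => lim t ts z z1); rewrite ball_support_fin//.
set T := fine _ => lim; rewrite lee_fin; apply/ler_addgt0Pr => e e0.
have w0 : 0 <= 1 - enorm z by rewrite subr_ge0.
have := lim (s - e); rewrite ltrBlDr ltrDl => /(_ e0); rewrite lee_fin.
have := enorm_ge0 z.
by rewrite /ball_form/=; nra.
Qed.

Lemma hull_fun_ge0 A x : 0 <= hull_fun A x.
Proof.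
rewrite /hull_fun; set E := (X in sup X).
have [supE|/sup_out->//] := pselect (has_sup E).
have [[r [s As sr]] _] := supE; rewrite (@le_trans _ _ r)//.
  by rewrite -sr expR_ge0.
by apply: sup_upper_bound => //; exists s.
Qed.

(** For upper semi-continuity: a point above the hull violates one of the
    defining inequalities strictly, and this inequality stays violated nearby. *)
Lemma hull_fun_LC A : bounded_pairs A ->
  log_concave (hull_fun A) /\ upper_semicontinuous (EFin \o hull_fun A).
Proof.
move=> bA; have f0 := @hull_fun_ge0 A.
split.
  apply: log_concave_hyp => //; last first.
    by rewrite hull_fun_hyp//; exact: ball_hull_convex.
  have [[[x s] Axs] _] := bA; exists x.
  by apply: lt_le_trans (hull_fun_ge bA (sub_ball_hull Axs)); exact: expR_gt0.
suff lA : lower_semicontinuous (fun y => - (hull_fun A y)%:E)%E by exact: lA.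
move=> x a; rewrite -EFinN lte_fin ltrNr.
set c := - a => fc; have c0 : 0 < c by exact: le_lt_trans fc.
have hypc y : hyp (hull_fun A) (y, ln c) = (c <= hull_fun A y).
  by rewrite /hyp/= lnK.
have : ~ ball_hull A (x, ln c).
  by rewrite -hull_fun_hyp// hypc leNgt fc.
move=> /existsNP[z /not_implyP[z1 /negP]]; rewrite -ltNge ball_support_fin//.
set T := fine _; rewrite lte_fin => Tx.
pose V := [set y | T < ball_form (y, ln c) z].
exists V.
  apply: (@open_nbhs_nbhs _ x V); split => //.
  rewrite /V (_ : mkset _ = (fun y => ball_form (y, ln c) z) @^-1` [set r | T < r])//.
  apply: open_comp (@open_gt _ T) => y _.
  have -> : (fun y => ball_form (y, ln c) z) =
      (fun y => dotp z y + ln c * (1 - enorm z)).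
    by apply/funext => u; rewrite /ball_form dotpC.
  exact: cvgD (@dotp_continuous _ _ z y) (cvg_cst _).
move=> y Vy; rewrite -EFinN lte_fin ltrNr -/c ltNge.
apply/negP; rewrite -hypc hull_fun_hyp// => /(_ z z1); rewrite ball_support_fin// lee_fin -/T.
by apply/negP; rewrite -ltNge.
Qed.

Definition LC_of A (bA : bounded_pairs A) : LC R k :=
  MkLC (hull_fun_LC bA).1 (hull_fun_LC bA).2.

Lemma hyp_LC_of A (bA : bounded_pairs A) : hyp (LC_of bA) = ball_hull A.
Proof. exact: hull_fun_hyp. Qed.

Lemma hyp_le f g : hyp g `<=` hyp f -> forall x, g x <= f x.
Proof.
move=> gf x; have := LC_ge0 g x; rewrite le_eqVlt => /predU1P[<-|gx].
  exact: LC_ge0.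
by have := gf _ (hyp_ln gx); rewrite /hyp/= lnK.
Qed.

End log_concave_functions.

(** * Duality and sup-convolution *)

Section duality.
Context (R : realType) (k : nat).
Implicit Types (A B S : set ('rV[R]_k.+1 * R)) (x y z : 'rV[R]_k.+1).
Implicit Types (f g h : LC R k.+1).

(** This is Fenchel-Moreau duality: [f] can be recovered from the support
    function of its hypograph.  Upper semi-continuity keeps the hypograph at a
    positive distance below any point above the graph, as separation requires. *)
Lemma ball_hull_hyp f : ball_hull (hyp f) `<=` hyp f.
Proof.
move=> [x s]; apply: contraPP; rewrite {1}/hyp/= => /negP; rewrite -ltNge => fs.
have [m /andP[fm ms]] : exists m, f x < m < expR s.
  by exists ((f x + expR s) / 2); rewrite midf_lt//= midf_lt.
have [V nV Vm] := usc_lt fm.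
have m0 : 0 < m by apply: le_lt_trans fm; exact: LC_ge0.
apply: (@ball_hull_separated _ _ _ x s (s - ln m) V).
- exact: hyp_convex.
- exact: hyp_neq0.
- by move=> ? ? ?; exact: hyp_down.
- exact: nV.
- by rewrite subr_gt0 -ltr_expR lnK.
move=> [y r] /= yr /Vm fy; suff : r <= ln m by lra.
by rewrite -ler_expR lnK// ltW// (le_lt_trans yr).
Qed.

Lemma bounded_mink a A b B : bounded_pairs A -> bounded_pairs B ->
  bounded_pairs (mink a A b B).
Proof.
move=> [[p Ap] [M AM]] [[q Bq] [N BN]]; split.
  by exists (a *: p.1 + b *: q.1, a * p.2 + b * q.2), p, q.
exists (`|a| * M + `|b| * N) => _ [p' [q' [/AM[p1 p2] /BN[q1 q2] ->]]] /=; split.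
  by rewrite (le_trans (enormD _ _))// !enormZ lerD// ler_wpM2l.
by rewrite (le_trans (ler_normD _ _))// !normrM lerD// ler_wpM2l.
Qed.

Lemma mink_down a A b B : 0 < a ->
  (forall x s t, s <= t -> A (x, t) -> A (x, s)) ->
  forall x s t, s <= t -> mink a A b B (x, t) -> mink a A b B (x, s).
Proof.
move=> a0 dA x s t st [[p1 p2] [q [Ap Bq [-> tE]]]].
exists (p1, p2 - (t - s) / a), q; split => //=.
  by apply: dA Ap; rewrite lerBlDr lerDl divr_ge0 ?subr_ge0// ltW.
congr (_, _); rewrite mulrBr mulrCA divff ?gt_eqF// mulr1 tE; ring.
Qed.

Lemma dilation_expR a (f : 'rV[R]_k.+1 -> R) p : 0 < a -> hyp f p ->
  expR (a * p.2) <= dilation a f (a *: p.1).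
Proof.
move=> a0 fp; rewrite /dilation scalerA mulVf ?gt_eqF// scale1r mulrC expRM.
by rewrite ge0_ler_powR ?(ltW a0) ?nnegrE ?expR_ge0// (le_trans (expR_ge0 _) fp).
Qed.

Lemma dilation_gt0 a f y : 0 < a -> 0 < dilation a f y ->
  exists2 p, hyp f p & y = a *: p.1 /\ dilation a f y = expR (a * p.2).
Proof.
move=> a0 fy; have fy0 : 0 < f (a^-1 *: y).
  rewrite lt_def LC_ge0 andbT; apply/eqP => f0.
  by move: fy; rewrite /dilation f0 powR0 ?gt_eqF// ltxx.
exists (a^-1 *: y, ln (f (a^-1 *: y))); first exact: hyp_ln.
by rewrite /dilation/= scalerA divff ?gt_eqF// scale1r mulrC expRM lnK.
Qed.

Lemma sup_conv_hyp a b f g x s : 0 < a -> 0 < b ->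
  mink a (hyp f) b (hyp g) (x, s) ->
  ((expR s)%:E <= sup_conv (dilation a f) (dilation b g) x)%E.
Proof.
move=> a0 b0 [p [q [fp gq [-> ->]]]].
apply: le_ereal_inf_tmp => _ [V nV <-].
apply: le_ereal_sup_tmp.
exists (ereal_sup [set (dilation a f y * dilation b g
   (a *: p.1 + b *: q.1 - y))%:E | y in [set: 'rV[R]_k.+1]]).
  by exists (a *: p.1 + b *: q.1) => //; exact: nbhs_singleton.
apply: le_ereal_sup_tmp; exists ((dilation a f (a *: p.1) *
    dilation b g (a *: p.1 + b *: q.1 - a *: p.1))%:E); first by exists (a *: p.1).
by rewrite lee_fin expRD addrAC subrr add0r ler_pM ?expR_ge0// dilation_expR.
Qed.

(** A value of the closed sup-convolution is approached by decompositions of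
    nearby points, which lie in the Minkowski sum of the hypographs; each linear
    form changes little between nearby points, so the closure does not enlarge the
    support function. *)
Lemma sup_conv_hull a b f g x s : 0 < a -> 0 < b ->
  ((expR s)%:E <= sup_conv (dilation a f) (dilation b g) x)%E ->
  ball_hull (mink a (hyp f) b (hyp g)) (x, s).
Proof.
move=> a0 b0 sx z z1; apply/lee_addgt0Pr => e e0.
have e20 : 0 < e / 2 by rewrite divr_gt0.
pose V := [set y : 'rV[R]_k.+1 | dotp z x - e / 2 < dotp z y].
have nV : nbhs x V.
  apply: (@open_nbhs_nbhs _ x V); split; last by rewrite /V/= ltrBlDr ltrDl.
  by apply: open_comp (@open_gt _ _) => y _; exact: dotp_continuous.
have : ((expR (s - e / 2))%:E < sup_conv (dilation a f) (dilation b g) x)%E.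
  by apply: lt_le_trans sx; rewrite lte_fin ltr_expR ltrBlDr ltrDl.
move=> /lt_le_trans/(_ (ereal_inf_lbound _)).
move=> /(_ _ (ex_intro2 _ _ V nV erefl)) /ereal_sup_gt[_ [y Vy <-]].
move=> /ereal_sup_gt[_ [u _ <-]]; rewrite lte_fin => h.
have df0 : 0 < dilation a f u.
  rewrite lt_def powR_ge0 andbT; apply/eqP => f0.
  by move: h; rewrite f0 mul0r ltNge expR_ge0.
have dg0 : 0 < dilation b g (y - u).
  rewrite lt_def powR_ge0 andbT; apply/eqP => g0.
  by move: h; rewrite g0 mulr0 ltNge expR_ge0.
have [p fp [up fE]] := dilation_gt0 a0 df0.
have [q gq [uq gE]] := dilation_gt0 b0 dg0.
move: h; rewrite fE gE -expRD ltr_expR => h.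
have yE : y = a *: p.1 + b *: q.1 by rewrite -up -uq addrC subrK.
have : mink a (hyp f) b (hyp g) (y, a * p.2 + b * q.2).
  by exists p, q; split => //; rewrite yE.
move=> /(ball_support_ge z) yz; apply: le_trans (leeD2r _ yz).
rewrite -EFinD lee_fin /ball_form/= ![dotp _ z]dotpC.
have := enorm_ge0 z; move: Vy; rewrite /V/= => Vy z0.
by nra.
Qed.

Lemma ball_support_sup_conv a b f g h z : 0 < a -> 0 < b -> enorm z <= 1 ->
  (forall x, (h x)%:E = sup_conv (dilation a f) (dilation b g) x) ->
  ball_support (hyp h) z =
  (a%:E * ball_support (hyp f) z + b%:E * ball_support (hyp g) z)%E.
Proof.
move=> a0 b0 z1 hE.
rewrite -ball_support_mink//; [|exact: hyp_neq0|exact: hyp_neq0].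
apply/eqP; rewrite eq_le; apply/andP; split.
  rewrite -[leRHS]ball_hull_support//; apply: ball_support_subset => -[x s] sx.
  by apply: sup_conv_hull => //; rewrite -hE lee_fin.
apply: ball_support_subset => -[x s] /sup_conv_hyp; rewrite -hE lee_fin.
exact.
Qed.

(** The hypograph of the left-hand side and the Minkowski sum of those on the
    right have the same support function.  If the sup-convolution were
    smaller at [x], a point of the hull of the Minkowski sum would be separated from
    this sum by a vertical gap over a neighbourhood of [x]; the converse inequality
    is [sup_conv_hull]. *)
Lemma LC_of_mink a b A B (bA : bounded_pairs A) (bB : bounded_pairs B)
    (bAB : bounded_pairs (mink a A b B)) x : 0 < a -> 0 < b ->
  (LC_of bAB x)%:E = sup_conv (dilation a (LC_of bA)) (dilation b (LC_of bB)) x.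
Proof.
move=> a0 b0; set f := LC_of bA; set g := LC_of bB; set h := LC_of bAB.
pose S := mink a (hyp f) b (hyp g).
have SE z : enorm z <= 1 -> ball_support S z = ball_support (mink a A b B) z.
  have [A0 B0 f0 g0] := And4 bA.1 bB.1 (hyp_neq0 f) (hyp_neq0 g).
  by move=> z1; rewrite !ball_support_mink// !hyp_LC_of !ball_hull_support.
have Sh p : ball_hull S p -> hyp h p.
  by rewrite hyp_LC_of; apply: ball_hull_le => z z1; rewrite SE.
have hS p : hyp h p -> ball_hull S p.
  by rewrite hyp_LC_of; apply: ball_hull_le => z z1; rewrite SE.
apply/eqP; rewrite eq_le; apply/andP; split; rewrite leNgt; apply/negP.
  move=> /ereal_inf_lt[_ [V nV <-]] Vh.
  have : (0 <= ereal_sup ((fun x0 => ereal_sup [set (dilation a f y *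
      dilation b g (x0 - y))%:E | y in [set: 'rV[R]_k.+1]]) @` V))%E.
    apply: le_ereal_sup_tmp; eexists; first by exists x => //; exact: nbhs_singleton.
    apply: le_ereal_sup_tmp; eexists; first by exists 0.
    by rewrite lee_fin mulr_ge0// powR_ge0.
  case: (ereal_sup _) Vh (@ereal_sup_ubound _ ((fun x0 => ereal_sup
    [set (dilation a f y * dilation b g (x0 - y))%:E | y in [set: 'rV[R]_k.+1]])
    @` V)) => [r| |//] //; rewrite lte_fin lee_fin => rh Vr r0.
  have hx : 0 < h x by exact: le_lt_trans rh.
  have [m /andP[rm mh]] : exists m, r < m < h x.
    by exists ((r + h x) / 2); rewrite midf_lt//= midf_lt.
  have m0 : 0 < m by exact: le_lt_trans rm.
  have := hS _ (hyp_ln hx).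
  apply: (@ball_hull_separated _ _ _ x (ln (h x)) (ln (h x) - ln m) V) => //.
  - by apply: mink_convex; exact: hyp_convex.
  - have [p fp] := hyp_neq0 f; have [q gq] := hyp_neq0 g.
    by exists (a *: p.1 + b *: q.1, a * p.2 + b * q.2), p, q.
  - by apply: mink_down => // ? ? ?; exact: hyp_down.
  - by rewrite subr_gt0 -ltr_expR !lnK.
  move=> [y s] /= [p [q [fp gq [yE sE]]]] Vy.
  suff : s <= ln m by lra.
  rewrite -ler_expR lnK//; apply: le_trans (ltW rm).
  rewrite -lee_fin; apply: le_trans (Vr _ _); last by exists y.
  apply: le_ereal_sup_tmp; eexists; first by exists (a *: p.1).
  by rewrite lee_fin sE expRD yE addrAC subrr add0r ler_pM ?expR_ge0// dilation_expR.
move=> hs.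
have [m [m0 hm ms]] : exists m, [/\ 0 < m, h x < m &
    (m%:E <= sup_conv (dilation a f) (dilation b g) x)%E].
  have h0 := LC_ge0 h x.
  case: (sup_conv _ _ _) hs => [r| |]//.
    by rewrite lte_fin => hr; exists r; split => //; exact: le_lt_trans hr.
  by move=> _; exists (h x + 1); split; rewrite ?leey//; lra.
have := @sup_conv_hull a b f g x (ln m) a0 b0; rewrite lnK// => /(_ ms) /Sh.
by rewrite /hyp/= lnK// leNgt hm.
Qed.

(** The hypograph is truncated to bounded sets; at each point the limit is
    reached after finitely many steps. *)
Lemma LC_approx f : exists (A : nat -> set ('rV[R]_k.+1 * R))
  (bA : forall i, bounded_pairs (A i)), increases_to (fun i => LC_of (bA i)) f.
Proof.
have [p0 fp0] := hyp_neq0 f.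
have [i0 [pi1 pi2]] : exists i0 : nat, enorm p0.1 <= i0%:R /\ `|p0.2| <= i0%:R.
  exists (maxn (Num.truncn (enorm p0.1)).+1 (Num.truncn `|p0.2|).+1); split.
    by rewrite (le_trans (ltW (truncnS_gt _)))// ler_nat leq_maxl.
  by rewrite (le_trans (ltW (truncnS_gt _)))// ler_nat leq_maxr.
pose A (i : nat) := hyp f `&`
  [set q | enorm q.1 <= (i0 + i)%:R /\ `|q.2| <= (i0 + i)%:R].
have bA i : bounded_pairs (A i).
  split; last by exists (i0 + i)%:R => q [].
  exists p0; split => //; split.
    by rewrite (le_trans pi1)// ler_nat leq_addr.
  by rewrite (le_trans pi2)// ler_nat leq_addr.
exists A, bA; split => [i|x].
  apply: hyp_le; rewrite !hyp_LC_of; apply: ball_hull_le => z z1.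
  apply: ball_support_subset => q [fq [q1 q2]]; split => //; split.
    by rewrite (le_trans q1)// ler_nat addnS.
  by rewrite (le_trans q2)// ler_nat addnS.
have le_f i y : LC_of (bA i) y <= f y.
  apply: hyp_le; rewrite hyp_LC_of; apply: subset_trans (@ball_hull_hyp f).
  by apply: ball_hull_le => z z1; apply: ball_support_subset => q [].
have [fx|fx] : f x = 0 \/ 0 < f x.
  by have := LC_ge0 f x; rewrite le_eqVlt => /predU1P[|]; [left|right].
  have -> : (fun i => LC_of (bA i) x) = cst (f x).
    by apply/funext => i; apply/eqP; rewrite eq_le le_f fx LC_ge0.
  exact: cvg_cst.
apply: cvg_near_cst.
near=> i; apply/eqP; rewrite eq_le le_f/=.
have : hyp (LC_of (bA i)) (x, ln (f x)).
  rewrite hyp_LC_of; apply: sub_ball_hull; split; first exact: hyp_ln.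
  split => /=; rewrite (@le_trans _ _ i%:R) ?ler_nat ?leq_addl//; near: i;
    exact: nbhs_infty_ger.
by rewrite /hyp/= lnK.
Unshelve. all: by end_near. Qed.

End duality.

(** * Measures from positive functionals on vector lattices *)

Section vector_lattice.
Context d (T : measurableType d) (R : realType) (X : set T) (D : (T -> R) -> Prop).

(** Boundedness is asked for on [X] only, where the measures to be built live. *)
Record vector_lattice := VectorLattice {
  lattice1 : D (cst 1);
  lattice_lin : forall a u b v, D u -> D v -> D (fun x => a * u x + b * v x);
  lattice_max : forall u v, D u -> D v -> D (fun x => Num.max (u x) (v x));
  lattice_bnd : forall u, D u -> exists M, forall x, X x -> `|u x| <= M;
  lattice_meas : forall u, D u -> measurable_fun setT u;
  lattice_gen : @measurable d T `<=` <<s [set [set x | 0 < u x] | u in D] >> }.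

Hypothesis DL : vector_lattice.

Lemma lattice_scale a u : D u -> D (fun x => a * u x).
Proof.
move=> Du; rewrite (_ : (fun x => _) = (fun x => a * u x + 0 * u x)).
  exact: lattice_lin.
by apply/funext => x; rewrite mul0r addr0.
Qed.

Lemma lattice_sub u v : D u -> D v -> D (fun x => u x - v x).
Proof.
move=> Du Dv; rewrite (_ : (fun x => _) = (fun x => 1 * u x + (-1) * v x)).
  exact: lattice_lin.
by apply/funext => x; rewrite mul1r mulN1r.
Qed.

Lemma lattice_add u v : D u -> D v -> D (fun x => u x + v x).
Proof.
move=> Du Dv; rewrite (_ : (fun x => _) = (fun x => 1 * u x + 1 * v x)).
  exact: lattice_lin.
by apply/funext => x; rewrite !mul1r.
Qed.

Lemma lattice_cst a : D (cst a).
Proof.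
rewrite (_ : cst a = (fun x => a * cst 1 x)); first exact/lattice_scale/lattice1.
by apply/funext => x /=; rewrite mulr1.
Qed.

Lemma lattice_min u v : D u -> D v -> D (fun x => Num.min (u x) (v x)).
Proof.
move=> Du Dv; rewrite (_ : (fun x => _) =
    (fun x => -1 * Num.max (-1 * u x) (-1 * v x))).
  by apply/lattice_scale/lattice_max => //; exact: lattice_scale.
by apply/funext => x; rewrite !mulN1r oppr_max !opprK.
Qed.

(** As [n] grows these functions increase to the indicator function of the set
    where [u] is positive. *)
Definition cutoff (u : T -> R) (n : nat) (x : T) : R :=
  Num.min 1 (n%:R * Num.max (u x) 0).

Lemma cutoff_lattice u n : D u -> D (cutoff u n).
Proof.
move=> Du; apply: lattice_min; first exact: lattice1.
by apply: lattice_scale; apply: lattice_max => //; exact: lattice_cst.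
Qed.

Lemma cutoff_ge0 u n x : 0 <= cutoff u n x.
Proof. by rewrite le_min ler01 mulr_ge0// le_max lexx orbT. Qed.

Lemma cutoff_nd u m n x : (m <= n)%N -> cutoff u m x <= cutoff u n x.
Proof.
move=> mn; rewrite /cutoff le_min !ge_min lexx/=; apply/orP; right.
by rewrite ler_wpM2r ?ler_nat// le_max lexx orbT.
Qed.

Lemma cutoff0 u n x : u x <= 0 -> cutoff u n x = 0.
Proof. by move=> ux; rewrite /cutoff max_r// mulr0 min_r. Qed.

Lemma cutoff1 u x : 0 < u x -> exists N, forall n, (N <= n)%N -> cutoff u n x = 1.
Proof.
move=> ux; exists (Num.truncn (u x)^-1).+1 => n Nn.
rewrite /cutoff min_l// max_l ?(ltW ux)// -ler_pdivrMr// div1r.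
by rewrite (le_trans (ltW (truncnS_gt _)))// ler_nat.
Qed.

End vector_lattice.

Section daniell.
Context d (T : measurableType d) (R : realType) (X : set T) (D : (T -> R) -> Prop).
Context (L : (T -> R) -> R).
Hypothesis DL : vector_lattice X D.
Hypothesis L_lin : forall a u b v, D u -> D v ->
  L (fun x => a * u x + b * v x) = a * L u + b * L v.
Hypothesis L_pos : forall u, D u -> (forall x, X x -> 0 <= u x) -> 0 <= L u.

Lemma daniell_scale a u : D u -> L (fun x => a * u x) = a * L u.
Proof.
move=> Du; rewrite (_ : (fun x => _) = (fun x => a * u x + 0 * u x)).
  by rewrite L_lin// mul0r addr0.
by apply/funext => x; rewrite mul0r addr0.
Qed.

Lemma daniell0 : L (cst 0) = 0.
Proof.
rewrite -[RHS](mul0r (L (cst 0))) -daniell_scale; last exact: lattice_cst DL 0.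
by congr L; apply/funext => x /=; rewrite mul0r.
Qed.

Lemma daniell_sub u v : D u -> D v -> L (fun x => u x - v x) = L u - L v.
Proof.
move=> Du Dv; rewrite (_ : (fun x => _) = (fun x => 1 * u x + (-1) * v x)).
  by rewrite L_lin// mul1r mulN1r.
by apply/funext => x; rewrite mul1r mulN1r.
Qed.

Lemma daniell_add u v : D u -> D v -> L (fun x => u x + v x) = L u + L v.
Proof.
move=> Du Dv; rewrite (_ : (fun x => _) = (fun x => 1 * u x + 1 * v x)).
  by rewrite L_lin// !mul1r.
by apply/funext => x; rewrite !mul1r.
Qed.

Lemma daniell_le u v : D u -> D v -> (forall x, X x -> u x <= v x) -> L u <= L v.
Proof.
move=> Du Dv uv; rewrite -subr_ge0 -daniell_sub//.
by apply: L_pos => [|x Xx]; [exact: (lattice_sub DL)|rewrite subr_ge0 uv].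
Qed.

(** Increasing sequences, rather than series, of nonnegative functions cover
    [A]: this makes countable subadditivity a diagonal argument on partial sums,
    and keeps every bound [c] a real number. *)
Definition covered (A : set T) (c : R) := exists e : nat -> T -> R,
  [/\ forall n, D (e n), forall n x, X x -> e n x <= e n.+1 x,
      forall n x, X x -> 0 <= e n x,
      forall x, A x -> X x -> exists n, 1 <= e n x &
      forall n, L (e n) <= c].

Definition outer (A : set T) : \bar R := ereal_inf [set c%:E | c in covered A].

Lemma covered_ge0 A c : covered A c -> 0 <= c.
Proof.
by move=> [e [De _ e0 _ /(_ 0)]]; apply: le_trans; apply: L_pos => //; exact: e0.
Qed.

Lemma covered1 A : covered A (L (cst 1)).
Proof.
have D1 := lattice1 DL; exists (fun=> cst 1); split => //.
by move=> x _ _; exists 0.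
Qed.

Lemma outer_le A c : covered A c -> (outer A <= c%:E)%E.
Proof. by move=> Ac; apply: ereal_inf_lbound; exists c. Qed.

Lemma outer_ge0 A : (0 <= outer A)%E.
Proof.
by apply: le_ereal_inf_tmp => _ [c /covered_ge0 c0 <-]; rewrite lee_fin.
Qed.

Lemma outer_fin A : outer A \is a fin_num.
Proof.
rewrite ge0_fin_numE ?outer_ge0//.
by apply: le_lt_trans (outer_le (covered1 A)) _; exact: ltry.
Qed.

Lemma outer_null A : A `&` X = set0 -> outer A = 0%E.
Proof.
move=> AX; apply/eqP; rewrite eq_le outer_ge0 andbT; apply: outer_le.
have D0 := lattice_cst DL 0.
exists (fun=> cst 0); split => //.
  by move=> x Ax Xx; have : (A `&` X) x by []; rewrite AX.
by move=> _; rewrite daniell0.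
Qed.

Lemma outer0 : outer set0 = 0%E. Proof. by apply: outer_null; rewrite set0I. Qed.

Lemma outer_homo : {homo outer : A B / A `<=` B >-> (A <= B)%E}.
Proof.
move=> A B AB; apply: le_ereal_inf_tmp => _ [c Bc <-]; apply: outer_le.
case: Bc => e [De e_nd e0 e1 Le]; exists e; split => // x /AB; exact: e1.
Qed.

Lemma outer_sigma_subadditive : sigma_subadditive outer.
Proof.
move=> F; apply/lee_addgt0Pr => eps eps0.
apply: le_trans (@epsilon_trick _ (outer \o F) eps xpredT _ (ltW eps0)); last first.
  by move=> n; exact: outer_ge0.
set S := (X in (_ <= X)%E).
have /choice[c cP] k : exists c, covered (F k) c /\
    (c%:E <= outer (F k) + (eps / (2 ^ k.+1)%:R)%:E)%E.
  have [|_ [c Fc <-] /ltW cP] := @lb_ereal_inf_adherent _ _ (eps / (2 ^ k.+1)%:R)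
    _ (outer_fin (F k)); last by exists c.
  by rewrite divr_gt0// ltr0n expn_gt0.
have /choice[e eP] k := (cP k).1.
have c0 k : 0 <= c k by exact: covered_ge0 (cP k).1.
have cS n : ((\sum_(k < n) c k)%:E <= S)%E.
  rewrite -sumEFin -(big_mkord xpredT (fun k => (c k)%:E)).
  apply: le_trans (nneseries_lim_ge n _); last first.
    by move=> k _ _; rewrite adde_ge0 ?outer_ge0// lee_fin divr_ge0// ltW.
  by apply: lee_sum => k _; exact: (cP k).2.
case: S cS => [s| |] cS; last 2 first.
- exact: leey.
- by have := cS 0; rewrite leeNy_eq.
apply: outer_le; exists (fun n x => \sum_(k < n) e k n x).
have De n m : D (fun x => \sum_(k < m) e k n x).
  elim: m => [|m IH]; first by under eq_fun do rewrite big_ord0; exact: lattice_cst DL 0.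
  under eq_fun do rewrite big_ord_recr/=.
  by apply: (lattice_add DL) => //; have [] := eP m.
have Le n m : L (fun x => \sum_(k < m) e k n x) = \sum_(k < m) L (e k n).
  elim: m => [|m IH].
    by under eq_fun do rewrite big_ord0; rewrite big_ord0; exact: daniell0.
  under eq_fun do rewrite big_ord_recr/=.
  rewrite daniell_add; [|exact: De|by have [] := eP m].
  by rewrite IH big_ord_recr.
split.
- by move=> n; exact: De.
- move=> n x Xx; rewrite big_ord_recr/=.
  rewrite -[leLHS]addr0; apply: lerD; last by have [_ _ h _ _] := eP n; exact: h.
  by apply: ler_sum => k _; have [_ h _ _ _] := eP k; exact: h.
- by move=> n x Xx; apply: sumr_ge0 => k _; have [_ _ h _ _] := eP k; exact: h.
- move=> x [j _ Fjx] Xx; have [_ nd e0 /(_ x Fjx Xx)[n en] _] := eP j.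
  pose N := maxn n j.+1.
  have jN : (j < N)%N by rewrite leq_max ltnSn orbT.
  exists N; rewrite (bigD1 (Ordinal jN))//=.
  rewrite -[leLHS]addr0; apply: lerD.
    apply: le_trans en _.
    have ndj : {homo e j ^~ x : i m / (i <= m)%N >-> i <= m}.
      by apply: homo_leq => [//||i]; [exact: le_trans|exact: nd].
    by apply: ndj; exact: leq_maxl.
  by apply: sumr_ge0 => k _; have [_ _ h _ _] := eP k; exact: h.
- move=> n; rewrite Le; have := cS n; rewrite lee_fin; apply: le_trans.
  by apply: ler_sum => k _; have [_ _ _ _ h] := eP k; exact: h.
Qed.

HB.instance Definition _ := isOuterMeasure.Build R T outer
  outer0 outer_ge0 outer_homo outer_sigma_subadditive.

(** Capping a covering of [A] by the cut-offs of [u] yields a covering of the part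
    of [A] where [u] is positive; what the [k]-th cap removes covers the other part,
    and the bounds on [L] of the two coverings add up to the given one. *)
Lemma caratheodory_lattice u : D u -> outer.-caratheodory [set x | 0 < u x].
Proof.
move=> Du; apply: le_caratheodory_measurable => A.
set E := [set x | 0 < u x].
apply: le_ereal_inf_tmp => _ [c Ac <-].
have [e [De nd e0 e1 Le]] := Ac.
have nd' x : X x -> {homo e ^~ x : n m / (n <= m)%N >-> n <= m}.
  by move=> Xx; apply: homo_leq => [//||i]; [exact: le_trans|exact: nd].
(* The [k]-th capped function; subtracting it from the covering gives [part]. *)
pose a k : T -> R := fun x => Num.min (e k x) (cutoff u k x).
have Dmin n k : D (fun x => Num.min (e n x) (cutoff u k x)).
  by apply: (lattice_min DL) => //; exact: cutoff_lattice DL _ _ Du.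
have Da k : D (a k) by exact: Dmin.
have part k : covered (A `&` ~` E) (c - L (a k)).
  exists (fun n x => e (n + k)%N x - Num.min (e (n + k)%N x) (cutoff u k x)).
  split.
  - by move=> n; exact: (lattice_sub DL).
  - move=> n x Xx; rewrite addSn; have := nd (n + k)%N x Xx.
    case: (leP (e (n + k)%N x) (cutoff u k x));
      by case: (leP (e (n + k).+1 x) (cutoff u k x)); lra.
  - by move=> n x Xx; rewrite subr_ge0 ge_min lexx.
  - move=> x [Ax /negP]; rewrite -leNgt => ux Xx.
    have [n en] := e1 x Ax Xx; exists n.
    rewrite cutoff0// min_r ?subr0; last exact: e0.
    by apply: le_trans en _; apply: nd' => //; exact: leq_addr.
  - move=> n; rewrite daniell_sub// lerB//; apply: daniell_le => // x Xx.
    rewrite /a le_min; apply/andP; split; rewrite ge_min.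
      by rewrite nd'// leq_addl.
    by rewrite [X in _ || X]lexx orbT.
change (outer (A `&` E) + outer (A `&` ~` E) <= c%:E)%E.
have r := outer_fin (A `&` ~` E); rewrite -(fineK r) -leeBrDr// -EFinB.
apply: outer_le; exists a; split.
- by move=> n; exact: Dmin.
- move=> n x Xx; rewrite /a le_min; apply/andP; split; rewrite ge_min.
    by rewrite nd.
  by rewrite [X in _ || X]cutoff_nd ?orbT.
- by move=> n x Xx; rewrite /a le_min e0// cutoff_ge0.
- move=> x [Ax ux] Xx; have [n en] := e1 x Ax Xx; have [N cN] := cutoff1 ux.
  exists (maxn n N); rewrite /a le_min cN ?leq_maxr// lexx andbT.
  by apply: le_trans en _; apply: nd' => //; exact: leq_maxl.
- move=> n; rewrite lerBrDr -lerBrDl -lee_fin fineK//; exact: outer_le.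
Qed.

Lemma caratheodory_measurable_sets A : measurable A -> outer.-caratheodory A.
Proof.
move=> /(lattice_gen DL); apply: smallest_sub A; last first.
  by move=> _ [u Du <-]; exact: caratheodory_lattice.
exact: (@sigma_algebra_measurable _ (caratheodory_type outer)).
Qed.

Lemma outer_measure_exists :
  exists m : {finite_measure set T -> \bar R}, m = outer :> (set T -> \bar R).
Proof.
have add : semi_sigma_additive outer.
  move=> A mA tA mUA; apply: (@caratheodory_measure_sigma_additive _ _ outer) => //.
    by move=> i; exact: caratheodory_measurable_sets.
  exact: caratheodory_measurable_sets.
pose m : {measure set T -> \bar R} := HB.pack_for {measure set T -> \bar R}
  outer (isMeasure.Build d T R outer outer0 outer_ge0 add).
have fin : fin_num_fun m by move=> A _; exact: outer_fin.
pose fm : {finite_measure set T -> \bar R} :=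
  HB.pack_for {finite_measure set T -> \bar R} (Measure.sort m)
    (Measure_isFinite.Build _ _ _ (Measure.sort m) fin).
by exists fm.
Qed.

Lemma sum_slices_ge (r eps : R) n : 0 <= r -> 0 < eps ->
  Num.min r (n%:R * eps) <= \sum_(k < n) eps * (k%:R * eps < r)%R%:R.
Proof.
move=> r0 e0; elim: n => [|n IH]; first by rewrite big_ord0 mul0r ge_min lexx orbT.
rewrite big_ord_recr/= -natr1 mulrDl mul1r.
have [nr|rn] := ltP (n%:R * eps) r.
  by move: IH; rewrite mulr1 (min_r (ltW nr)) => IH; rewrite ge_min lerD ?orbT.
by move: IH; rewrite mulr0 addr0 (min_l rn); apply: le_trans; rewrite ge_min lexx.
Qed.

Hypothesis mX : measurable X.

(** Slicing [u] at the levels [k * eps], the measure of each level set is at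
    most [L] of the slice below it divided by [eps]. *)
Lemma integral_le_daniell (m : {measure set T -> \bar R}) u :
  m = outer :> (set T -> \bar R) -> D u -> (forall x, X x -> 0 <= u x) ->
  (\int[m]_(x in X) (u x)%:E <= (L u)%:E)%E.
Proof.
move=> mE Du u0; apply/lee_addgt0Pr => e e0.
have [M uM] := lattice_bnd DL Du.
have L1 : 0 <= L (cst 1) by exact: covered_ge0 (covered1 set0).
pose eps := e / (L (cst 1) + 1).
have eps0 : 0 < eps by rewrite divr_gt0// ltr_wpDl.
pose n := (Num.truncn (M / eps)).+1.
have Mn : M < n%:R * eps by rewrite -ltr_pdivrMr// truncnS_gt.
have mu : measurable_fun setT u := lattice_meas DL Du.
pose E k := [set x | k%:R * eps < u x].
have mE' k : measurable (E k).
  rewrite (_ : E k = setT `&` u @^-1` `]k%:R * eps, +oo[%classic).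
    exact: mu.
  by rewrite setTI; apply/seteqP; split => x; rewrite /E/= in_itv/= andbT.
apply: (@le_trans _ _ (\int[m]_(x in X) (\sum_(k < n.+1) (eps * \1_(E k) x)%:E)%R)%E).
  apply: ge0_le_integral => //.
  - by apply/measurable_EFinP; exact: measurable_funS mu.
  - apply: emeasurable_sum => k; apply/measurable_EFinP.
    by apply: measurable_funM => //; exact: measurable_indic.
  - move=> x Xx; rewrite sumEFin lee_fin.
    have := sum_slices_ge n.+1 (u0 x Xx) eps0.
    rewrite min_l; last first.
      have /ler_normlP[_ uxM] := uM x Xx; rewrite (le_trans uxM)// (le_trans (ltW Mn))//.
      by rewrite ler_pM2r// ler_nat.
    move=> /le_trans; apply; apply: ler_sum => k _.
    by rewrite indicE /E/= mem_setE.
rewrite ge0_integral_sum//; last 2 first.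
- move=> k; apply/measurable_EFinP.
  by apply: measurable_funM => //; exact: measurable_indic.
- by move=> k x _; rewrite lee_fin mulr_ge0// ltW.
have intE k : (\int[m]_(x in X) (eps * \1_(E k) x)%:E = eps%:E * m (E k `&` X))%E.
  under eq_integral do rewrite EFinM.
  rewrite ge0_integralZl//.
  - by rewrite integral_indic.
  - by apply/measurable_EFinP; exact: measurable_indic.
  - by rewrite lee_fin ltW.
under eq_bigr do rewrite intE.
pose w k : T -> R := fun x => Num.min (u x) (k%:R * eps).
have Dw k : D (w k).
  by apply: (lattice_min DL) => //; exact: (lattice_cst DL (k%:R * eps)).
have slice k : (eps%:E * m (E k.+1 `&` X) <= (L (w k.+1) - L (w k))%:E)%E.
  have cE : covered (E k.+1 `&` X) (eps^-1 * (L (w k.+1) - L (w k))).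
    have Dc : D (fun x => eps^-1 * (w k.+1 x - w k x)).
      by apply: (lattice_scale DL); exact: (lattice_sub DL).
    exists (fun=> (fun x => eps^-1 * (w k.+1 x - w k x))); split => //.
    - move=> _ x Xx; rewrite mulr_ge0 ?invr_ge0 ?(ltW eps0)// subr_ge0 /w.
      rewrite le_min !ge_min lexx/=; apply/orP; right.
      by rewrite ler_pM2r// ler_nat.
    - move=> x [Ex _] _; exists 0%N; rewrite /w !min_r ?(ltW Ex)//.
        by rewrite -mulrBl -natrB// subSnn mul1r mulVf ?gt_eqF.
      by apply: le_trans (ltW Ex); rewrite ler_pM2r// ler_nat.
    - move=> _; rewrite daniell_scale ?daniell_sub//; exact: (lattice_sub DL).
  have := outer_le cE; rewrite -mE => h.
  apply: (@le_trans _ _ (eps%:E * (eps^-1 * (L (w k.+1) - L (w k)))%:E)%E).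
    by rewrite lee_wpmul2l// lee_fin ltW.
  by rewrite -EFinM mulrA divff ?gt_eqF// mul1r.
rewrite big_ord_recl/= addeC leeD//; last first.
  apply: (@le_trans _ _ (eps%:E * (L (cst 1))%:E)%E).
    rewrite lee_wpmul2l ?lee_fin ?(ltW eps0)//.
    by have := outer_le (covered1 (E 0 `&` X)); rewrite -mE.
  rewrite -EFinM lee_fin /eps mulrAC ler_pdivrMr ?ltr_wpDl// ler_pM2l//.
  by rewrite lerDl.
apply: (@le_trans _ _ (\sum_(k < n) (L (w k.+1) - L (w k))%:E)%E).
  by apply: lee_sum => k _; exact: slice.
rewrite sumEFin lee_fin -(big_mkord xpredT (fun k => L (w k.+1) - L (w k))).
rewrite telescope_sumr//.
have : L (w n) <= L u by apply: daniell_le => // x _; rewrite /w ge_min lexx.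
have : 0 <= L (w 0%N).
  by apply: L_pos => // x Xx; rewrite /w mul0r le_min lexx u0.
by move=> h1 h2; lra.
Qed.

(** The form [L] is continuous from below at the constant 1, which says that [X]
    has full outer measure. *)
Hypothesis L_compact : forall e : nat -> T -> R, (forall n, D (e n)) ->
  (forall n x, X x -> e n x <= e n.+1 x) -> (forall n x, X x -> 0 <= e n x) ->
  (forall x, X x -> exists n, 1 <= e n x) ->
  forall c, (forall n, L (e n) <= c) -> L (cst 1) <= c.

(** The bound [integral_le_daniell], applied to [M + u] and to [M - u] with
    [|u| <= M], leaves no room for a strict inequality since the total mass of [X] is
    [L 1]. *)
Theorem daniell_representation :
  exists m : {finite_measure set T -> \bar R}, m (~` X) = 0%E /\
    forall u, D u -> (\int[m]_(x in X) (u x)%:E = (L u)%:E)%E.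
Proof.
have [m mE] := outer_measure_exists; exists m; split.
  by rewrite mE outer_null// setIC setICr.
have m1 : m X = (L (cst 1))%:E.
  apply/eqP; rewrite mE eq_le (outer_le (covered1 X)) andTb.
  apply: le_ereal_inf_tmp => _ [c [e [De nd e0 e1 Le]] <-].
  by rewrite lee_fin; apply: (L_compact De) => // x Xx; exact: e1.
move=> u Du; have [M uM] := lattice_bnd DL Du.
have mu : measurable_fun setT u := lattice_meas DL Du.
have D1 := lattice1 DL.
have DM := lattice_cst DL M.
have LM : L (cst M) = M * L (cst 1).
  by rewrite -daniell_scale//; congr L; apply/funext => x /=; rewrite mulr1.
have intM : m.-integrable X (EFin \o cst M).
  exact: finite_measure_integrable_cst.
have intu : m.-integrable X (EFin \o u).
  apply: le_integrable intM => //.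
    by apply/measurable_EFinP; exact: measurable_funS mu.
  by move=> x Xx /=; rewrite lee_fin (le_trans (uM x Xx))// ler_norm.
have h1 : (\int[m]_(x in X) (M + u x)%:E <= (M * L (cst 1) + L u)%:E)%E.
  rewrite -LM -(daniell_add DM Du); apply: integral_le_daniell => //.
    exact: (lattice_add DL DM Du).
  by move=> x /uM /ler_normlP[]; lra.
have h2 : (\int[m]_(x in X) (M - u x)%:E <= (M * L (cst 1) - L u)%:E)%E.
  rewrite -LM -(daniell_sub DM Du); apply: integral_le_daniell => //.
    exact: (lattice_sub DL DM Du).
  by move=> x /uM /ler_normlP[]; lra.
have iM : (\int[m]_(x in X) (cst M x)%:E = (M * L (cst 1))%:E)%E.
  transitivity (M%:E * m X)%E; first exact: (integral_cst m mX M%:E).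
  by rewrite m1.
have e1 : (\int[m]_(x in X) (M + u x)%:E =
    \int[m]_(x in X) (cst M x)%:E + \int[m]_(x in X) (u x)%:E)%E.
  exact: (integralD mX intM intu).
have e2 : (\int[m]_(x in X) (M - u x)%:E =
    \int[m]_(x in X) (cst M x)%:E - \int[m]_(x in X) (u x)%:E)%E.
  exact: (integralB mX intM intu).
have : (\int[m]_(x in X) (u x)%:E)%E \is a fin_num by exact: integrable_fin_num intu.
move: h1 h2; rewrite e1 e2 iM.
case: (integral _ _ _) => [r| |]// h1 h2 _.
by move: h1 h2; rewrite -EFinD -EFinB !lee_fin => h1 h2; congr EFin; lra.
Qed.

End daniell.

(** Monotone limits of cut-offs give the measures of the sets where a function of
    the lattice is positive, and these sets are stable under intersection. *)
Lemma lattice_measure_unique d (T : measurableType d) (R : realType) (X : set T)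
    (D : (T -> R) -> Prop) (m m' : {finite_measure set T -> \bar R}) :
  vector_lattice X D -> measurable X -> m (~` X) = 0%E -> m' (~` X) = 0%E ->
  (forall u, D u ->
    (\int[m]_(x in X) (u x)%:E = \int[m']_(x in X) (u x)%:E)%E) ->
  forall A, measurable A -> m A = m' A.
Proof.
move=> DL mX m0 m'0 mm'.
have onX (p : {measure set T -> \bar R}) A : measurable A ->
    p (~` X) = 0%E -> p A = p (A `&` X).
  move=> mA p0.
  have mAX : measurable (A `&` X) by exact: measurableI.
  have mAC : measurable (A `&` ~` X) by apply: measurableI => //; exact: measurableC.
  have pAC : p (A `&` ~` X) = 0%E.
    apply/eqP; rewrite eq_le measure_ge0 andbT -p0 le_measure// inE//.
    exact: measurableC.
  rewrite -[in LHS](setIT A) -(setUv X) setIUr measureU//.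
    by rewrite -[RHS]adde0; congr (_ + _)%E.
  by apply/seteqP; split => // x [[_ Xx] [_ /(_ Xx)]].
have mu u : D u -> measurable [set x | 0 < u x].
  move=> Du; rewrite (_ : mkset _ = setT `&` u @^-1` `]0, +oo[%classic).
    exact: (lattice_meas DL Du).
  by rewrite setTI; apply/seteqP; split => x; rewrite /= in_itv/= andbT.
have lim (p : {finite_measure set T -> \bar R}) u : D u ->
    (\int[p]_(x in X) (cutoff u n x)%:E @[n --> \oo] --> p ([set x | (0 < u x)%R] `&` X))%E.
  move=> Du.
  have := @cvg_monotone_convergence _ _ _ p X mX (fun n x => (cutoff u n x)%:E).
  have -> : (\int[p]_(x in X) limn (fun n => (cutoff u n x)%:E))%E =
      p ([set x | 0 < u x] `&` X).
    rewrite -(integral_indic p mX (mu _ Du)); apply: eq_integral => x _.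
    apply/cvg_lim => //; rewrite indicE; apply: cvg_near_cst.
    have [ux|ux] := ltP 0 (u x).
      have [N uN] := cutoff1 ux.
      by exists N => // n /= Nn; rewrite mem_set//= uN.
    exists 0%N => // n _; rewrite cutoff0//= memNset//=.
    by apply/negP; rewrite -leNgt.
  apply.
  - move=> n; apply/measurable_EFinP.
    by apply: measurable_funS (lattice_meas DL (cutoff_lattice DL n Du)).
  - by move=> n x _; rewrite lee_fin cutoff_ge0.
  - by move=> x _ i j ij; rewrite lee_fin cutoff_nd.
apply: (@measure_unique _ _ _ [set [set x | 0 < u x] | u in D] (fun=> setT)).
- apply/seteqP; split; first exact: lattice_gen DL.
  apply: smallest_sub; first exact: sigma_algebra_measurable.
  by move=> _ [u Du <-]; exact: mu.
- move=> _ _ [u Du <-] [v Dv <-].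
  exists (fun x => Num.min (u x) (v x)); first exact: (lattice_min DL).
  by apply/seteqP; split => x /=; rewrite lt_min => /andP.
- move=> _; exists (cst 1); first exact: lattice1 DL.
  by apply/seteqP; split => x //= _; exact: ltr01.
- by rewrite bigcup_const//; exists 0%N.
- move=> _ [u Du <-]; transitivity (m ([set x | 0 < u x] `&` X)).
    by apply: onX m0; exact: mu.
  transitivity (m' ([set x | 0 < u x] `&` X)); last first.
    by apply/esym; apply: onX m'0; exact: mu.
  apply: cvg_unique (lim m u Du) _ => //.
  have -> : (fun n => \int[m]_(x in X) (cutoff u n x)%:E)%E =
      (fun n => \int[m']_(x in X) (cutoff u n x)%:E)%E.
    by apply/funext => n; apply: mm'; exact: cutoff_lattice DL _ _ Du.
  exact: lim.
- by move=> _; rewrite -ge0_fin_numE// fin_num_measure.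
Qed.

(** * Weighted images of measures *)

Section weighted_image.
Import HBNNSimple.
Context d d' (T : measurableType d) (T' : measurableType d') (R : realType).
Context (M : {measure set T -> \bar R}) (w : T -> R) (phi : T -> T').
Hypotheses (mw : measurable_fun setT w) (w0 : forall x, 0 <= w x).
Hypothesis (mphi : measurable_fun setT phi).

Let mwE : measurable_fun setT (EFin \o w). Proof. exact/measurable_EFinP. Qed.

Let mpre A : measurable A -> measurable (phi @^-1` A).
Proof. by move=> mA; rewrite -[X in measurable X]setTI; exact: mphi. Qed.

(** The image under [phi] of the measure with density [w] with respect to [M]. *)
Definition weighted_image (A : set T') : \bar R :=
  \int[M]_(x in phi @^-1` A) (w x)%:E.

Lemma weighted_image0 : weighted_image set0 = 0%E.
Proof. by rewrite /weighted_image preimage_set0 integral_set0. Qed.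

Lemma weighted_image_ge0 A : (0 <= weighted_image A)%E.
Proof. by apply: integral_ge0 => x _; rewrite lee_fin. Qed.

Lemma weighted_image_sigma_additive : semi_sigma_additive weighted_image.
Proof.
move=> A mA tA mUA; rewrite /weighted_image preimage_bigcup.
apply: (@semi_sigma_additive_nng_induced _ _ _ M (EFin \o w)) => //.
- by move=> i; exact: mpre.
- apply/trivIsetP => i j _ _ ij; rewrite -preimage_setI.
  by have /trivIsetP/(_ i j I I ij) -> := tA; rewrite preimage_set0.
- by apply: bigcupT_measurable => i; exact: mpre.
Qed.

HB.instance Definition _ := isMeasure.Build d' T' R weighted_image
  weighted_image0 weighted_image_ge0 weighted_image_sigma_additive.

Lemma integral_weighted_image_indic A : measurable A ->
  (\int[weighted_image]_y (\1_A y)%:E = \int[M]_x ((w x)%:E * (\1_A (phi x))%:E))%E.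
Proof.
move=> mA; rewrite integral_indic// setIT -[LHS]/(weighted_image A) /weighted_image.
rewrite [LHS]integral_mkcond.
apply: eq_integral => x _; rewrite patchE indicE.
have -> : (x \in phi @^-1` A) = (phi x \in A) by apply/idP/idP; rewrite !inE.
by case: (phi x \in A); rewrite ?mule1 ?mule0.
Qed.

Lemma integral_weighted_image (g : T' -> \bar R) :
  measurable_fun setT g -> (forall y, (0 <= g y)%E) ->
  (\int[weighted_image]_y g y = \int[M]_x ((w x)%:E * g (phi x)))%E.
Proof.
move=> mg g0.
pose f := nnsfun_approx measurableT mg.
have nnsfunE n : (\int[weighted_image]_y (f n y)%:E =
    \int[M]_x ((w x)%:E * (f n (phi x))%:E))%E.
  transitivity (\int[weighted_image]_y (\sum_(r \in range (f n))
      (r * \1_(f n @^-1` [set r]) y)%:E))%E.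
    by apply: eq_integral => y _; rewrite [in LHS]fimfunE -fsumEFin.
  have mi r : measurable_fun setT (fun x => (r * \1_(f n @^-1` [set r]) x)%:E).
    by apply/measurable_EFinP; apply: measurable_funM.
  have ge0 r y : (0 <= (r * \1_(f n @^-1` [set r]) y)%:E)%E.
    by rewrite EFinM nnfun_muleindic_ge0.
  rewrite ge0_integral_fsum//.
  transitivity (\int[M]_x (\sum_(r \in range (f n))
      ((w x)%:E * (r * \1_(f n @^-1` [set r]) (phi x))%:E)))%E; last first.
    apply: eq_integral => x _; rewrite -ge0_mule_fsumr//.
    by rewrite [in RHS]fimfunE -fsumEFin.
  rewrite ge0_integral_fsum//; last 2 first.
  - move=> r; apply: emeasurable_funM => //.
    by apply: (measurableT_comp (mi r)).
  - by move=> r x _; rewrite mule_ge0// lee_fin.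
  apply: eq_fsbigr => r _.
  have [r0|r0] := leP 0 r; last first.
    have f0 : f n @^-1` [set r] = set0 by exact: preimage_nnfun0.
    by rewrite f0 !integral0_eq// => x _; rewrite indic0 mulr0 ?mule0.
  under eq_integral do rewrite EFinM.
  have mi1 : measurable_fun setT (fun y => (\1_(f n @^-1` [set r]) y : R)%:E).
    by apply/measurable_EFinP.
  rewrite ge0_integralZl// integral_weighted_image_indic//.
  rewrite -ge0_integralZl//.
  - by apply: eq_integral => x _; rewrite EFinM muleCA.
  - by apply: emeasurable_funM => //; apply: (measurableT_comp mi1).
  - by move=> x _; rewrite mule_ge0// lee_fin.
transitivity (\int[weighted_image]_y (limn (fun n => (f n y)%:E)))%E.
  by apply: eq_integral => y _; apply/esym/cvg_lim => //; exact: cvg_nnsfun_approx.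
rewrite monotone_convergence//; last 3 first.
- by move=> n; exact/measurable_EFinP.
- by move=> n y _; rewrite lee_fin.
- by move=> y _ a b ab; rewrite lee_fin; exact/lefP/nd_nnsfun_approx.
transitivity (limn (fun n => \int[M]_x ((w x)%:E * (f n (phi x))%:E)))%E.
  by congr (limn _); apply/funext => n; exact: nnsfunE.
rewrite -monotone_convergence//; last 3 first.
- move=> n; apply: emeasurable_funM => //; apply/measurable_EFinP.
  by apply: measurableT_comp.
- by move=> n x _; rewrite mule_ge0// lee_fin.
- move=> x _ a b ab; rewrite lee_wpmul2l ?lee_fin//.
  exact/lefP/nd_nnsfun_approx.
apply: eq_integral => x _; apply/cvg_lim => //.
by apply: cvgeZl => //; exact: cvg_nnsfun_approx.
Qed.

End weighted_image.

Lemma finite_weighted_image d d' (T : measurableType d) (T' : measurableType d')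
    (R : realType) (M : {measure set T -> \bar R}) (w : T -> R) (phi : T -> T') :
  measurable_fun setT w -> (forall x, 0 <= w x) -> measurable_fun setT phi ->
  (\int[M]_x (w x)%:E < +oo)%E ->
  exists P : {finite_measure set T' -> \bar R},
  forall g, measurable_fun setT g -> (forall y, (0 <= g y)%E) ->
  (\int[P]_y g y = \int[M]_x ((w x)%:E * g (phi x)))%E.
Proof.
move=> mw w0 mphi wfin.
pose pack := HB.pack_for {measure set T' -> \bar R} (weighted_image M w phi).
pose P : {measure set T' -> \bar R} := pack mw w0 mphi.
have fin : fin_num_fun P.
  move=> A mA; rewrite ge0_fin_numE//; apply: le_lt_trans wfin.
  rewrite -[leRHS]/(weighted_image M w phi setT).
  by apply: (@le_measure _ _ _ P); rewrite ?inE.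
pose fP : {finite_measure set T' -> \bar R} :=
  HB.pack_for {finite_measure set T' -> \bar R} (Measure.sort P)
    (Measure_isFinite.Build _ _ _ (Measure.sort P) fin).
by exists fP => g mg g0; exact: integral_weighted_image.
Qed.

(** * The two support functions of a log-concave function *)

Section support_functions.
Context (R : realType) (k : nat).
Implicit Types (f : LC R k) (x y z : 'rV[R]_k).

(** At [z = y / (1 + |y|)] the height [1 - |z|] is [1 / (1 + |y|)], so the form at
    [z] is the form with direction [(y, 1)] divided by [1 + |y|]. *)
Lemma support_fun_ball f y : support_fun f y =
  ((1 + enorm y)%:E * ball_support (hyp f) ((1 + enorm y)^-1 *: y))%E.
Proof.
set c := 1 + enorm y; set z := c^-1 *: y.
have c0 : 0 < c by rewrite ltr_wpDr ?enorm_ge0.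
have formE q : c * ball_form q z = dotp q.1 y + q.2.
  rewrite /ball_form /z dotpZr enormZ gtr0_norm ?invr_gt0//.
  have -> : 1 - c^-1 * enorm y = c^-1.
    have -> : enorm y = c - 1 by rewrite /c addrAC subrr add0r.
    by rewrite mulrBr mulVf ?gt_eqF// mulr1; ring.
  by field; rewrite gt_eqF.
apply/eqP; rewrite eq_le; apply/andP; split.
  apply: ge_ereal_sup => _ [x _ <-].
  have [fx|fx] := leP (f x) 0.
    by rewrite le0_lneNy//= leNye.
  rewrite lne_EFin// oppeK -EFinD -(formE (x, ln (f x))) EFinM.
  by rewrite lee_wpmul2l ?lee_fin ?(ltW c0)//; apply/ball_support_ge/hyp_ln.
rewrite -lee_pdivlMl//; apply: ball_support_le => -[x s] /hyp_leP[fx sx].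
rewrite lee_pdivlMl// -EFinM formE/=.
apply: le_ereal_sup_tmp; exists ((dotp x y)%:E - - lne (f x)%:E)%E; first by exists x.
by rewrite lne_EFin// oppeK -EFinD lee_fin lerD2l.
Qed.

(** On the sphere the second coordinate does not count, and passing to the closure
    does not change the supremum of a continuous function. *)
Lemma set_support_fun_ball f z : enorm z = 1 ->
  set_support_fun (supp f) z = ball_support (hyp f) z.
Proof.
move=> z1; have formE q : ball_form q z = dotp q.1 z.
  by rewrite /ball_form z1 subrr mulr0 addr0.
apply/eqP; rewrite eq_le; apply/andP; split; last first.
  apply: ball_support_le => -[x s] /hyp_leP[fx sx].
  apply: ereal_sup_ubound; exists x; last by rewrite formE.
  exact: subset_closure.
apply: ge_ereal_sup => _ [x clx <-].
rewrite leNgt; apply/negP => xT.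
have [c cx Tc] : exists2 c, c < dotp z x & (ball_support (hyp f) z <= c%:E)%E.
  have := ball_support_gtNy z (hyp_neq0 f).
  case: (ball_support _ _) xT => [r| |]//; rewrite lte_fin dotpC => rx _.
  by exists r.
have : nbhs x [set y | c < dotp z y].
  apply: (@open_nbhs_nbhs _ x [set y | c < dotp z y]); split => //.
  apply: open_comp (@open_gt _ c) => y _; exact: dotp_continuous.
move=> /clx[y [/= fy cy]].
have := le_trans (ball_support_ge z (hyp_ln fy)) Tc.
by rewrite lee_fin formE/= dotpC leNgt cy.
Qed.

End support_functions.

(** * Borel sets of the space and of the sphere *)

Section measurability.
Context (R : realType) (k : nat).

Lemma open_measurable_rV (A : set 'rV[R]_k) :
  open A -> measurable (A : set (borel_rV R k)).
Proof. exact: sub_sigma_algebra. Qed.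

Lemma continuous_measurable_rV (g : 'rV[R]_k -> R) :
  continuous g -> measurable_fun [set: borel_rV R k] (g : borel_rV R k -> R).
Proof.
move=> cg; apply: (measurability _ (RGenOpens.measurableE R)).
move=> _ [_ [a [b ->] <-]]; rewrite setTI; apply: open_measurable_rV.
by apply: open_comp; [move=> v _; exact: cg|exact: interval_open].
Qed.

Lemma ball_support_measurable (A : set ('rV[R]_k * R)) :
  measurable_fun [set: borel_rV R k] (ball_support A : borel_rV R k -> \bar R).
Proof.
apply: (measurability _ (ErealGenOInfty.measurableE R)).
move=> /= _ [_ [a ->]] <-; apply: measurableI => //; apply: open_measurable_rV.
rewrite preimage_itvoy.
rewrite (_ : mkset _ = \bigcup_(q in A) [set z | a < ball_form q z]).
  apply: bigcup_open => q _.
  by apply: open_comp (@open_gt _ a) => z _; exact: ball_form_continuous.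
apply/seteqP; split => z /=.
  by move=> /ereal_sup_gt[_ [q Aq <-]]; rewrite lte_fin => aq; exists q.
move=> [q Aq /= aq]; apply: lt_le_trans (ball_support_ge z Aq).
by rewrite lte_fin.
Qed.

Lemma measurable_enorm : measurable_fun [set: borel_rV R k] (@enorm R k).
Proof. by apply: continuous_measurable_rV; exact: enorm_continuous. Qed.

Lemma measurable_rescale d (T : measurableType d) (c : T -> R) (v : T -> borel_rV R k) :
  measurable_fun setT c -> (forall x, 0 < c x) -> measurable_fun setT v ->
  measurable_fun setT (fun x => (c x)^-1 *: (v x : 'rV[R]_k) : borel_rV R k).
Proof.
move=> mc c0 mv; apply: measurable_fun_rV => j.
under eq_fun do rewrite mxE.
apply: measurable_funM; last first.
  by apply: (measurableT_comp (measurable_coord j) mv).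
under eq_fun do rewrite -powR_inv1 ?(ltW (c0 _))//.
exact: (measurableT_comp (measurable_powR _) mc).
Qed.

Lemma measurable_ball_enorm :
  measurable ([set z | enorm z <= 1] : set (borel_rV R k)).
Proof.
rewrite -[X in measurable X]setCK; apply: measurableC; apply: open_measurable_rV.
by rewrite openC; exact: closed_unit_enorm_ball.
Qed.

Lemma measurable_open_unit_ball :
  measurable ([set z | enorm z < 1] : set (borel_rV R k)).
Proof.
apply: open_measurable_rV; apply: (@open_comp _ _ _ [set r : R | r < 1]).
  by move=> z _; exact: enorm_continuous.
exact: open_lt.
Qed.

End measurability.

Section sphere_measurability.
Context (R : realType) (n : nat).

Lemma enorm_sphere (t : sphere R n) : enorm (\val t) = 1.
Proof. by have := set_valP t. Qed.

Lemma measurable_sphere_val :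
  measurable_fun [set: borel_sphere R n]
    (fun t : borel_sphere R n => \val (t : sphere R n) : borel_rV R n.+1).
Proof.
apply: (@measurability _ _ (borel_sphere R n) (borel_rV R n.+1) setT _
  (@open 'rV[R]_n.+1) erefl).
move=> _ [U oU <-]; rewrite setTI; apply: sub_sigma_algebra.
by exists U.
Qed.

(** Total left inverse of the inclusion of the sphere, which carries measures on
    the ball to the sphere. *)
Definition sphere_proj (z : 'rV[R]_n.+1) : sphere R n :=
  let p : set_type (@unit_sphere R n.+1) := (point : sphere R n) in insubd p z.

Lemma sphere_projK (t : sphere R n) : sphere_proj (\val t) = t.
Proof. exact: valKd. Qed.

Lemma val_sphere_proj z : enorm z = 1 -> \val (sphere_proj z) = z.
Proof. by move=> z1; apply: insubdK; apply/mem_set. Qed.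

Lemma val_sphere_proj_out z :
  enorm z <> 1 -> \val (sphere_proj z) = \val (point : sphere R n).
Proof.
move=> z1; rewrite /sphere_proj val_insubd; case: ifP => // /set_mem.
by move/z1.
Qed.

Lemma measurable_unit_sphere :
  measurable (@unit_sphere R n.+1 : set (borel_rV R n.+1)).
Proof.
have -> : @unit_sphere R n.+1 = setT `&` (@enorm R n.+1) @^-1` [set 1].
  by rewrite setTI.
by apply: (@measurable_enorm R n.+1).
Qed.

Lemma measurable_sphere_proj : measurable_fun [set: borel_rV R n.+1]
  (sphere_proj : borel_rV R n.+1 -> borel_sphere R n).
Proof.
apply: (@measurability _ _ (borel_rV R n.+1) (borel_sphere R n) setT _
  (@open (sphere R n)) erefl).
move=> _ [_ [U oU <-] <-]; rewrite setTI.
pose S := @unit_sphere R n.+1.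
rewrite (_ : _ @^-1` _ = (U `&` S) `|`
  (~` S `&` [set z | U (\val (point : sphere R n))])); last first.
  apply/seteqP; split => z /=.
    have [zS|zS] := pselect (S z) => Uz; [left|right]; split => //.
      by rewrite -(val_sphere_proj zS).
    suff : U (\val (point : sphere R n)) by [].
    by rewrite -(val_sphere_proj_out zS).
  case=> -[].
    by move=> + zS; rewrite -[X in U X -> _](val_sphere_proj zS).
  move=> zS Up; suff : U (\val (sphere_proj z)) by [].
  by rewrite (val_sphere_proj_out zS).
apply: measurableU; apply: measurableI.
- exact: open_measurable_rV.
- exact: measurable_unit_sphere.
- by apply: measurableC; exact: measurable_unit_sphere.
- have [Up|Up] := pselect (U (\val (point : sphere R n))).
    by rewrite (_ : mkset _ = setT)//; apply/seteqP; split.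
  by rewrite (_ : mkset _ = set0)//; apply/seteqP; split.
Qed.

End sphere_measurability.

(** * Measures on the ball and pairs of measures *)

Section ball_decomposition.
Context (R : realType) (n : nat).
Local Notation V := (borel_rV R n.+1).
Local Notation S := (borel_sphere R n).
Local Open Scope ereal_scope.

Definition unit_ball : set V := [set z | (enorm z <= 1)%R].

Lemma measurable_unit_ball : measurable unit_ball.
Proof. exact: measurable_ball_enorm. Qed.

(** The open unit ball is identified with the space by [y |-> y / (1 + |y|)]. *)
Definition to_ball (y : V) : V := ((1 + enorm y)^-1 *: (y : 'rV[R]_n.+1))%R.

(** The value 1 off the open ball makes [of_ball] a total measurable map with
    positive denominators. *)
Definition height (z : V) : R := (if enorm z < 1 then 1 - enorm z else 1)%R.

Definition of_ball (z : V) : V := ((height z)^-1 *: (z : 'rV[R]_n.+1))%R.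

Lemma height_gt0 z : (0 < height z)%R.
Proof. by rewrite /height; case: ifP => // z1; rewrite subr_gt0. Qed.

Lemma enorm1_gt0 (y : 'rV[R]_n.+1) : (0 < 1 + enorm y)%R.
Proof. by rewrite ltr_wpDr// enorm_ge0. Qed.

Lemma enorm_to_ball y : (enorm (to_ball y : 'rV[R]_n.+1) = enorm y / (1 + enorm y))%R.
Proof. by rewrite enormZ gtr0_norm ?invr_gt0 ?enorm1_gt0// mulrC. Qed.

Lemma enorm_to_ball_lt1 y : (enorm (to_ball y : 'rV[R]_n.+1) < 1)%R.
Proof. by rewrite enorm_to_ball ltr_pdivrMr ?enorm1_gt0// mul1r ltrDr. Qed.

Lemma height_to_ball y : height (to_ball y) = ((1 + enorm y)^-1)%R.
Proof.
rewrite /height enorm_to_ball_lt1 enorm_to_ball.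
have := lt0r_neq0 (enorm1_gt0 y); set e := enorm y => e1.
by field.
Qed.

Lemma to_ballK y : of_ball (to_ball y) = y.
Proof.
rewrite /of_ball height_to_ball invrK /to_ball scalerA mulfV ?scale1r//.
by rewrite gt_eqF// enorm1_gt0.
Qed.

Lemma of_ballP (z : V) : (enorm z < 1)%R ->
  (1 + enorm (of_ball z : 'rV[R]_n.+1) = (1 - enorm z)^-1)%R /\ to_ball (of_ball z) = z.
Proof.
move=> z1; have h0 : (0 < 1 - enorm z)%R by rewrite subr_gt0.
have e : (1 + enorm (of_ball z : 'rV[R]_n.+1) = (1 - enorm z)^-1)%R.
  rewrite /of_ball /height z1 enormZ gtr0_norm ?invr_gt0//.
  by move: (lt0r_neq0 h0); set r := enorm _ => r0; field.
split => //; rewrite /to_ball e invrK /of_ball /height z1 scalerA mulfV ?scale1r//.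
by rewrite gt_eqF.
Qed.

Lemma measurable_height : measurable_fun setT height.
Proof.
apply: measurable_fun_ifT; last exact: measurable_cst.
- by apply: measurable_fun_ltr; [exact: measurable_enorm|exact: measurable_cst].
- by apply: measurable_funB; [exact: measurable_cst|exact: measurable_enorm].
Qed.

Lemma measurable_of_ball : measurable_fun setT of_ball.
Proof.
apply: (@measurable_rescale _ _ _ _ height id) => //; first exact: measurable_height.
exact: height_gt0.
Qed.

Lemma measurable_enorm1 : measurable_fun [set: V] (fun y : V => 1 + enorm y)%R.
Proof. by apply: measurable_funD; [exact: measurable_cst|exact: measurable_enorm]. Qed.

Lemma measurable_to_ball : measurable_fun setT to_ball.
Proof.
apply: (@measurable_rescale _ _ _ _ (fun y : V => 1 + enorm y)%R id) => //.
  exact: measurable_enorm1.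
exact: enorm1_gt0.
Qed.

(** The measure [m] is the sum of the image under [to_ball] of [mu] with density
    [1 + |y|], and of [nu] on the boundary.  The density turns the homogeneous
    supports on the ball into [h_f], and makes the total mass of [m] finite exactly
    when [mu] and [nu] are finite and [mu] has a finite first moment. *)
Definition ball_decomposition (m mu : set V -> \bar R) (nu : set S -> \bar R) :=
  forall g : V -> \bar R, measurable_fun setT g -> (forall z, 0 <= g z) ->
  \int[m]_z g z = \int[mu]_y ((1 + enorm (y : 'rV[R]_n.+1))%:E * g (to_ball y)) +
    \int[nu]_t g (\val (t : sphere R n)).

Lemma finite_first_moment1 (mu : {finite_measure set V -> \bar R}) :
  finite_first_moment mu <->
  \int[mu]_y (1 + enorm (y : 'rV[R]_n.+1))%:E < +oo.
Proof.
have me : measurable_fun [set: V] (fun y : V => (enorm (y : 'rV[R]_n.+1))%:E).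
  by apply/measurable_EFinP; exact: measurable_enorm.
under eq_integral do rewrite EFinD.
rewrite ge0_integralD//=; last by move=> y _; rewrite lee_fin enorm_ge0.
rewrite integral_cst// mul1e /finite_first_moment.
rewrite -[X in _ <-> X + _ < _]/(mu setT) -(fineK (fin_num_measure mu setT measurableT)).
by case: (integral _ _ _) => [s| |] /=; split => // _; exact: ltry.
Qed.

Lemma ball_measure_exists (mu : {finite_measure set V -> \bar R})
    (nu : {finite_measure set S -> \bar R}) : finite_first_moment mu ->
  exists2 m : {finite_measure set V -> \bar R},
    m (~` unit_ball) = 0 & ball_decomposition m mu nu.
Proof.
move=> /finite_first_moment1 mu1.
have [P1 P1E] := @finite_weighted_image _ _ V V R mu _ _ measurable_enorm1
  (fun y => ltW (enorm1_gt0 y)) measurable_to_ball mu1.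
have mc1 : measurable_fun [set: S] (fun _ : S => 1%R : R) by exact: measurable_cst.
have [|P2 P2E] := @finite_weighted_image _ _ S V R nu _ _ mc1
  (fun=> ler01) (@measurable_sphere_val R n).
  by rewrite integral_cst// mul1e; exact: fin_num_fun_lty (@fin_num_measure _ _ _ nu).
pose m0 : {measure set V -> \bar R} := measure_add P1 P2.
have fin : fin_num_fun m0.
  move=> A mA; have -> : m0 A = P1 A + P2 A by exact: measure_addE.
  by rewrite fin_numD !fin_num_measure.
pose m : {finite_measure set V -> \bar R} :=
  HB.pack_for {finite_measure set V -> \bar R} (Measure.sort m0)
    (Measure_isFinite.Build _ _ _ (Measure.sort m0) fin).
have mD : ball_decomposition m mu nu.
  move=> g mg g0.
  transitivity (\int[measure_add P1 P2]_z g z) => //.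
  rewrite ge0_integral_measure_add// P1E// P2E//; congr (_ + _).
  by apply: eq_integral => t _; rewrite mul1e.
exists m => //.
have mX := measurableC measurable_unit_ball.
rewrite -(setIT (~` unit_ball)) -integral_indic// mD//; last first.
  by apply/measurable_EFinP; exact: measurable_indic.
rewrite !integral0_eq ?adde0// => y _.
  by rewrite indicE memNset//=; apply; rewrite /unit_ball/= enorm_sphere.
rewrite indicE memNset ?mule0//=; apply.
exact/ltW/enorm_to_ball_lt1.
Qed.

Lemma integral_ball (m : {measure set V -> \bar R}) (g : V -> \bar R) :
  m (~` unit_ball) = 0 -> measurable_fun setT g -> (forall z, 0 <= g z) ->
  \int[m]_z g z = \int[m]_(z in unit_ball) g z.
Proof.
move=> m0 mg g0; rewrite (ge0_negligible_integral _ _ _ _ m0)//.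
  by rewrite setTD setCK.
exact: measurableC measurable_unit_ball.
Qed.

(** [mu] is the image under [of_ball] of [m] with density [1 - |z|] on the open
    ball, and [nu] is the restriction of [m] to the sphere. *)
Lemma ball_measure_split (m : {finite_measure set V -> \bar R}) :
  m (~` unit_ball) = 0 ->
  exists (mu : {finite_measure set V -> \bar R})
         (nu : {finite_measure set S -> \bar R}), ball_decomposition m mu nu.
Proof.
move=> m0.
pose w1 (z : V) : R := (height z * \1_[set z : V | enorm z < 1] z)%R.
have mO := @measurable_open_unit_ball R n.+1.
have mw1 : measurable_fun setT w1.
  by apply: measurable_funM; [exact: measurable_height|exact: measurable_indic].
have w1_0 z : (0 <= w1 z)%R by rewrite mulr_ge0// ltW// height_gt0.
have w1_le1 z : (w1 z <= 1)%R.
  rewrite /w1 indicE; case: (boolP (z \in _)) => [/set_mem/= z1|]; rewrite ?mulr0//.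
  by rewrite /height z1 mulr1 gerBl enorm_ge0.
have mS := @measurable_unit_sphere R n.
pose w2 : V -> R := \1_(@unit_sphere R n.+1).
have mw2 : measurable_fun setT w2 by exact: measurable_indic.
have w2_0 z : (0 <= w2 z)%R by [].
have finI (w : V -> R) : measurable_fun setT w -> (forall z : V, (0 <= w z <= 1)%R) ->
    \int[m]_z (w z)%:E < +oo.
  move=> mw w01; apply: (@le_lt_trans _ _ (\int[m]_z (cst 1 z))).
    apply: ge0_le_integral => //.
    - by move=> z _; rewrite lee_fin; case/andP: (w01 z).
    - exact/measurable_EFinP.
    - by move=> z _; rewrite lee_fin; case/andP: (w01 z).
  rewrite integral_cst// mul1e.
  exact: fin_num_fun_lty (@fin_num_measure _ _ _ m).
have [|mu muE] := @finite_weighted_image _ _ V V R m _ _ mw1 w1_0 measurable_of_ball.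
  by apply: finI => // z; rewrite w1_0 w1_le1.
have [|nu nuE] := @finite_weighted_image _ _ V S R m _ _ mw2 w2_0
    (@measurable_sphere_proj R n).
  by apply: finI => // z; rewrite w2_0 /w2 indicE lern1 leq_b1.
exists mu, nu => g mg g0.
have mg1 : measurable_fun [set: V] (fun y : V =>
    (1 + enorm (y : 'rV[R]_n.+1))%:E * g (to_ball y)).
  apply: emeasurable_funM; first by apply/measurable_EFinP; exact: measurable_enorm1.
  exact: (measurableT_comp mg measurable_to_ball).
have mg2 : measurable_fun [set: S] (fun t : S => g (\val (t : sphere R n))).
  exact: (measurableT_comp mg (@measurable_sphere_val R n)).
rewrite muE//; last by move=> y; rewrite mule_ge0// lee_fin ltW// enorm1_gt0.
rewrite nuE//.
have mh1 : measurable_fun [set: V] (fun z : V => (w1 z)%:E *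
    ((1 + enorm (of_ball z : 'rV[R]_n.+1))%:E * g (to_ball (of_ball z)))).
  apply: emeasurable_funM; first exact/measurable_EFinP.
  exact: (measurableT_comp mg1 measurable_of_ball).
have mh2 : measurable_fun [set: V] (fun z : V => (w2 z)%:E *
    g (\val (sphere_proj (z : 'rV[R]_n.+1)))).
  apply: emeasurable_funM; first exact/measurable_EFinP.
  exact: (measurableT_comp mg2 (@measurable_sphere_proj R n)).
have h1_0 z : 0 <= (w1 z)%:E *
    ((1 + enorm (of_ball z : 'rV[R]_n.+1))%:E * g (to_ball (of_ball z))).
  by rewrite mule_ge0 ?lee_fin// mule_ge0// lee_fin ltW// enorm1_gt0.
have h2_0 z : 0 <= (w2 z)%:E * g (\val (sphere_proj (z : 'rV[R]_n.+1))).
  by rewrite mule_ge0// lee_fin.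
rewrite -ge0_integralD// (integral_ball m0 mg g0).
rewrite [RHS](integral_ball m0)//; first last.
- by move=> z; rewrite adde_ge0.
- exact: emeasurable_funD.
apply: eq_integral => z /set_mem; rewrite /unit_ball/= le_eqVlt => /predU1P[z1|z1].
  rewrite /w1 indicE memNset/= ?z1 ?ltxx// mulr0 mul0e add0e.
  by rewrite /w2 indicE mem_set// mul1e val_sphere_proj.
have [e1 e2] := of_ballP z1.
rewrite /w2 indicE memNset; last by move=> z1'; move: z1; rewrite z1' ltxx.
rewrite mul0e adde0 e1 e2 /w1 indicE mem_set// mulr1 /height z1 muleA -EFinM.
by rewrite mulfV ?mul1e// gt_eqF// subr_gt0.
Qed.

(** [mu] and [nu] are recovered from [m] as its images with the densities used in
    [ball_measure_split]. *)
Lemma ball_decomposition_unique (m : {measure set V -> \bar R})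
    (mu mu' : {measure set V -> \bar R}) (nu nu' : {measure set S -> \bar R}) :
  ball_decomposition m mu nu -> ball_decomposition m mu' nu' ->
  (forall A, measurable A -> mu A = mu' A) /\
  (forall B, measurable B -> nu B = nu' B).
Proof.
have mO := @measurable_open_unit_ball R n.+1.
have mS := @measurable_unit_sphere R n.
have muE (p : {measure set V -> \bar R}) (q : {measure set S -> \bar R}) A :
    ball_decomposition m p q -> measurable A -> p A =
    \int[m]_z (height z * \1_[set z : V | enorm z < 1]%R z * \1_A (of_ball z))%:E.
  move=> D mA; rewrite D; last 2 first.
  - apply/measurable_EFinP; apply: measurable_funM.
      by apply: measurable_funM; [exact: measurable_height|exact: measurable_indic].
    have mi : measurable_fun setT (\1_A : V -> R) by exact: measurable_indic.
    exact: (measurableT_comp mi measurable_of_ball).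
  - by move=> z; rewrite lee_fin !mulr_ge0// ltW// height_gt0.
  rewrite [X in _ = _ + X]integral0_eq ?adde0; last first.
    by move=> t _; rewrite indicE memNset ?mulr0 ?mul0r//= enorm_sphere ltxx.
  transitivity (\int[p]_y (\1_A y)%:E); first by rewrite integral_indic// setIT.
  apply: eq_integral => y _.
  have y1 : \1_[set z : V | enorm z < 1]%R (to_ball y) = 1%R :> R.
    by rewrite indicE mem_set//; exact: enorm_to_ball_lt1.
  rewrite to_ballK y1 mulr1 height_to_ball -EFinM mulrA mulfV ?mul1r//.
  by rewrite gt_eqF// enorm1_gt0.
have nuE (p : {measure set V -> \bar R}) (q : {measure set S -> \bar R}) B :
    ball_decomposition m p q -> measurable B -> q B =
    \int[m]_z (\1_(@unit_sphere R n.+1) z * \1_B (sphere_proj z : S))%:E.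
  move=> D mB; rewrite D; last 2 first.
  - apply/measurable_EFinP; apply: measurable_funM; first exact: measurable_indic.
    have mi : measurable_fun setT (\1_B : S -> R) by exact: measurable_indic.
    exact: (measurableT_comp mi (@measurable_sphere_proj R n)).
  - by move=> z; rewrite lee_fin mulr_ge0.
  rewrite [X in _ = X + _]integral0_eq ?add0e; last first.
    move=> y _; rewrite indicE memNset ?mul0r ?mule0// => y1.
    by have := enorm_to_ball_lt1 y; rewrite y1 ltxx.
  transitivity (\int[q]_t (\1_B t)%:E); first by rewrite integral_indic// setIT.
  apply: eq_integral => t _.
  have t1 : \1_(@unit_sphere R n.+1) (\val (t : sphere R n)) = 1%R :> R.
    by rewrite indicE mem_set//; exact: enorm_sphere.
  by rewrite sphere_projK t1 mul1r.
move=> D D'; split => [A mA|B mB].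
  by rewrite (muE _ _ _ D mA) (muE _ _ _ D' mA).
by rewrite (nuE _ _ _ D mB) (nuE _ _ _ D' mB).
Qed.

Lemma ball_support_lbound (A : set ('rV[R]_n.+1 * R)) : A !=set0 ->
  exists c : R, forall z, (enorm z <= 1)%R -> (- c)%:E <= ball_support A z.
Proof.
move=> [q Aq]; exists (enorm q.1 + `|q.2|)%R => z z1.
apply: le_trans (ball_support_ge z Aq); rewrite lee_fin /ball_form.
have z0 := enorm_ge0 z.
have := normr_dotp q.1 z; have := enorm_ge0 q.1; rewrite ler_norml.
have := ler_norm q.2; have := ler_norm (- q.2); rewrite normrN; have := normr_ge0 q.2.
set e := enorm z in z1 z0 *; set a := enorm q.1; set b := `|q.2|%R; set s := q.2.
by move=> h1 h2 h3 h4 /andP[h5 h6]; nra.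
Qed.

(** A signed integral is the difference of the integrals of the positive and
    negative parts, and the decomposition applies to each.  The negative parts have
    finite integrals since supports are bounded below on the ball, which allows the
    differences to be regrouped. *)
Lemma integral_functional_ball (m mu : {finite_measure set V -> \bar R})
    (nu : {finite_measure set S -> \bar R}) (f : LC R n.+1) :
  m (~` unit_ball) = 0 -> ball_decomposition m mu nu ->
  integral_functional mu nu f = \int[m]_(z in unit_ball) ball_support (hyp f) z.
Proof.
move=> m0 mD; set h := ball_support (hyp f).
have mh : measurable_fun [set: V] (h : V -> \bar R) by exact: ball_support_measurable.
have mX := measurable_unit_ball.
have pE (c : R) (x : \bar R) : (0 < c)%R -> c%:E * maxe x 0 = maxe (c%:E * x) 0.
  by move=> c0; rewrite maxe_pMr// ?mule0// lee_fin ltW.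
have posD : \int[m]_(z in unit_ball) (h : V -> _)^\+ z =
    \int[mu]_y (support_fun f)^\+ y +
    \int[nu]_t (fun t : S => set_support_fun (supp f) (\val (t : sphere R n)))^\+ t.
  rewrite integral_mkcond mD; last 2 first.
  - apply/(measurable_restrictT _ mX); apply: measurable_funTS.
    exact: measurable_funepos.
  - by move=> z; apply: erestrict_ge0 => y _; exact: funepos_ge0.
  congr (_ + _); apply: eq_integral => y _; rewrite patchE mem_set.
  - by rewrite !funeposE pE ?enorm1_gt0// support_fun_ball.
  - exact/ltW/enorm_to_ball_lt1.
  - by rewrite !funeposE /h -set_support_fun_ball// enorm_sphere.
  - by rewrite /unit_ball/= enorm_sphere.
have negD : \int[m]_(z in unit_ball) (h : V -> _)^\- z =
    \int[mu]_y (support_fun f)^\- y +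
    \int[nu]_t (fun t : S => set_support_fun (supp f) (\val (t : sphere R n)))^\- t.
  rewrite integral_mkcond mD; last 2 first.
  - apply/(measurable_restrictT _ mX); apply: measurable_funTS.
    exact: measurable_funeneg.
  - by move=> z; apply: erestrict_ge0 => y _; exact: funeneg_ge0.
  congr (_ + _); apply: eq_integral => y _; rewrite patchE mem_set.
  - by rewrite !funenegE pE ?enorm1_gt0// muleN support_fun_ball.
  - exact/ltW/enorm_to_ball_lt1.
  - by rewrite !funenegE /h -set_support_fun_ball// enorm_sphere.
  - by rewrite /unit_ball/= enorm_sphere.
have [c hc] := ball_support_lbound (hyp_neq0 f).
have neg_fin : \int[m]_(z in unit_ball) (h : V -> _)^\- z < +oo.
  apply: (@le_lt_trans _ _ (\int[m]_(z in unit_ball) (cst `|c|%:E z))).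
    apply: ge0_le_integral => //.
    - by apply: measurable_funTS; exact: measurable_funeneg.
    - move=> z z1; rewrite funenegE ge_max lee_fin normr_ge0 andbT leeNl -EFinN.
      by apply: le_trans (hc z z1); rewrite lee_fin lerN2 ler_norm.
  rewrite integral_cst// lte_mul_pinfty ?lee_fin//.
  by rewrite ltey_eq fin_num_measure.
rewrite /integral_functional integralE [in X in _ + X]integralE [RHS]integralE.
rewrite posD negD; rewrite negD in neg_fin.
set a2 := \int[mu]_y (support_fun f)^\- y in neg_fin *.
set b2 := (X in a2 + X < _) in neg_fin *.
have a20 : 0 <= a2 by apply: integral_ge0.
have b20 : 0 <= b2 by apply: integral_ge0.
case: a2 b2 neg_fin a20 b20 => [a2| |] [b2| |]// _ _ _.
by rewrite oppeD// addeACA.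
Qed.

End ball_decomposition.

(** * Cubes under graphs of positive integral *)

Section lebesgue.
Context (R : realType).
Local Open Scope ereal_scope.

Definition cube (n : nat) : set (borel_rV R n) := [set v | forall i, (`|v ord0 i| <= 1)%R].

Lemma measurable_cube n : measurable (@cube n).
Proof.
rewrite (_ : @cube n = \bigcap_(i in [set: 'I_n])
    ((fun v : borel_rV R n => v ord0 i) @^-1` `[(-1)%R, 1%R]%classic)); last first.
  apply/seteqP; split => v /= h i; first by move=> _; rewrite /= in_itv/= -ler_norml.
  by have := h i I; rewrite /= in_itv/= -ler_norml.
apply: fin_bigcap_measurable => // i _.
by rewrite -[X in measurable X]setTI; exact: (@measurable_coord R n i).
Qed.

Lemma cons_rV0 n t (v : borel_rV R n) : @cons_rV R n (t, v) ord0 ord0 = t.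
Proof.
rewrite /cons_rV (_ : @ord0 n = @lshift 1 n ord0); last exact: val_inj.
by rewrite (row_mxEl (_ : 'rV_1)) mxE eqxx mulr1n.
Qed.

Lemma cons_rVS n t (v : borel_rV R n) i : @cons_rV R n (t, v) ord0 (lift ord0 i) = v ord0 i.
Proof.
rewrite /cons_rV (_ : lift ord0 i = @rshift 1 n i); last exact: val_inj.
by rewrite (row_mxEr (_ : 'rV_1)).
Qed.

Lemma lebesgue_cube_gt0 n : 0 < @lebesgue_rV R n (@cube n).
Proof.
elim: n => [|n IH].
  by rewrite /= diracE mem_set ?lte01// => i; case: i.
rewrite /= /pushforward.
have -> : @cons_rV R n @^-1` @cube n.+1 = `[(-1)%R, 1%R] `*` @cube n.
  apply/seteqP; split => -[t v].
    move=> h; split; first by rewrite /= in_itv/= -ler_norml -(cons_rV0 t v); exact: h.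
    by move=> i; rewrite -(cons_rVS t v); exact: h.
  move=> [/= t1 v1] i; have [j ->|->] := unliftP ord0 i.
    by rewrite cons_rVS; exact: v1.
  by rewrite cons_rV0 ler_norml; move: t1; rewrite in_itv.
rewrite product_measure1E//; last exact: measurable_cube.
apply: mule_gt0 => //.
suff : 0 < @lebesgue_measure R `[(-1)%R, 1%R]%classic by [].
by rewrite lebesgue_measure_itv/= lte_fin gtrN ?ltr01// -EFinB opprK lte_fin.
Qed.

Lemma measurable_hyperplane n (a : 'rV[R]_n) (c : R) :
  measurable ([set v | dotp a v = c] : set (borel_rV R n)).
Proof.
have -> : [set v | dotp a v = c] = setT `&` (dotp a) @^-1` [set c].
  by rewrite setTI.
by apply: (continuous_measurable_rV (@dotp_continuous R n a)).
Qed.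

(** By Fubini in the first coordinate: either the slices are hyperplanes of
    smaller dimension, or the hyperplane is orthogonal to the first axis. *)
Lemma lebesgue_hyperplane n (a : 'rV[R]_n) (c : R) : a != 0%R ->
  @lebesgue_rV R n [set v | dotp a v = c] = 0.
Proof.
elim: n a c => [|n IH] a c a0.
  by move: a0; rewrite (_ : a = 0%R) ?eqxx//; apply/rowP => -[].
rewrite /= /pushforward.
pose a1 := (\row_i a ord0 (lift ord0 i) : 'rV[R]_n)%R.
set H := (X in (_ \x _) X).
have HE t v : H (t, v) <-> (a ord0 ord0 * t + dotp a1 v = c)%R.
  rewrite /H /preimage/= /dotp big_ord_recl cons_rV0.
  by under eq_bigr do rewrite cons_rVS; under [in X in _ <-> X]eq_bigr do rewrite mxE.
have mH : measurable H.
  rewrite -[H]setTI; apply: (@measurable_cons_rV R n) => //.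
  exact: measurable_hyperplane.
have [a10|a10] := eqVneq a1 0%R; last first.
  apply: integral0_eq => t _.
  transitivity (@lebesgue_rV R n (xsection H t)) => //.
  rewrite (_ : xsection H t = [set v | dotp a1 v = (c - a ord0 ord0 * t)%R]).
    exact: IH.
  by apply/seteqP; split => v; rewrite /xsection/= inE HE => h; lra.
have a00 : a ord0 ord0 != 0%R.
  apply: contraNneq a0 => a00; apply/eqP/rowP => i; rewrite mxE.
  have [j ->|->//] := unliftP ord0 i.
  by move/rowP: a10 => /(_ j); rewrite !mxE.
have HS : H `<=` [set c / a ord0 ord0]%R `*` setT.
  move=> -[t v] /HE; rewrite a10 dotp0l addr0 => h; split => //=.
  by rewrite -h mulrAC mulfV ?mul1r.
apply/eqP; rewrite eq_le measure_ge0 andbT.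
apply: (@le_trans _ _ ((@lebesgue_measure R \x @lebesgue_rV R n)
    ([set c / a ord0 ord0]%R `*` setT))).
  by rewrite le_measure// inE//; exact: measurableX.
rewrite product_measure1E// [X in X * _](_ : _ = 0) ?mul0e//.
exact: lebesgue_measure_set1.
Qed.

End lebesgue.

Section fat_hypograph.
Context (R : realType) (n : nat).

Lemma LC_measurable (f : LC R n) :
  measurable_fun [set: borel_rV R n] (f : borel_rV R n -> R).
Proof.
apply: (measurability _ (RGenInftyO.measurableE R)).
move=> _ [_ [b ->] <-]; rewrite setTI; apply: open_measurable_rV.
rewrite openE => x; rewrite /= in_itv/= => fx; have [V nV Vb] := usc_lt fx.
by apply: filterS nV => y /Vb; rewrite /= in_itv/=.
Qed.

(** Otherwise [f] would vanish almost everywhere, hyperplanes being null sets. *)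
Lemma LC_off_hyperplane (f : LC R n) (a : 'rV[R]_n) c : a != 0 ->
  (0 < \int[@lebesgue_rV R n]_(x in [set: borel_rV R n]) (f x)%:E)%E ->
  exists2 y, 0 < f y & dotp a y != c.
Proof.
move=> a0; apply: contraPP => /forall2NP noty; apply/negP; rewrite -leNgt.
have mH := measurable_hyperplane a c.
have fH x : dotp a x != c -> f x = 0.
  move=> ax; have [//|] := noty x; rewrite ?ax// => /negP; rewrite -leNgt => fx.
  by apply/eqP; rewrite eq_le fx LC_ge0.
have mf := LC_measurable f.
rewrite (ge0_negligible_integral mH)//.
- rewrite integral0_eq// => x [_ /eqP /fH ->]; by [].
- exact/measurable_EFinP.
- by move=> x _; rewrite lee_fin LC_ge0.
- exact: lebesgue_hyperplane.
Qed.

(** By induction on [k], the hypograph contains a [k]-dimensional parallelepiped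
    with centre [p] at a constant height.  A point [y] with [f y > 0] off a
    hyperplane that contains it yields one more dimension: the convex hull of the
    parallelepiped and [y] contains a parallelepiped with centre [(p + y) / 2] and
    the additional axis [y - p]. *)
Lemma hyp_box (f : LC R n) :
  (0 < \int[@lebesgue_rV R n]_(x in [set: borel_rV R n]) (f x)%:E)%E ->
  forall k, (k <= n)%N -> exists (p : 'rV[R]_n) (s r : R) (M : 'M[R]_(k, n)),
  [/\ 0 < r, row_free M &
      forall t : 'rV[R]_k, (forall i, `|t ord0 i| <= r) -> hyp f (p + t *m M, s)].
Proof.
move=> f0; elim=> [_|k IH kn].
  have [p fp] := LC_neq0 f.
  exists p, (ln (f p)), 1, 0; split => //; first by rewrite /row_free mxrank0.
  by move=> t _; rewrite mulmx0 addr0; exact: hyp_ln.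
have [p [s [r [M [r0 Mfree hM]]]]] := IH (ltnW kn).
(* A normal vector to all the axes exists as their number is less than [n]. *)
have [a a0 Ma] : exists2 a : 'rV[R]_n, a != 0 & M *m a^T = 0.
  have : kermx M^T != 0.
    by rewrite -mxrank_eq0 mxrank_ker mxrank_tr (eqP Mfree) subn_eq0 -ltnNge.
  move=> /rowV0Pn[a aM a0]; exists a => //.
  by rewrite -[M]trmxK -trmx_mul (sub_kermxP aM) trmx0.
have [y fy ay] := LC_off_hyperplane (dotp a p) a0 f0.
have dotE (u v : 'rV[R]_n) : u *m v^T = (dotp u v)%:M.
  apply/matrixP => i j; rewrite !ord1 !mxE eqxx mulr1n; apply: eq_bigr => l _.
  by rewrite mxE.
pose v := y - p.
(* A displacement [u] along [y - p] with [|u| <= 1/4] leaves weight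
   [1/2 - u >= 1/4] on the old parallelepiped, hence the factor 1/4 on [r]. *)
exists (2^-1 *: (p + y)), (Num.min s (ln (f y))), (Num.min (r / 4) 4^-1), (col_mx v M).
split.
- by rewrite lt_min divr_gt0//= invr_gt0.
- have vM : ~~ (v <= M)%MS.
    apply/negP => /submxP[D vD]; move: ay; rewrite dotpC -subr_eq0 => /eqP; apply.
    have : v *m a^T = 0 by rewrite vD -mulmxA Ma mulmx0.
    rewrite dotE => /matrixP/(_ ord0 ord0); rewrite !mxE eqxx mulr1n.
    by rewrite /v dotpDl dotpNl dotpC (dotpC p).
  have : (\rank M < \rank (col_mx v M))%N.
    have : (M < col_mx v M)%MS by rewrite ltmxE -!addsmxE addsmxSr addsmx_sub negb_and vM.
    by rewrite ltmxErank => /andP[].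
  rewrite (eqP Mfree) => h; rewrite /row_free eqn_leq h andbT.
  exact: rank_leq_row.
- move=> t tr.
  pose u : R := t ord0 (@lshift 1 k ord0); pose t' : 'rV[R]_k := rsubmx (t : 'rV_(1 + k)).
  have u4 : `|u| <= 4^-1 by have := tr (@lshift 1 k ord0); rewrite le_min => /andP[].
  have l0 : 0 < 2^-1 - u by move: u4; rewrite ler_norml => /andP[]; lra.
  have -> : 2^-1 *: (p + y) + t *m col_mx v M =
     (2^-1 - u) *: (p + ((2^-1 - u)^-1 *: t') *m M) + (1 - (2^-1 - u)) *: y.
    have tE : t *m col_mx v M = u *: v + t' *m M.
      have := mul_row_col (lsubmx (t : 'rV_(1 + k))) (rsubmx (t : 'rV_(1 + k))) v M.
      by rewrite hsubmxK [lsubmx _]mx11_scalar mul_scalar_mx mxE.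
    rewrite tE -scalemxAl [(2^-1 - u) *: (_ + _)]scalerDr scalerA mulfV ?gt_eqF// scale1r.
    move: (t' *m M) => b; rewrite /v; apply/rowP => i; rewrite !mxE; lra.
  have := @hyp_convex _ _ f (p + ((2^-1 - u)^-1 *: t') *m M, Num.min s (ln (f y)))
    (y, Num.min s (ln (f y))) (2^-1 - u).
  rewrite /= -mulrDl addrCA subrr addr0 mul1r; apply.
  + apply: (@hyp_down _ _ _ _ _ s); first by rewrite ge_min lexx.
    apply: hM => i; rewrite mxE normrM gtr0_norm ?invr_gt0// mulrC ler_pdivrMr//.
    have := tr (@rshift 1 k i); rewrite le_min => /andP[+ _].
    move: u4; rewrite ler_norml => /andP[]; rewrite /t' mxE; nra.
  + apply: (@hyp_down _ _ _ _ _ (ln (f y))); first by rewrite ge_min lexx orbT.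
    exact: hyp_ln.
  + by move: u4; rewrite ler_norml => /andP[]; rewrite (ltW l0)/=; lra.
Qed.

(** A parallelepiped of full dimension contains a cube with the same centre. *)
Lemma hyp_cube (f : LC R n) :
  (0 < \int[@lebesgue_rV R n]_(x in [set: borel_rV R n]) (f x)%:E)%E ->
  exists (p : 'rV[R]_n) (s r : R), 0 < r /\
    forall x, cube x -> hyp f (p + r *: x, s).
Proof.
move=> /hyp_box/(_ n (leqnn n))[p [s [r [M [r0 Mfree hM]]]]].
have Mu : M \in unitmx by rewrite -row_free_unit.
pose B := 1 + \sum_i \sum_j `|invmx M i j|.
have B0 : 0 < B.
  by rewrite ltr_wpDr// sumr_ge0// => i _; rewrite sumr_ge0.
exists p, s, (r / B); split; first by rewrite divr_gt0.
move=> x x1; have -> : (r / B) *: x = ((r / B) *: (x *m invmx M)) *m M.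
  by rewrite -scalemxAl mulmxKV.
apply: hM => i; rewrite mxE normrM gtr0_norm ?divr_gt0// mulrAC ler_pdivrMr//.
rewrite ler_wpM2l ?(ltW r0)// mxE (le_trans (ler_norm_sum _ _ _))//.
apply: (@le_trans _ _ (\sum_j `|invmx M j i|)).
  by apply: ler_sum => j _; rewrite normrM ler_piMl//; exact: x1.
rewrite /B; apply: ler_wpDl => //; apply: ler_sum => j _.
by rewrite (bigD1 i)//= lerDl sumr_ge0.
Qed.

End fat_hypograph.

(** * Integrals of functions bounded below *)

Section integrals_bounded_below.
Context d (T : measurableType d) (R : realType) (m : {finite_measure set T -> \bar R}).
Context (X : set T) (mX : measurable X).
Local Open Scope ereal_scope.
Implicit Types (h u v : T -> \bar R) (c : R).

(** This reduces functions bounded below to nonnegative ones, also when the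
    integral is infinite. *)
Lemma integral_addcst h c : (0 <= c)%R -> measurable_fun X h ->
  (forall x, X x -> (- c)%:E <= h x) ->
  \int[m]_(x in X) (h x + c%:E) = \int[m]_(x in X) h x + c%:E * m X.
Proof.
move=> c0 mh hc.
have hc0 x : X x -> 0 <= h x + c%:E.
  by move=> /hc; rewrite -leeBlDr// sub0e EFinN.
have mhc : measurable_fun X (fun x => h x + c%:E).
  by apply: emeasurable_funD => //; exact: measurable_cst.
have key x : X x -> (h x + c%:E) + h^\- x = h^\+ x + c%:E.
  move=> /hc; rewrite funeposE funenegE; case: (h x) => [r| |]//= rc.
    rewrite -!EFin_max -!EFinD; congr EFin.
    by case: (leP r 0%R); case: (leP (- r)%R 0%R); lra.
  by rewrite maxye /= max_r.
have mn := measurable_funeneg mh.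
have mp := measurable_funepos mh.
have eq1 : \int[m]_(x in X) (h x + c%:E) + \int[m]_(x in X) h^\- x =
    \int[m]_(x in X) h^\+ x + c%:E * m X.
  rewrite -ge0_integralD//.
  transitivity (\int[m]_(x in X) (h^\+ x + cst c%:E x)).
    by apply: eq_integral => x /set_mem /key.
  rewrite ge0_integralD ?integral_cst//.
have nfin : \int[m]_(x in X) h^\- x \is a fin_num.
  rewrite ge0_fin_numE; last by apply: integral_ge0.
  apply: (@le_lt_trans _ _ (\int[m]_(x in X) (cst c%:E x))).
    apply: ge0_le_integral => // x /hc hx.
    by rewrite funenegE ge_max lee_fin c0 andbT leeNl -EFinN.
  by rewrite integral_cst// lte_mul_pinfty ?lee_fin// ltey_eq fin_num_measure.
rewrite [in RHS]integralE -(addeK (\int[m]_(x in X) (h x + c%:E)) nfin) eq1.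
by rewrite addeAC.
Qed.

Lemma integral_gtNy h c : measurable_fun X h ->
  (forall x, X x -> (- c)%:E <= h x) -> \int[m]_(x in X) h x != -oo.
Proof.
move=> mh hc; have hc' x : X x -> (- `|c|)%:E <= h x.
  by move=> /hc; apply: le_trans; rewrite lee_fin lerN2 ler_norm.
have := integral_addcst (normr_ge0 c) mh hc'.
have : 0 <= \int[m]_(x in X) (h x + `|c|%:E).
  by apply: integral_ge0 => x /hc'; rewrite -leeBlDr// sub0e EFinN.
by case: (\int[m]_(x in X) h x) => // /[swap] ->.
Qed.

Lemma le_integral_pointwise u v : measurable_fun X u -> measurable_fun X v ->
  (forall x, X x -> u x <= v x) -> \int[m]_(x in X) u x <= \int[m]_(x in X) v x.
Proof.
move=> mu mv uv; rewrite integralE [leRHS]integralE leeB//.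
  apply: ge0_le_integral => //; [exact: measurable_funepos|exact: measurable_funepos|].
  by move=> x Xx; rewrite !funeposE ge_max !le_max uv//= lexx orbT.
apply: ge0_le_integral => //; [exact: measurable_funeneg|exact: measurable_funeneg|].
by move=> x Xx; rewrite !funenegE ge_max !le_max leeN2 uv//= lexx orbT.
Qed.

Lemma integral_lincomb (a b : R) u v c : (0 < a)%R -> (0 < b)%R ->
  measurable_fun X u -> measurable_fun X v ->
  (forall x, X x -> (- c)%:E <= u x) -> (forall x, X x -> (- c)%:E <= v x) ->
  \int[m]_(x in X) (a%:E * u x + b%:E * v x) =
  a%:E * \int[m]_(x in X) u x + b%:E * \int[m]_(x in X) v x.
Proof.
move=> a0 b0 mu mv; wlog c0 : c / (0 <= c)%R.
  move=> wl uc vc; apply: (wl `|c|%R) => // x Xx.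
    by apply: le_trans (uc x Xx); rewrite lee_fin lerN2 ler_norm.
  by apply: le_trans (vc x Xx); rewrite lee_fin lerN2 ler_norm.
move=> uc vc.
have ge0 (w : T -> \bar R) : (forall x, X x -> (- c)%:E <= w x) ->
    forall x, X x -> 0 <= w x + c%:E.
  by move=> wc x /wc; rewrite -leeBlDr// sub0e EFinN.
have mshift (w : T -> \bar R) : measurable_fun X w -> measurable_fun X (fun x => w x + c%:E).
  by move=> mw; apply: emeasurable_funD => //; exact: measurable_cst.
have abc0 : (0 <= (a + b) * c)%R by rewrite mulr_ge0// addr_ge0// ltW.
have mab : measurable_fun X (fun x => a%:E * u x + b%:E * v x).
  by apply: emeasurable_funD; apply: emeasurable_funM => //; exact: measurable_cst.
have abE x : X x -> a%:E * u x + b%:E * v x + ((a + b) * c)%:E =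
    a%:E * (u x + c%:E) + b%:E * (v x + c%:E).
  move=> Xx; move: (uc x Xx) (vc x Xx).
  case: (u x) => [r| |]//; case: (v x) => [s| |]// _ _; last 3 first.
  all: try by rewrite /= !gt0_muley ?lte_fin.
  change ((a * r + b * s + (a + b) * c)%R%:E = (a * (r + c) + b * (s + c))%R%:E).
  by congr EFin; ring.
have abge x : X x -> (- ((a + b) * c))%:E <= a%:E * u x + b%:E * v x.
  move=> Xx; rewrite EFinN -[leLHS]sub0e leeBlDr// abE//.
  by rewrite adde_ge0// mule_ge0 ?ge0// lee_fin ltW.
have := integral_addcst abc0 mab abge.
have -> : \int[m]_(x in X) (a%:E * u x + b%:E * v x + ((a + b) * c)%:E) =
    a%:E * \int[m]_(x in X) (u x + c%:E) + b%:E * \int[m]_(x in X) (v x + c%:E).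
  transitivity (\int[m]_(x in X) (a%:E * (u x + c%:E) + b%:E * (v x + c%:E))).
    by apply: eq_integral => x /set_mem /abE.
  rewrite ge0_integralD//.
  - by rewrite !ge0_integralZl// ?lee_fin ?ltW//; [exact: mshift|exact: ge0|exact: mshift|exact: ge0].
  - by move=> x Xx; rewrite mule_ge0 ?ge0// lee_fin ltW.
  - by apply: emeasurable_funM; [exact: measurable_cst|exact: mshift].
  - by move=> x Xx; rewrite mule_ge0 ?ge0// lee_fin ltW.
  - by apply: emeasurable_funM; [exact: measurable_cst|exact: mshift].
rewrite !integral_addcst//.
have uN := integral_gtNy mu uc; have vN := integral_gtNy mv vc.
rewrite -[m X](fineK (fin_num_measure m X mX)); set M := fine _.
case: (\int[m]_(x in X) u x) uN => [r| |]// _;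
  case: (\int[m]_(x in X) v x) vN => [s| |]// _;
  case: (\int[m]_(x in X) (a%:E * u x + b%:E * v x)) => [q| |]//.
1: by move=> [] e; congr EFin; move: e; nra.
all: rewrite -![(c)%:E * _]EFinM ?addye// !gt0_muley ?lte_fin//=.
Qed.

Lemma cvg_integral_lbound (hs : nat -> T -> \bar R) h c :
  (forall i, measurable_fun X (hs i)) ->
  (forall i x, X x -> hs i x <= hs i.+1 x) ->
  (forall x, X x -> (- c)%:E <= hs 0%N x) ->
  (forall x, X x -> hs i x @[i --> \oo] --> h x) ->
  \int[m]_(x in X) hs i x @[i --> \oo] --> \int[m]_(x in X) h x.
Proof.
move=> mhs nd; wlog c0 : c / (0 <= c)%R.
  move=> wl hc; apply: (wl `|c|%R) => // x Xx.
  by apply: le_trans (hc x Xx); rewrite lee_fin lerN2 ler_norm.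
move=> hc0 hsh.
have nd' x : X x -> {homo hs ^~ x : i j / (i <= j)%N >-> i <= j}.
  by move=> Xx; apply: homo_leq => [//||i]; [exact: le_trans|exact: nd].
have hc i x : X x -> (- c)%:E <= hs i x.
  by move=> Xx; apply: le_trans (hc0 x Xx) _; exact: nd'.
have mh : measurable_fun X h.
  by apply: (emeasurable_fun_cvg hs).
have hc' x : X x -> (- c)%:E <= h x.
  by move=> Xx; apply: cvge_ge (hsh x Xx); apply: nearW => i; exact: hc.
have shiftE (w : T -> \bar R) : measurable_fun X w ->
    (forall x, X x -> (- c)%:E <= w x) ->
    \int[m]_(x in X) w x = \int[m]_(x in X) (w x + c%:E) - c%:E * m X.
  move=> mw wc; rewrite integral_addcst// addeK//.
  by rewrite fin_numM// fin_num_measure.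
rewrite (shiftE h mh hc'); under eq_fun do rewrite (shiftE _ (mhs _) (hc _)).
apply: cvgeB; last 2 first.
- have -> : \int[m]_(x in X) (h x + c%:E) =
      \int[m]_(x in X) limn (fun i => hs i x + c%:E).
    apply: eq_integral => x /set_mem Xx; apply/esym/cvg_lim => //.
    by apply: cvgeD => //; [exact: fin_num_adde_defl|exact: hsh|exact: cvg_cst].
  apply: cvg_monotone_convergence => //.
  + by move=> i; apply: emeasurable_funD => //; exact: measurable_cst.
  + by move=> i x Xx; rewrite -leeBlDr// sub0e; exact: hc.
  + by move=> x Xx i j ij; rewrite leeD2r// nd'.
- exact: cvg_cst.
- by apply: fin_num_adde_defl; rewrite fin_numN fin_numM// fin_num_measure.
Qed.

End integrals_bounded_below.

(** * Functionals given by a measure on the ball *)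

Section increasing_limits.
Context (R : realType) (k : nat).
Implicit Types (f g : LC R k) (z : 'rV[R]_k).

Lemma le_hyp f g : (forall x, g x <= f x) -> hyp g `<=` hyp f.
Proof. by move=> gf q; rewrite /hyp/= => /le_trans; apply. Qed.

Lemma increases_to_nd (fs : nat -> LC R k) f i x :
  increases_to fs f -> fs i x <= fs i.+1 x.
Proof. by move=> [nd _]; exact: nd. Qed.

(** Two suprema are exchanged.  A pair [(x, s)] of [hyp f] need not lie in any
    [hyp (fs i)], but [(x, s - e)] does for large [i]. *)
Lemma cvg_ball_support (fs : nat -> LC R k) f z : increases_to fs f ->
  enorm z <= 1 ->
  (ball_support (hyp (fs i)) z @[i --> \oo] --> ball_support (hyp f) z)%E.
Proof.
move=> [nd lim] z1.
have ndS : nondecreasing_seq (fun i => ball_support (hyp (fs i)) z).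
  apply/nondecreasing_seqP => i; apply: ball_support_subset.
  by apply: le_hyp => x; exact: nd.
have fs_le i x : fs i x <= f x.
  have /nondecreasing_cvgn_le : nondecreasing_seq (fs ^~ x).
    by apply/nondecreasing_seqP => j; exact: nd.
  move=> /(_ _ i) h.
  have cv : cvgn (fs ^~ x) by apply/cvg_ex; exists (f x); exact: lim.
  by have := h cv; rewrite (cvg_lim _ (lim x)).
have := ereal_nondecreasing_cvgn ndS.
suff -> : ereal_sup (range (fun i => ball_support (hyp (fs i)) z)) =
    ball_support (hyp f) z by [].
apply/eqP; rewrite eq_le; apply/andP; split.
  apply: ge_ereal_sup => _ [i _ <-]; apply: ball_support_subset.
  by apply: le_hyp => x; exact: fs_le.
apply: ball_support_le => -[x s] /=; rewrite /hyp/= => fx.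
apply/lee_addgt0Pr => e e0.
have ex : expR (s - e) < f x.
  by apply: lt_le_trans fx; rewrite ltr_expR ltrBlDr ltrDl.
have [N _ HN] := cvgr_gt (f x) (lim x) _ ex.
have hN : hyp (fs N) (x, s - e) by rewrite /hyp/= ltW//; apply: HN => /=.
apply: (@le_trans _ _ (ball_support (hyp (fs N)) z + e%:E)%E).
  apply: le_trans (leeD2r _ (ball_support_ge z hN)).
  rewrite -EFinD lee_fin /ball_form/=; have := enorm_ge0 z.
  by nra.
by apply: leeD2r; apply: ereal_sup_ubound; exists N.
Qed.

End increasing_limits.

Section ball_functional.
Context (R : realType) (n : nat).
Local Notation V := (borel_rV R n.+1).
Local Open Scope ereal_scope.
Context (m : {finite_measure set V -> \bar R}).
Implicit Types f g h : LC R n.+1.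

Definition ball_functional f : \bar R :=
  \int[m]_(z in @unit_ball R n) ball_support (hyp f) z.

Let mX := @measurable_unit_ball R n.

Let mh f : measurable_fun (@unit_ball R n) (ball_support (hyp f) : V -> \bar R).
Proof. by apply: measurable_funTS; exact: ball_support_measurable. Qed.

Lemma ball_functional_gtNy f : ball_functional f != -oo.
Proof.
have [c hc] := ball_support_lbound (hyp_neq0 f).
rewrite /ball_functional; exact: (@integral_gtNy _ _ _ m _ mX _ c).
Qed.

Lemma ball_functional_increasing : increasing_functional ball_functional.
Proof.
move=> f g gf; apply: (le_integral_pointwise _ mX) => // z _.
by apply: ball_support_subset; exact: le_hyp.
Qed.

Lemma ball_functional_linear : linear_functional ball_functional.
Proof.
move=> a b f g h a0 b0 hE.
have [c hc] := ball_support_lbound (hyp_neq0 f).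
have [c' hc'] := ball_support_lbound (hyp_neq0 g).
rewrite /ball_functional -(@integral_lincomb _ _ _ m _ mX a b _ _ (Num.max c c'))//.
- by apply: eq_integral => z /set_mem z1; exact: ball_support_sup_conv.
- move=> z z1; apply: le_trans (hc z z1).
  by rewrite lee_fin lerN2 le_max lexx.
- move=> z z1; apply: le_trans (hc' z z1).
  by rewrite lee_fin lerN2 le_max lexx orbT.
Qed.

Lemma ball_functional_continuous : monotone_continuous ball_functional.
Proof.
move=> fs f fsf; have [c hc] := ball_support_lbound (hyp_neq0 (fs 0%N)).
apply: (@cvg_integral_lbound _ _ _ m _ mX _ _ c) => //.
- move=> i z z1; apply: ball_support_subset; apply: le_hyp => x.
  exact: increases_to_nd fsf.
- by move=> z z1; exact: cvg_ball_support.
Qed.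

Lemma ball_functional_bounded (A : set ('rV[R]_n.+1 * R)) (bA : bounded_pairs A) :
  ball_functional (LC_of bA) < +oo.
Proof.
have [A0 [M AM]] := bA.
apply: (@le_lt_trans _ _ (\int[m]_(z in @unit_ball R n) (cst (M + M)%:E z))).
  apply: (le_integral_pointwise _ mX) => // z z1.
  rewrite hyp_LC_of ball_hull_support//; apply: ball_support_le => q /AM[q1 q2].
  rewrite lee_fin /ball_form; have := dotp_le_enorm q.1 z.
  move: z1; rewrite /unit_ball/=; have := enorm_ge0 z; have := enorm_ge0 q.1.
  by move: q2; rewrite ler_norml => /andP[h1 h2] h3 h4 h5 h6; nra.
by rewrite integral_cst// ltey_eq fin_numM// fin_num_measure.
Qed.

End ball_functional.

Section cube_function.
Context (R : realType) (n : nat).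
Local Notation V := (borel_rV R n).

Definition cube_pairs (r s : R) (p : 'rV[R]_n) : set ('rV[R]_n * R) :=
  [set q | q.2 = s /\ exists2 x : V, cube x & q.1 = p + r *: (x : 'rV[R]_n)].

Lemma cube_enorm (x : V) : cube x -> enorm (x : 'rV[R]_n) <= n%:R + 1.
Proof.
move=> x1; rewrite -(ler_pXn2r (n := 2))// ?nnegrE ?enorm_ge0 ?addr_ge0//.
rewrite enorm_sqr /dotp; apply: (@le_trans _ _ (\sum_(i < n) 1)).
  by apply: ler_sum => i _; have := x1 i; rewrite ler_norml => /andP[]; nra.
rewrite sumr_const card_ord; have : 0 <= n%:R :> R by [].
by nra.
Qed.

Lemma bounded_cube_pairs r s p : bounded_pairs (cube_pairs r s p).
Proof.
split; first by exists (p, s); split => //; exists 0; rewrite ?scaler0 ?addr0// => i; rewrite mxE normr0.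
exists (enorm p + `|r| * (n%:R + 1) + `|s|) => -[q t] [/= -> [x /cube_enorm x1 ->]]; split.
  rewrite (le_trans (enormD _ _))// -addrA lerD2l enormZ.
  by rewrite ler_wpDr// ler_wpM2l.
by rewrite lerDr addr_ge0 ?enorm_ge0// mulr_ge0// addr_ge0.
Qed.

End cube_function.

Lemma LC_cube_integral (R : realType) (n : nat) :
  (0 < \int[@lebesgue_rV R n]_(x in [set: borel_rV R n])
     (LC_of (@bounded_cube_pairs R n 1 0 0) x)%:E)%E.
Proof.
set f := LC_of (@bounded_cube_pairs R n 1 0 0).
apply: (@lt_le_trans _ _ (\int[@lebesgue_rV R n]_(x in [set: borel_rV R n])
    (\1_(@cube R n) x)%:E)%E).
  rewrite integral_indic// ?setIT; first exact: lebesgue_cube_gt0.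
  exact: measurable_cube.
apply: ge0_le_integral => //.
- apply/measurable_EFinP; apply: measurable_indic; exact: measurable_cube.
- apply/measurable_EFinP; exact: LC_measurable.
- move=> x _; rewrite lee_fin indicE; case: (boolP (x \in _)) => [/set_mem x1|_].
    have : hyp f (x, 0).
      rewrite hyp_LC_of; apply: sub_ball_hull; split => //.
      by exists x => //=; rewrite scale1r add0r.
    by rewrite /hyp/= expR0.
  exact: LC_ge0.
Qed.

(** The function that witnesses finiteness is generated by a cube at height zero:
    it is at least 1 on a set of positive volume and its supports are bounded. *)
Theorem integral_functional_properties (R : realType) (n : nat)
    (mu : {finite_measure set (borel_rV R n.+1) -> \bar R})
    (nu : {finite_measure set (borel_sphere R n) -> \bar R}) :
  finite_first_moment mu ->
  let F := integral_functional mu nu in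
  [/\ forall f, F f != -oo%E, linear_functional F, increasing_functional F,
      finite_somewhere F & monotone_continuous F].
Proof.
move=> mu1 F; have [m m0 mD] := ball_measure_exists nu mu1.
have -> : F = ball_functional m.
  by apply/funext => f; exact: integral_functional_ball.
split.
- exact: ball_functional_gtNy.
- exact: ball_functional_linear.
- exact: ball_functional_increasing.
- exists (LC_of (@bounded_cube_pairs R n.+1 1 0 0)); split.
    exact: LC_cube_integral.
  exact: ball_functional_bounded.
- exact: ball_functional_continuous.
Qed.

(** * The lattice of differences of support functions *)

Section support_differences.
Context (R : realType) (n : nat).
Local Notation V := (borel_rV R n.+1).
Implicit Types (A B C E : set ('rV[R]_n.+1 * R)) (z y : 'rV[R]_n.+1).

Definition ball_supportR A z : R := fine (ball_support A z).

Lemma ball_supportRE A z : bounded_pairs A -> ball_support A z = (ball_supportR A z)%:E.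
Proof. exact: ball_support_fin. Qed.

Definition support_difference (u : V -> R) := exists A B,
  [/\ bounded_pairs A, bounded_pairs B &
      forall z, u z = ball_supportR A z - ball_supportR B z].

Lemma bounded_set1 (q : 'rV[R]_n.+1 * R) : bounded_pairs [set q].
Proof.
split; first by exists q.
exists (enorm q.1 + `|q.2|) => _ ->; split; first by rewrite lerDl.
by rewrite lerDr enorm_ge0.
Qed.

Lemma ball_support_set1 (q : 'rV[R]_n.+1 * R) z : ball_support [set q] z = (ball_form q z)%:E.
Proof. by rewrite /ball_support image_set1 ereal_sup1. Qed.

Lemma ball_supportR_set1 (q : 'rV[R]_n.+1 * R) z : ball_supportR [set q] z = ball_form q z.
Proof. by rewrite /ball_supportR ball_support_set1. Qed.

Lemma ball_form0 z : ball_form (0, 0) z = 0.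
Proof. by rewrite /ball_form dotp0l mul0r addr0. Qed.

Lemma ball_supportR0 z : ball_supportR [set (0, 0)] z = 0.
Proof. by rewrite ball_supportR_set1 ball_form0. Qed.

Lemma ball_supportR_mink a A b B z : 0 < a -> 0 < b ->
  bounded_pairs A -> bounded_pairs B ->
  ball_supportR (mink a A b B) z = a * ball_supportR A z + b * ball_supportR B z.
Proof.
move=> a0 b0 bA bB; apply: EFin_inj.
rewrite -ball_supportRE; last exact: bounded_mink.
have [A0 B0] := conj bA.1 bB.1.
by rewrite ball_support_mink// (ball_supportRE _ bA) (ball_supportRE _ bB).
Qed.

Lemma bounded_setU A B : bounded_pairs A -> bounded_pairs B -> bounded_pairs (A `|` B).
Proof.
move=> [[p Ap] [M AM]] [_ [N BN]]; split; first by exists p; left.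
exists (Num.max M N) => q [/AM|/BN] [q1 q2]; rewrite !le_max q1 q2 ?orbT//.
Qed.

Lemma ball_supportR_setU A B z : bounded_pairs A -> bounded_pairs B ->
  ball_supportR (A `|` B) z = Num.max (ball_supportR A z) (ball_supportR B z).
Proof.
move=> bA bB; apply: EFin_inj; rewrite EFin_max -!ball_supportRE//; last first.
  exact: bounded_setU.
apply/eqP; rewrite eq_le; apply/andP; split.
  by apply: ball_support_le => q [|] /(ball_support_ge z) h; rewrite le_max h ?orbT.
by rewrite ge_max !ball_support_subset.
Qed.

Lemma ball_supportR_lipschitz A : bounded_pairs A -> exists M, forall z y,
  ball_supportR A z <= ball_supportR A y + M * (enorm (z - y) + `|enorm z - enorm y|).
Proof.
move=> bA; have [_ [M AM]] := bA; exists M => z y.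
rewrite -lee_fin -ball_supportRE//; apply: ball_support_le => q Aq.
have := ball_support_ge y Aq; rewrite ball_supportRE// !lee_fin.
have [q1 q2] := AM q Aq.
have := dotp_le_enorm q.1 (z - y); rewrite dotpDr dotpNr /ball_form.
have : q.2 * (enorm y - enorm z) <= M * `|enorm z - enorm y|.
  rewrite (le_trans (ler_norm _))// normrM distrC ler_wpM2r//.
have : enorm q.1 * enorm (z - y) <= M * enorm (z - y).
  by rewrite ler_wpM2r// enorm_ge0.
by lra.
Qed.

Lemma ball_supportR_continuous A : bounded_pairs A -> continuous (ball_supportR A).
Proof.
move=> bA y; have [M AM] := ball_supportR_lipschitz bA.
pose dl z := `|M| * (enorm (z - y) + `|enorm z - enorm y|).
have dl0 : dl z @[z --> y] --> 0.
  have -> : 0 = `|M| * (enorm (y - y) + `|enorm y - enorm y|).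
    by rewrite !subrr enorm0 normr0 addr0 mulr0.
  exact: cvgM (cvg_cst _) (cvgD (@enorm_subr_continuous _ _ y y)
    (cvg_norm (cvgB (@enorm_continuous _ _ y) (cvg_cst _)))).
have bnd z w : ball_supportR A z <= ball_supportR A w +
    `|M| * (enorm (z - w) + `|enorm z - enorm w|).
  apply: le_trans (AM z w) _; rewrite lerD2l ler_wpM2r ?ler_norm//.
  by rewrite addr_ge0 ?enorm_ge0.
apply/(@cvgrPdist_le _ _ _ _ (nbhs_filter y)) => e e0.
move/cvgrPdist_le : dl0 => /(_ e e0); apply: filterS => z.
rewrite sub0r normrN ger0_norm; last first.
  by rewrite mulr_ge0// addr_ge0 ?enorm_ge0.
move=> dle; rewrite ler_norml; have := bnd z y; have := bnd y z.
rewrite -(opprB z y) enormN [`|enorm y - _|]distrC -/(dl z).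
by move: dle; lra.
Qed.

Lemma support_difference_continuous u : support_difference u ->
  continuous (u : 'rV[R]_n.+1 -> R).
Proof.
move=> [A [B [bA bB uE]]] z; rewrite (_ : u = (fun z => ball_supportR A z - ball_supportR B z)).
  exact: cvgB (@ball_supportR_continuous _ bA z) (@ball_supportR_continuous _ bB z).
by apply/funext.
Qed.

Lemma support_difference1 A : bounded_pairs A -> support_difference (ball_supportR A).
Proof.
move=> bA; exists A, [set (0, 0)]; split => //; first exact: bounded_set1.
by move=> z; rewrite ball_supportR0 subr0.
Qed.

Lemma support_differenceD u v : support_difference u -> support_difference v ->
  support_difference (fun z => u z + v z).
Proof.
move=> [A [B [bA bB uE]]] [C [E [bC bE vE]]].
exists (mink 1 A 1 C), (mink 1 B 1 E); split; [exact: bounded_mink..|move=> z].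
by rewrite !ball_supportR_mink// uE vE; ring.
Qed.

Lemma support_differenceN u : support_difference u -> support_difference (fun z => - u z).
Proof.
move=> [A [B [bA bB uE]]]; exists B, A; split => // z.
by rewrite uE opprB.
Qed.

Lemma support_differenceZ a u : support_difference u -> support_difference (fun z => a * u z).
Proof.
have b0 := bounded_set1 (0, 0).
have pos c v : 0 < c -> support_difference v -> support_difference (fun z => c * v z).
  move=> c0 [A [B [bA bB uE]]].
  exists (mink c A 1 [set (0, 0)]), (mink c B 1 [set (0, 0)]).
  split; [exact: bounded_mink..|move=> z].
  by rewrite !ball_supportR_mink// uE ball_supportR0; ring.
move=> Du; have [a0|a0|->] := ltgtP a 0; last 1 first.
- exists [set (0, 0)], [set (0, 0)]; split => // z.
  by rewrite ball_supportR0 mul0r subrr.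
- rewrite (_ : (fun z => _) = (fun z => - (- a * u z))).
    by apply: support_differenceN; apply: pos => //; rewrite oppr_gt0.
  by apply/funext => z; rewrite mulNr opprK.
- exact: pos.
Qed.

Lemma support_difference_max u v : support_difference u -> support_difference v ->
  support_difference (fun z => Num.max (u z) (v z)).
Proof.
move=> [A [B [bA bB uE]]] [C [E [bC bE vE]]].
have bAE := bounded_mink 1 1 bA bE; have bCB := bounded_mink 1 1 bC bB.
exists (mink 1 A 1 E `|` mink 1 C 1 B), (mink 1 B 1 E); split.
- exact: bounded_setU.
- exact: bounded_mink.
(* [max (p - q) (r - s) = max (p + s) (r + q) - (q + s)]: unions give maxima. *)
move=> z; rewrite ball_supportR_setU// !ball_supportR_mink// uE vE !mul1r.
set p := ball_supportR A z; set q := ball_supportR B z.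
set r := ball_supportR C z; set s := ball_supportR E z.
by case: (leP (p - q) (r - s)); case: (leP (p + s) (r + q)); lra.
Qed.

(** The constant 1 is the support function of the unit ball at height one. *)
Lemma support_difference_cst1 : support_difference (cst 1).
Proof.
pose A : set ('rV[R]_n.+1 * R) := [set q | enorm q.1 <= 1 /\ q.2 = 1].
have bA : bounded_pairs A.
  split; first by exists (0, 1); split; rewrite //= enorm0.
  by exists 1 => q [q1 ->]; rewrite normr1.
suff -> : cst 1 = ball_supportR A :> (V -> R) by exact: support_difference1.
apply/funext => z /=; apply: EFin_inj; rewrite -ball_supportRE//.
apply/eqP; rewrite eq_le; apply/andP; split; last first.
  apply: ball_support_le => q [q1 q2]; rewrite lee_fin /ball_form q2.
  have := dotp_le_enorm q.1 z; have := enorm_ge0 z; nra.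
have [z0|z0] := eqVneq (enorm z) 0.
  apply: (@le_trans _ _ (ball_form (0, 1) z)%:E).
    by rewrite lee_fin /ball_form dotp0l z0 subr0 mulr1 add0r.
  by apply: ball_support_ge; split; rewrite //= enorm0.
apply: (@le_trans _ _ (ball_form ((enorm z)^-1 *: z, 1) z)%:E).
  rewrite lee_fin /ball_form/= dotpZl -enorm_sqr mul1r expr2 mulrA mulVf// mul1r.
  by rewrite addrC subrK.
apply: ball_support_ge; split => //=; rewrite enormZ ger0_norm ?invr_ge0 ?enorm_ge0//.
by rewrite mulVf.
Qed.

Lemma support_difference_coord j : support_difference (fun z : V => z ord0 j).
Proof.
rewrite (_ : (fun z : V => _) = ball_supportR [set (delta_mx ord0 j, 0)]).
  by apply: support_difference1; exact: bounded_set1.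
apply/funext => z; rewrite ball_supportR_set1 /ball_form/= mul0r addr0.
by rewrite dotp_delta.
Qed.

Lemma ball_supportR_bounded A : bounded_pairs A ->
  exists M, forall z, enorm z <= 1 -> `|ball_supportR A z| <= M.
Proof.
move=> bA; have [M AM] := ball_supportR_lipschitz bA.
exists (`|ball_supportR A 0| + `|M| * 2) => z z1.
have e0 := enorm_ge0 z.
have Me : M * (enorm z + `|enorm z|) <= `|M| * 2.
  rewrite ger0_norm//; apply: (@le_trans _ _ (`|M| * (enorm z + enorm z))).
    by rewrite ler_wpM2r ?ler_norm// addr_ge0.
  by rewrite ler_wpM2l//; lra.
have := AM z 0; have := AM 0 z.
rewrite enorm0 !subr0 !sub0r enormN normrN => h2 h1.
have := ler_norm (ball_supportR A 0); have := ler_norm (- ball_supportR A 0).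
by rewrite normrN ler_norml; move: h1 h2 Me; lra.
Qed.

(** The coordinates and the constants belong to the lattice, so its positivity
    sets include all half-spaces bounded by coordinate hyperplanes. *)
Lemma support_difference_lattice : vector_lattice (@unit_ball R n) support_difference.
Proof.
split.
- exact: support_difference_cst1.
- by move=> a u b v Du Dv; apply: support_differenceD; exact: support_differenceZ.
- exact: support_difference_max.
- move=> u [A [B [bA bB uE]]].
  have [M AM] := ball_supportR_bounded bA; have [N BN] := ball_supportR_bounded bB.
  exists (M + N) => z z1; rewrite uE (le_trans (ler_normB _ _))//.
  by rewrite lerD ?AM ?BN.
- move=> u Du; apply: continuous_measurable_rV; exact: support_difference_continuous.
- set G := [set _ | _ in _] => A mA.
  have mid : measurable_fun [set: g_sigma_algebraType G]
      (id : g_sigma_algebraType G -> V).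
    apply: measurable_fun_rV => j.
    apply: (measurability _ (RGenOInfty.measurableE R)).
    move=> _ [_ [c ->] <-]; rewrite setTI; apply: sub_sigma_algebra.
    exists (fun z : V => z ord0 j - c * 1).
      apply: support_differenceD; first exact: support_difference_coord.
      apply: support_differenceN; apply: support_differenceZ.
      exact: support_difference_cst1.
    by apply/seteqP; split => z /=; rewrite in_itv/= andbT mulr1 subr_gt0.
  have := mid measurableT A mA; rewrite setTI; exact.
Qed.

End support_differences.

(** * Representation of functionals *)

Section representation.
Context (R : realType) (n : nat).
Local Notation V := (borel_rV R n.+1).
Local Notation X := (@unit_ball R n).
Context (F : LC R n.+1 -> \bar R).
Hypothesis F_gtNy : forall f, F f != -oo%E.
Hypothesis F_lin : linear_functional F.
Hypothesis F_inc : increasing_functional F.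
Hypothesis F_fin : finite_somewhere F.
Hypothesis F_cont : monotone_continuous F.
Implicit Types (A B C E : set ('rV[R]_n.+1 * R)) (z : 'rV[R]_n.+1).

Lemma functional_le A B (bA : bounded_pairs A) (bB : bounded_pairs B) :
  (forall z, enorm z <= 1 -> ball_supportR A z <= ball_supportR B z) ->
  (F (LC_of bA) <= F (LC_of bB))%E.
Proof.
move=> AB; apply: F_inc; apply: hyp_le; rewrite !hyp_LC_of.
by apply: ball_hull_le => z z1; rewrite !ball_supportRE// lee_fin AB.
Qed.

(** A total function of sets, so that no proof of boundedness has to be carried by
    the expressions in which it occurs. *)
Definition on_pairs A : \bar R :=
  if pselect (bounded_pairs A) is left bA then F (LC_of bA) else 0%E.

Lemma on_pairsE A (bA : bounded_pairs A) : on_pairs A = F (LC_of bA).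
Proof.
rewrite /on_pairs; case: pselect => // bA'.
by apply/eqP; rewrite eq_le !functional_le.
Qed.

Lemma on_pairs_le A B : bounded_pairs A -> bounded_pairs B ->
  (forall z, enorm z <= 1 -> ball_supportR A z <= ball_supportR B z) ->
  (on_pairs A <= on_pairs B)%E.
Proof. by move=> bA bB AB; rewrite !on_pairsE functional_le. Qed.

Lemma on_pairs_eq A B : bounded_pairs A -> bounded_pairs B ->
  (forall z, enorm z <= 1 -> ball_supportR A z = ball_supportR B z) ->
  on_pairs A = on_pairs B.
Proof.
move=> bA bB AB; apply/eqP; rewrite eq_le; apply/andP; split;
  by apply: on_pairs_le => // z z1; rewrite AB.
Qed.

Lemma on_pairs_mink a A b B : 0 < a -> 0 < b -> bounded_pairs A -> bounded_pairs B ->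
  on_pairs (mink a A b B) = (a%:E * on_pairs A + b%:E * on_pairs B)%E.
Proof.
move=> a0 b0 bA bB; rewrite (on_pairsE bA) (on_pairsE bB).
rewrite (on_pairsE (bounded_mink a b bA bB)).
by apply: F_lin => // x; exact: LC_of_mink.
Qed.

Lemma on_pairs_gtNy A : bounded_pairs A -> on_pairs A != -oo%E.
Proof. by move=> bA; rewrite on_pairsE. Qed.

Let b0 := @bounded_set1 R n (0, 0).

(** The function [f0] on which [F] is finite dominates a constant on a cube. *)
Lemma on_pairs_cube : exists r s p, 0 < r /\ (on_pairs (cube_pairs r s p) < +oo)%E.
Proof.
have [f0 [f0_int f0_fin]] := F_fin.
have [p [s [r [r0 hc]]]] := hyp_cube f0_int.
exists r, s, p; split => //; rewrite (on_pairsE (bounded_cube_pairs r s p)).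
apply: le_lt_trans f0_fin; apply: F_inc; apply: hyp_le; rewrite hyp_LC_of.
apply: subset_trans (@ball_hull_hyp _ _ f0); apply: ball_hull_le => z z1.
apply: ball_support_subset => -[q t] [/= -> [x x1 ->]]; exact: hc.
Qed.

(** [F] is additive and [{(0, 0)}] is neutral for Minkowski sums; the value can be
    cancelled as [F] is finite at some cube. *)
Lemma on_pairs0 : on_pairs [set (0, 0)] = 0%E.
Proof.
have [r [s [p [r0 Cfin]]]] := on_pairs_cube.
have bC := bounded_cube_pairs r s p.
have := on_pairs_mink ltr01 ltr01 bC b0.
rewrite (@on_pairs_eq _ (cube_pairs r s p)) //; last 2 first.
- exact: bounded_mink.
- by move=> z z1; rewrite ball_supportR_mink// ball_supportR0; ring.
rewrite !mul1e; have := on_pairs_gtNy bC; have := on_pairs_gtNy b0.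
case: (on_pairs (cube_pairs r s p)) Cfin => [c| |]// _ + _.
case: (on_pairs _) => [d| |]// _ [] h; congr EFin; move: h; lra.
Qed.

(** The values at opposite point masses add up to the value 0 at the origin. *)
Lemma on_pairs_set1 (q : 'rV[R]_n.+1 * R) : (on_pairs [set q] < +oo)%E.
Proof.
have bq := bounded_set1 q; have bq' := bounded_set1 (- q.1, - q.2).
have := on_pairs_mink ltr01 ltr01 bq bq'.
rewrite (@on_pairs_eq _ [set (0, 0)]) //; last 2 first.
- exact: bounded_mink.
- move=> z z1; rewrite ball_supportR_mink// ball_supportR0 !ball_supportR_set1.
  by rewrite /ball_form/= dotpNl; ring.
rewrite on_pairs0 !mul1e; have := on_pairs_gtNy bq; have := on_pairs_gtNy bq'.
case: (on_pairs [set q]) => [c| |]; rewrite ?ltry//.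
by case: (on_pairs _) => [d| |].
Qed.

(** Up to a translation, every bounded set is dominated by a multiple of the
    cube on which [F] is finite. *)
Lemma on_pairs_fin A : bounded_pairs A -> on_pairs A \is a fin_num.
Proof.
move=> bA; rewrite fin_numE on_pairs_gtNy//= -ltey.
have [r [s [p [r0 Cfin]]]] := on_pairs_cube.
have bC := bounded_cube_pairs r s p.
have [A0 [M AM]] := bA.
pose l := (`|M| + 1) / r.
have l0 : 0 < l by rewrite divr_gt0// ltr_wpDl.
pose q' : 'rV[R]_n.+1 * R := (- (l *: p), M - l * s).
have bq' := bounded_set1 q'.
apply: (@le_lt_trans _ _ (on_pairs (mink l (cube_pairs r s p) 1 [set q']))).
  apply: on_pairs_le => //; first exact: bounded_mink.
  move=> z z1; rewrite ball_supportR_mink// ball_supportR_set1 mul1r.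
  rewrite -lee_fin -ball_supportRE//; apply: ball_support_le => q Aq; rewrite lee_fin.
  have [q1 q2] := AM q Aq.
  pose x : V := ((l * r)^-1 *: q.1 : 'rV[R]_n.+1).
  have lrE : l * r = `|M| + 1 by rewrite /l mulfVK ?gt_eqF.
  have lr0 : 0 < l * r by rewrite mulr_gt0.
  have Cx : cube_pairs r s p (p + r *: (x : 'rV[R]_n.+1), s).
    split => //; exists x => // i; rewrite /x mxE normrM gtr0_norm ?invr_gt0//.
    rewrite mulrC ler_pdivrMr// mul1r lrE (le_trans (coord_le_enorm _ _))//.
    by rewrite (le_trans q1)// (le_trans (ler_norm _))// lerDl.
  have := ball_support_ge z Cx; rewrite ball_supportRE// lee_fin => h.
  apply: (@le_trans _ _ (l * ball_form (p + r *: (x : 'rV[R]_n.+1), s) z + ball_form q' z)).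
    have -> : l * ball_form (p + r *: (x : 'rV[R]_n.+1), s) z + ball_form q' z =
        ball_form (q.1, M) z.
      rewrite /ball_form/= /x dotpDl dotpNl !dotpZl.
      by move: (lt0r_neq0 l0) (lt0r_neq0 r0) => l_neq r_neq; field; rewrite l_neq r_neq.
    by rewrite {1}[q]surjective_pairing ball_formS// (le_trans (ler_norm _)).
  by rewrite lerD2r ler_wpM2l// ltW.
rewrite on_pairs_mink// mul1e; apply: lte_add_pinfty; last exact: on_pairs_set1.
by rewrite lte_mul_pinfty ?lee_fin// ltW.
Qed.

Definition on_pairsR A : R := fine (on_pairs A).

Lemma on_pairsRE A : bounded_pairs A -> on_pairs A = (on_pairsR A)%:E.
Proof. by move=> bA; rewrite fineK// on_pairs_fin. Qed.

Lemma on_pairsR_mink a A b B : 0 < a -> 0 < b -> bounded_pairs A -> bounded_pairs B ->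
  on_pairsR (mink a A b B) = a * on_pairsR A + b * on_pairsR B.
Proof.
move=> a0 b0' bA bB; apply: EFin_inj; rewrite -on_pairsRE; last exact: bounded_mink.
by rewrite on_pairs_mink// !on_pairsRE.
Qed.

Lemma on_pairsR_le A B : bounded_pairs A -> bounded_pairs B ->
  (forall z, enorm z <= 1 -> ball_supportR A z <= ball_supportR B z) ->
  on_pairsR A <= on_pairsR B.
Proof. by move=> bA bB AB; rewrite -lee_fin -!on_pairsRE// on_pairs_le. Qed.

(** The linear extension of [F] to differences of support functions; [xget] picks
    the common value of all representations of [u] as a difference
    ([difference_functionalE]). *)
Definition difference_functional (u : V -> R) : R :=
  xget 0 [set c | exists A B, [/\ bounded_pairs A, bounded_pairs B,
    forall z, u z = ball_supportR A z - ball_supportR B z &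
    c = on_pairsR A - on_pairsR B]].

(** Moving the subtracted terms to the other side turns an inequality between
    differences into one between Minkowski sums, where [F] is monotone.  With
    [u = v] it shows that the extension is well defined. *)
Lemma difference_functional_le u v A B C E :
  bounded_pairs A -> bounded_pairs B -> bounded_pairs C -> bounded_pairs E ->
  (forall z, u z = ball_supportR A z - ball_supportR B z) ->
  (forall z, v z = ball_supportR C z - ball_supportR E z) ->
  (forall z, enorm z <= 1 -> u z <= v z) ->
  on_pairsR A - on_pairsR B <= on_pairsR C - on_pairsR E.
Proof.
move=> bA bB bC bE uE vE uv.
have : on_pairsR (mink 1 A 1 E) <= on_pairsR (mink 1 C 1 B).
  apply: on_pairsR_le; [exact: bounded_mink..|move=> z z1].
  by rewrite !ball_supportR_mink//; have := uv z z1; rewrite uE vE; lra.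
by rewrite !on_pairsR_mink//; lra.
Qed.

Lemma difference_functionalE u A B : bounded_pairs A -> bounded_pairs B ->
  (forall z, u z = ball_supportR A z - ball_supportR B z) ->
  difference_functional u = on_pairsR A - on_pairsR B.
Proof.
move=> bA bB uE; rewrite /difference_functional.
case: xgetP => [c _ [C [E [bC bE uE' ->]]]|/(_ (on_pairsR A - on_pairsR B)) []].
  by apply/eqP; rewrite eq_le; apply/andP; split;
    exact: (@difference_functional_le u u).
by exists A, B.
Qed.

Lemma difference_functional_lin a u b v :
  support_difference u -> support_difference v ->
  difference_functional (fun z => a * u z + b * v z) =
  a * difference_functional u + b * difference_functional v.
Proof.
have add u1 u2 : support_difference u1 -> support_difference u2 ->
    difference_functional (fun z => u1 z + u2 z) =
    difference_functional u1 + difference_functional u2.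
  move=> [A [B [bA bB uE]]] [C [E [bC bE vE]]].
  rewrite (difference_functionalE bA bB uE) (difference_functionalE bC bE vE).
  rewrite (@difference_functionalE _ (mink 1 A 1 C) (mink 1 B 1 E)).
  - by rewrite !on_pairsR_mink//; ring.
  - exact: bounded_mink.
  - exact: bounded_mink.
  - by move=> z; rewrite !ball_supportR_mink// uE vE; ring.
have opp u1 : support_difference u1 ->
    difference_functional (fun z => - u1 z) = - difference_functional u1.
  move=> [A [B [bA bB uE]]].
  rewrite (difference_functionalE bA bB uE) (difference_functionalE bB bA) ?opprB//.
  by move=> z; rewrite uE opprB.
have pos c u1 : 0 < c -> support_difference u1 ->
    difference_functional (fun z => c * u1 z) = c * difference_functional u1.
  move=> c0 [A [B [bA bB uE]]].
  rewrite (difference_functionalE bA bB uE).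
  rewrite (@difference_functionalE _ (mink c A 1 [set (0, 0)]) (mink c B 1 [set (0, 0)])).
  - by rewrite !on_pairsR_mink//; ring.
  - exact: bounded_mink.
  - exact: bounded_mink.
  - by move=> z; rewrite !ball_supportR_mink// uE ball_supportR0; ring.
have scale c u1 : support_difference u1 ->
    difference_functional (fun z => c * u1 z) = c * difference_functional u1.
  move=> Du; have [c0|c0|->] := ltgtP c 0; last 1 first.
  - rewrite mul0r (@difference_functionalE _ [set (0, 0)] [set (0, 0)])// ?subrr//.
    by move=> z; rewrite mul0r subrr.
  - rewrite (_ : (fun z => _) = (fun z => - (- c * u1 z))).
      rewrite opp; last exact: support_differenceZ.
      by rewrite pos// ?oppr_gt0// mulNr opprK.
    by apply/funext => z; rewrite mulNr opprK.
  - exact: pos.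
by move=> Du Dv; rewrite add ?scale//; exact: support_differenceZ.
Qed.

Lemma difference_functional_pos u : support_difference u ->
  (forall z, X z -> 0 <= u z) -> 0 <= difference_functional u.
Proof.
move=> [A [B [bA bB uE]]] u0.
rewrite (difference_functionalE bA bB uE) subr_ge0; apply: on_pairsR_le => // z z1.
by rewrite -subr_ge0 -uE; exact: u0.
Qed.

(** As in Dini's theorem, compactness of the ball makes one [e i] at least [1 - d]
    everywhere. *)
Lemma difference_functional_compact (e : nat -> V -> R) :
  (forall i, support_difference (e i)) ->
  (forall i z, X z -> e i z <= e i.+1 z) -> (forall i z, X z -> 0 <= e i z) ->
  (forall z, X z -> exists i, 1 <= e i z) ->
  forall c, (forall i, difference_functional (e i) <= c) ->
  difference_functional (cst 1) <= c.
Proof.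
move=> De nd e0 e1 c Le.
have DL := @support_difference_lattice R n.
have Ll := difference_functional_lin; have Lp := difference_functional_pos.
have L1 : 0 <= difference_functional (cst 1).
  by apply: Lp => //; exact: support_difference_cst1.
have nd' z : X z -> {homo e ^~ z : i j / (i <= j)%N >-> i <= j}.
  by move=> Xz; apply: homo_leq => [//||i]; [exact: le_trans|exact: nd].
have cX : compact (X : set 'rV[R]_n.+1).
  apply: bounded_closed_compact.
    by apply: (@bounded_enorm _ _ _ 0 1) => z; rewrite subr0.
  exact: closed_unit_enorm_ball.
suff step d : 0 < d -> (1 - d) * difference_functional (cst 1) <= c.
  apply/ler_addgt0Pr => d d0.
  have k0 : 0 < difference_functional (cst 1) + 1 by rewrite ltr_wpDl.
  have := step (d / (difference_functional (cst 1) + 1)).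
  rewrite divr_gt0// => /(_ isT).
  have : d / (difference_functional (cst 1) + 1) * difference_functional (cst 1) <= d.
    by rewrite mulrAC ler_pdivrMr// ler_pM2l// lerDl.
  by rewrite mulrBl mul1r; lra.
move=> d0.
have [N XN] : exists N, forall z, X z -> 1 - d <= e N z.
  move: cX; rewrite compact_cover => /(_ nat setT (fun i => [set z | 1 - d < e i z])).
  case.
  - move=> i _; apply: open_comp (@open_gt _ _) => z _.
    exact: support_difference_continuous.
  - move=> z Xz; have [i ei] := e1 z Xz; exists i => //=.
    by apply: lt_le_trans ei; rewrite ltrBlDr ltrDl.
  move=> D _ XD; exists (\max_(i <- finmap.enum_fset D) i)%N => z Xz.
  have [i iD /= /ltW ei] := XD z Xz; apply: le_trans ei _; apply: nd' => //.
  by apply: leq_bigmax_seq.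
apply: le_trans (Le N).
have DN : support_difference (fun z => (1 - d) * cst 1 z).
  exact/support_differenceZ/support_difference_cst1.
have <- : difference_functional (fun z => (1 - d) * cst 1 z) =
    (1 - d) * difference_functional (cst 1).
  by rewrite (daniell_scale Ll)//; exact: support_difference_cst1.
apply: (daniell_le DL Ll Lp) => // z Xz.
by rewrite /= mulr1; exact: XN.
Qed.

(** The formula holds on functions generated by bounded sets, and both sides are
    continuous along increasing sequences. *)
Lemma functional_ball_measure : exists m : {finite_measure set V -> \bar R},
  m (~` X) = 0%E /\ forall f, F f = ball_functional m f.
Proof.
have [m [m0 mE]] := daniell_representation (@support_difference_lattice R n)
  difference_functional_lin difference_functional_pos (@measurable_unit_ball R n)
  difference_functional_compact.
exists m; split => // f.
have eqb A (bA : bounded_pairs A) : F (LC_of bA) = ball_functional m (LC_of bA).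
  rewrite -on_pairsE on_pairsRE//.
  transitivity (difference_functional (ball_supportR A))%:E.
    rewrite (difference_functionalE bA b0); last first.
      by move=> z; rewrite ball_supportR0 subr0.
    by rewrite [X in _ - X](_ : _ = 0) ?subr0// /on_pairsR on_pairs0.
  rewrite -mE; last exact: support_difference1.
  apply: eq_integral => z /set_mem z1.
  by rewrite hyp_LC_of ball_hull_support// ball_supportRE.
have [A [bA Af]] := LC_approx f.
apply: cvg_unique (F_cont Af) _ => //.
have -> : (fun i => F (LC_of (bA i))) = (fun i => ball_functional m (LC_of (bA i))).
  by apply/funext => i; exact: eqb.
exact: (@ball_functional_continuous R n m _ f Af).
Qed.

End representation.

(** The functionals determine the integrals of support functions of bounded sets,
    hence those of the whole lattice. *)
Lemma ball_functional_unique (R : realType) (n : nat)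
    (m m' : {finite_measure set (borel_rV R n.+1) -> \bar R}) :
  m (~` @unit_ball R n) = 0%E -> m' (~` @unit_ball R n) = 0%E ->
  (forall f, ball_functional m f = ball_functional m' f) ->
  forall A, measurable A -> m A = m' A.
Proof.
move=> m0 m'0 mm'; have DL := @support_difference_lattice R n.
have mX := @measurable_unit_ball R n.
have mb A : bounded_pairs A ->
    (\int[m]_(z in @unit_ball R n) (ball_supportR A z)%:E =
     \int[m']_(z in @unit_ball R n) (ball_supportR A z)%:E)%E.
  move=> bA; have bE (p : {finite_measure set (borel_rV R n.+1) -> \bar R}) :
    ball_functional p (LC_of bA) = (\int[p]_(z in @unit_ball R n) (ball_supportR A z)%:E)%E.
    apply: eq_integral => z /set_mem z1.
    by rewrite hyp_LC_of ball_hull_support// ball_supportRE.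
  by rewrite -!bE.
apply: (lattice_measure_unique DL) => // u Du.
have [A [B [bA bB uE]]] := Du.
have intS (p : {finite_measure set (borel_rV R n.+1) -> \bar R}) C : bounded_pairs C ->
    p.-integrable (@unit_ball R n) (EFin \o ball_supportR C).
  move=> bC; have [M CM] := ball_supportR_bounded bC.
  have intM : p.-integrable (@unit_ball R n) (EFin \o cst M).
    exact: finite_measure_integrable_cst.
  apply: le_integrable intM => //.
    apply/measurable_EFinP; apply: measurable_funTS.
    apply: continuous_measurable_rV; exact: ball_supportR_continuous.
  by move=> z z1 /=; rewrite lee_fin (le_trans (CM z z1))// ler_norm.
have split (p : {finite_measure set (borel_rV R n.+1) -> \bar R}) :
    (\int[p]_(z in @unit_ball R n) (u z)%:E =
     \int[p]_(z in @unit_ball R n) (ball_supportR A z)%:E -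
     \int[p]_(z in @unit_ball R n) (ball_supportR B z)%:E)%E.
  transitivity (\int[p]_(z in @unit_ball R n)
      ((ball_supportR A z)%:E - (ball_supportR B z)%:E))%E.
    by apply: eq_integral => z _; rewrite uE EFinB.
  exact: (integralB mX (intS p A bA) (intS p B bB)).
by rewrite !split !mb.
Qed.

Theorem functional_representation (R : realType) (n : nat) (F : LC R n.+1 -> \bar R) :
  (forall f, F f != -oo%E) -> linear_functional F -> increasing_functional F ->
  finite_somewhere F -> monotone_continuous F ->
  exists (mu : {finite_measure set (borel_rV R n.+1) -> \bar R})
         (nu : {finite_measure set (borel_sphere R n) -> \bar R}),
    [/\ finite_first_moment mu,
        forall f, F f = integral_functional mu nu f &
        forall (mu' : {finite_measure set (borel_rV R n.+1) -> \bar R})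
               (nu' : {finite_measure set (borel_sphere R n) -> \bar R}),
          finite_first_moment mu' ->
          (forall f, F f = integral_functional mu' nu' f) ->
          (forall A, measurable A -> mu' A = mu A) /\
          (forall B, measurable B -> nu' B = nu B)].
Proof.
move=> FN Fl Fi Ff Fc; have [m [m0 mE]] := functional_ball_measure FN Fl Fi Ff Fc.
have [mu [nu D]] := ball_measure_split m0.
exists mu, nu; split.
- apply/finite_first_moment1; have := D (cst 1%E) (measurable_cst _) (fun=> lee01).
  rewrite integral_cst// mul1e => mT.
  have : (m setT < +oo)%E by rewrite ltey_eq fin_num_measure.
  rewrite [m setT]mT; apply: le_lt_trans.
  under [in leRHS]eq_integral do rewrite mule1.
  by rewrite leeDl// integral_ge0.
- by move=> f; rewrite mE (integral_functional_ball f m0 D).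
- move=> mu' nu' mu'1 FE.
  have [m' m'0 D'] := ball_measure_exists nu' mu'1.
  have mm' A : measurable A -> m A = m' A.
    apply: ball_functional_unique => // f.
    by rewrite -mE FE (integral_functional_ball f m'0 D').
  have D2 : ball_decomposition m mu' nu'.
    move=> g mg g0; rewrite -D'//; apply: eq_measure_integral => A mA _.
    exact: mm'.
  have [h1 h2] := ball_decomposition_unique D2 D.
  by split.
Qed.

Unset Implicit Arguments.
Local Open Scope ereal_scope.

Theorem theorem1p8 (R : realType) (n : nat) :
  (forall F : LC R n.+1 -> \bar R,
     (forall f, F f != -oo) ->
     linear_functional F -> increasing_functional F ->
     finite_somewhere F -> monotone_continuous F ->
     exists (mu : {finite_measure set (borel_rV R n.+1) -> \bar R})
            (nu : {finite_measure set (borel_sphere R n) -> \bar R}),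
       [/\ finite_first_moment mu,
           forall f, F f = integral_functional mu nu f &
           forall (mu' : {finite_measure set (borel_rV R n.+1) -> \bar R})
                  (nu' : {finite_measure set (borel_sphere R n) -> \bar R}),
             finite_first_moment mu' ->
             (forall f, F f = integral_functional mu' nu' f) ->
             (forall A, measurable A -> mu' A = mu A) /\
             (forall B, measurable B -> nu' B = nu B)]) /\
  (forall (mu : {finite_measure set (borel_rV R n.+1) -> \bar R})
          (nu : {finite_measure set (borel_sphere R n) -> \bar R}),
     finite_first_moment mu ->
     let F := integral_functional mu nu in
     [/\ forall f, F f != -oo,
         linear_functional F,
         increasing_functional F,
         finite_somewhere F &
         monotone_continuous F]).
Proof.
split=> [F|]; [exact: functional_representation|exact: integral_functional_properties].
Qed.
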